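(* Let $M\in SL(3,\mathbb Z)$ have one real eigenvalue $\alpha>1$ and two complex conjugate eigenvalues $\beta\neq\bar\beta$, and let $X=S_M$ be the associated Inoue surface, equipped with the Tricerri metric and the canonical $\mathrm{spin}^c$ structure, with chiral Dirac operators $\mathcal D^{\pm}(X)$. Then neither $\mathcal D^{+}(X)$ nor $\mathcal D^{-}(X)$ has a spectral point in the annulus $\alpha^{-1/4}<|z|<\alpha^{1/4}$. Furthermore, the only spectral point of $\mathcal D^+(X)$ on the circle $|z|=\alpha^{-1/4}$ is $z=\alpha^{1/4}\beta$, and the only spectral point of $\mathcal D^+(X)$ on the circle $|z|=\alpha^{1/4}$ is $z=\alpha^{1/4}$ (in particular, these two points are spectral points of $\mathcal D^+(X)$).
   Context: Inoue surface $S_M$: let $\mathcal H=\{w=w_1+iw_2\in\mathbb C : w_2>0\}$. Let $a=(a_1,a_2,a_3)$ be a real eigenvector of $M$ for $\alpha$ and $b=(b_1,b_2,b_3)$ a complex eigenvector of $M$ for $\beta$ (column eigenvectors). Let $G_M$ be the group of transformations of $\mathcal H\times\mathbb C$ generated by $g_0(w,z)=(\alpha w,\beta z)$ and $g_i(w,z)=(w+a_i,z+b_i)$, $i=1,2,3$. The group $G_M$ acts freely and properly discontinuously, and $X=S_M=(\mathcal H\times\mathbb C)/G_M$ is a compact complex surface. Tricerri metric: the Hermitian metric on $X$ induced by the $G_M$-invariant metric $g=\dfrac{dw\otimes d\bar w}{w_2^2}+w_2\,dz\otimes d\bar z$ on $\mathcal H\times\mathbb C$. The function $f=\ln w_2/\ln\alpha$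 on $\mathcal H\times\mathbb C$ descends to a smooth map $f:X\to\mathbb R/\mathbb Z=S^1$, and $df$ is a well-defined closed $1$-form on $X$ whose class generates $H^1(X;\mathbb Z)=\mathbb Z$. Canonical $\mathrm{spin}^c$ structure: the spinor bundles are $\mathcal S^+=\Lambda^{0,0}(X)\oplus\Lambda^{0,2}(X)$ and $\mathcal S^-=\Lambda^{0,1}(X)$. The operators $\mathcal D^{+}(X):\Gamma(\mathcal S^+)\to\Gamma(\mathcal S^-)$ and $\mathcal D^-(X):\Gamma(\mathcal S^-)\to\Gamma(\mathcal S^+)$ are the associated chiral $\mathrm{spin}^c$ Dirac operators for the Tricerri metric (with the Chern connection on the determinant line bundle $K_X^{-1}$). They are formal adjoints of each other, and $\mathcal D^-(X)+\tfrac14\ln\alpha\cdot df=\sqrt2\,(\bar\partial\oplus\bar\partial^* )$, where $\bar\partial\oplus\bar\partial^*:\Omega^{0,1}(X)\to\Omega^{0,2}(X)\oplus\Omega^{0,0}(X)$, the adjoint $\bar\partial^*$ is taken with respect to the Tricerri metric, and $df$ acts by Clifford multiplication. Spectral points: $z\in\mathbb C^*$ is a spectral point of $\mathcal D^{\pm}(X)$ if and only if the operator $z^{f}\circ\mathcal D^{\pm}(X)\circ z^{-f}=\mathcal D^{\pm}(X)-\ln z\cdot df$ on $X$ has non-zero kernel, where $df$ acts by Clifford multiplication (this does not depend on the choice of the branch of $\ln z$). *)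

(* Defs.v *)
(* Real and complex analysis on the Stdlib reals with Coquelicot;
   MathComp supplies only the integer matrices. *)
From mathcomp Require Import all_boot all_algebra.
From mathcomp Require Import Rstruct.
From Stdlib Require Import Reals.
From Coquelicot Require Import Coquelicot.
Open Scope R_scope.

Definition int_to_R (n : int) : R := intmul (1 : R) n.

Definition is_eigenvector (M : 'M[int]_3) (lambda : C) (v : 'I_3 -> C) : Prop :=
  (exists i, v i <> 0) /\
  forall i, \big[Cplus/RtoC 0]_(j < 3) (RtoC (int_to_R (M i j)) * v j)%C
            = (lambda * v i)%C.

Definition Cexp (x : C) : C := (exp (Re x) * cos (Im x), exp (Re x) * sin (Im x)).

(* A point (w, z), or a real tangent vector at a point, given by its dw and dz
   components. Maps are total on C^2; only their values on H x C matter. *)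
Definition pt : Type := (C * C)%type.

Definition HxC (p : pt) : Prop := 0 < Im (fst p).

Definition im_w (p : pt) : R := Im (fst p).

Definition move (p X : pt) (t : R) : pt :=
  (fst p + RtoC t * fst X, snd p + RtoC t * snd X)%C.

Definition dirR (X : pt) (phi : pt -> R) (p : pt) : R :=
  Derive (fun t => phi (move p X t)) 0.

Definition dirC (X : pt) (F : pt -> C) (p : pt) : C :=
  (dirR X (fun q => Re (F q)) p, dirR X (fun q => Im (F q)) p).

Definition ex_dirC (X : pt) (F : pt -> C) (p : pt) : Prop :=
  ex_derive (fun t => Re (F (move p X t))) 0 /\
  ex_derive (fun t => Im (F (move p X t))) 0.

Fixpoint Ck (k : nat) (F : pt -> C) : Prop :=
  (forall p, HxC p -> continuous F p) /\
  match k with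
  | O => True
  | S k' => forall X : pt,
      (forall p, HxC p -> ex_dirC X F p) /\ Ck k' (dirC X F)
  end.

Definition smooth (F : pt -> C) : Prop := forall k, Ck k F.

Definition lie_bracket (X Y : pt -> pt) (p : pt) : pt :=
  let d (U V : pt -> pt) : pt :=
    (dirC (U p) (fun q => fst (V q)) p, dirC (U p) (fun q => snd (V q)) p) in
  (fst (d X Y) - fst (d Y X), snd (d X Y) - snd (d Y X))%C.

Definition tricerri (p X Y : pt) : R :=
  Re (fst X * Cconj (fst Y)) / im_w p ^ 2 + im_w p * Re (snd X * Cconj (snd Y)).

(* The orthonormal frame e_0, ..., e_3; here e_1 = J e_0 and e_3 = J e_2. *)
Definition frame (i : nat) (p : pt) : pt :=
  match i with
  | 0%nat => (RtoC (im_w p), RtoC 0)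
  | 1%nat => ((RtoC (im_w p) * Ci)%C, RtoC 0)
  | 2%nat => (RtoC 0, RtoC (/ sqrt (im_w p)))
  | _ => (RtoC 0, (RtoC (/ sqrt (im_w p)) * Ci)%C)
  end.

(* g (nabla_X Y, Z) for the Levi-Civita connection, by the Koszul formula *)
Definition levi_civita (X Y Z : pt -> pt) (p : pt) : R :=
  let D (U V W : pt -> pt) := dirR (U p) (fun q => tricerri q (V q) (W q)) p in
  let B (U V W : pt -> pt) := tricerri p (lie_bracket U V p) (W p) in
  (D X Y Z + D Y X Z - D Z X Y + B X Y Z - B X Z Y - B Y Z X) / 2.

(* The Chern connection of K^{-1} is d + (partial log h) in the holomorphic frame
   d/dw /\ d/dz of squared norm h. In the unitary frame (d/dw /\ d/dz) / sqrt h its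
   connection form is (partial - dbar)(log h) / 2, that is, X |-> -(i/2) d(log h)(J X). *)
Definition chern_anticanonical (X : pt) (p : pt) : C :=
  let h q := tricerri q (RtoC 1, RtoC 0) (RtoC 1, RtoC 0)
             * tricerri q (RtoC 0, RtoC 1) (RtoC 0, RtoC 1) in
  let JX : pt := ((Ci * fst X)%C, (Ci * snd X)%C) in
  (- (Ci / RtoC 2) * RtoC (dirR JX (fun q => ln (h q)) p))%C.

(* ((f, h), (u, v)) is the element f + h eta1 /\ eta2 + u eta1 + v eta2 of
   Lambda^{0,*} = S^+ (+) S^-, for the unitary (0,1)-coframe
   eta1 = conj(dw) / (sqrt 2 w_2),  eta2 = sqrt w_2 conj(dz) / sqrt 2. *)
Definition spinor : Type := ((C * C) * (C * C))%type.

Definition spinor_add (s t : spinor) : spinor := plus s t.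

Definition spinor_scale (c : C) (s : spinor) : spinor :=
  let '((f, h), (u, v)) := s in ((c * f, c * h), (c * u, c * v))%C.

(* c(X) = theta /\ - (theta /\)^*, where theta is sqrt 2 times the (0,1) part of the
   1-form metrically dual to X, equal to x1 eta1 + x2 eta2 with x1, x2 as below. *)
Definition clifford (p X : pt) (s : spinor) : spinor :=
  let '((f, h), (u, v)) := s in
  let x1 := (fst X / RtoC (im_w p))%C in
  let x2 := (RtoC (sqrt (im_w p)) * snd X)%C in
  ((- (Cconj x1 * u + Cconj x2 * v), x1 * v - x2 * u),
   (x1 * f + Cconj x2 * h, x2 * f - Cconj x1 * h))%C.

Definition clifford_d (phi : pt -> R) (p : pt) (s : spinor) : spinor :=
  sum_n (fun i => spinor_scale (RtoC (dirR (frame i p) phi p))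
                    (clifford p (frame i p) s)) 3.

Definition dirS (X : pt) (psi : pt -> spinor) (p : pt) : spinor :=
  ((dirC X (fun q => fst (fst (psi q))) p, dirC X (fun q => snd (fst (psi q))) p),
   (dirC X (fun q => fst (snd (psi q))) p, dirC X (fun q => snd (snd (psi q))) p)).

(* The spin^c connection in the unitary trivialization by 1, eta1 /\ eta2, eta1, eta2:
   nabla_{e_i} = e_i + (1/4) sum_{j,k} g(nabla^LC_{e_i} e_j, e_k) c(e_j) c(e_k)
                 + (1/2) A(e_i),
   with A the Chern connection form of the determinant line bundle K^{-1}. *)
Definition spinc_nabla (i : nat) (psi : pt -> spinor) (p : pt) : spinor :=
  spinor_add (dirS (frame i p) psi p)
    (spinor_add
      (sum_n (fun j => sum_n (fun k =>
         spinor_scale (RtoC (levi_civita (frame i) (frame j) (frame k) p / 4))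
           (clifford p (frame j p) (clifford p (frame k p) (psi p)))) 3) 3)
      (spinor_scale (chern_anticanonical (frame i p) p / RtoC 2)%C (psi p))).

(* D^+ (resp. D^-) is the restriction of [dirac] to S^+ (resp. S^-). *)
Definition dirac (psi : pt -> spinor) (p : pt) : spinor :=
  sum_n (fun i => clifford p (frame i p) (spinc_nabla i psi p)) 3.

(* [Deck p q r s] is the transformation (w, z) |-> (p w + q, r z + s). *)
Record deck : Type := Deck { dp : R; dq : R; dr : C; ds : C }.

Definition deck_act (g : deck) (x : pt) : pt :=
  (RtoC (dp g) * fst x + RtoC (dq g), dr g * snd x + ds g)%C.

Definition deck_comp (g g' : deck) : deck :=
  Deck (dp g * dp g') (dp g * dq g' + dq g)
       (dr g * dr g')%C (dr g * ds g' + ds g)%C.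

Definition deck_inv (g : deck) : deck :=
  Deck (/ dp g) (- dq g / dp g) (/ dr g)%C (- ds g / dr g)%C.

Inductive inoue_group (alpha : R) (beta : C) (a : 'I_3 -> R) (b : 'I_3 -> C)
  : deck -> Prop :=
| inoue_g0 : inoue_group alpha beta a b (Deck alpha 0 beta (RtoC 0))
| inoue_gi (i : 'I_3) : inoue_group alpha beta a b (Deck 1 (a i) (RtoC 1) (b i))
| inoue_comp (g g' : deck) :
    inoue_group alpha beta a b g -> inoue_group alpha beta a b g' ->
    inoue_group alpha beta a b (deck_comp g g')
| inoue_inv (g : deck) :
    inoue_group alpha beta a b g -> inoue_group alpha beta a b (deck_inv g).

(* An element of Omega^{0,*}(H x C) in holomorphic coordinates: ((f, h), (u, v)) stands for
   f + h conj(dw) /\ conj(dz) + u conj(dw) + v conj(dz). *)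
Definition form : Type := pt -> ((C * C) * (C * C))%type.

Definition smooth_form (omega : form) : Prop :=
  smooth (fun p => fst (fst (omega p))) /\ smooth (fun p => snd (fst (omega p))) /\
  smooth (fun p => fst (snd (omega p))) /\ smooth (fun p => snd (snd (omega p))).

Definition pullback (g : deck) (omega : form) : form := fun x =>
  let '((f, h), (u, v)) := omega (deck_act g x) in
  ((f, h * (RtoC (dp g) * Cconj (dr g))), (u * RtoC (dp g), v * Cconj (dr g)))%C.

(* Smooth forms on X are the smooth G_M-invariant forms on H x C. *)
Definition descends (G : deck -> Prop) (omega : form) : Prop :=
  smooth_form omega /\
  forall g, G g -> forall p, HxC p -> pullback g omega p = omega p.

Definition spinor_of_form (omega : form) (p : pt) : spinor :=
  let '((f, h), (u, v)) := omega p in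
  ((f, RtoC (2 * sqrt (im_w p)) * h),
   (RtoC (sqrt 2 * im_w p) * u, RtoC (sqrt 2 / sqrt (im_w p)) * v))%C.

Definition section_plus (omega : form) : Prop :=
  forall p, HxC p -> snd (omega p) = (RtoC 0, RtoC 0).

Definition section_minus (omega : form) : Prop :=
  forall p, HxC p -> fst (omega p) = (RtoC 0, RtoC 0).

Definition twisted_dirac (alpha : R) (logz : C) (psi : pt -> spinor) (p : pt) : spinor :=
  spinor_add (dirac psi p)
    (spinor_scale (- logz)%C
       (clifford_d (fun q => ln (im_w q) / ln alpha) p (psi p))).

(* [chi] selects the half-spinor bundle; the choice of logarithm is immaterial. *)
Definition spectral_point (chi : form -> Prop) (alpha : R) (beta : C)
    (a : 'I_3 -> R) (b : 'I_3 -> C) (z : C) : Prop :=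
  exists logz : C, Cexp logz = z /\
  exists omega : form,
    descends (inoue_group alpha beta a b) omega /\
    chi omega /\
    (exists p, HxC p /\ omega p <> zero) /\
    (forall p, HxC p -> twisted_dirac alpha logz (spinor_of_form omega) p = zero).

Definition spectral_point_plus := spectral_point section_plus.
Definition spectral_point_minus := spectral_point section_minus.

(* Main.v *)
(* In the frame e_i the Levi-Civita terms of the Dirac operator cancel. With t = Im w and
   logz = lambda ln(alpha), a twisted kernel element becomes, after multiplication by powers
   of t, a pair (F, G) of functions on H x C with
     F_t = i F_x + (i c1 / t) d^s G,   G_t = - i G_x + (i c2 / t^2) d^(-s) F,   c1, c2 > 0,
   where d^s is d/dz or d/d(conj z), according to s = 1 or s = -1. Both functions are
   periodic for the lattice of translations and automorphic under (w, z) |-> (alpha w, beta z).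
   For any such pair, the integral of Re (i d^(-s) F conj G) over the 3-torus fibre is
   nondecreasing in t. Apply this to the mixed difference of (F, G) in the directions of x
   and z. By automorphy its value at t = alpha^n is governed by differences with steps
   L / alpha^n and z / beta^n on the fibre t = 1; one of the steps tends to 0 as n -> +oo, the
   other as n -> -oo, and in the closed annulus this beats the automorphy factor. So the
   monotone quantity tends to 0 at both ends and vanishes, whence so does its derivative.
   The periods alpha^n a_i and beta^n b_i accumulate at 0, so F and G are constant on the
   fibres, hence constant, and the automorphy factors then determine z. *)
Require Import Defs.
From mathcomp Require Import all_boot all_algebra.
From mathcomp Require Import Rstruct.
From Stdlib Require Import Reals ZArith Lra Lia ClassicalEpsilon Classical.
From Coquelicot Require Import Coquelicot.
Open Scope R_scope.

(** * Calculus on the half-space *)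

(** Let kappa = |mu nu / beta|, with mu and nu the multipliers of F and G. Automorphy bounds the
    monotone quantity at t = alpha^n by a multiple of kappa^n, which never tends to 0 at both ends;
    this is the obstacle. The quantity is quadratic, so a difference in x gains alpha^(-2n) at t =
    alpha^n and one in z gains |beta|^(2n) = alpha^(-n) at t = alpha^(-n). The mixed difference has
    both gains, and suffices for 1/alpha < kappa < alpha^2. Monotonicity holds because the terms in
    F_x and G_x form Jacobians, of integral zero on a torus, and only |d^s G|^2 and |d^(-s) F|^2
    remain. When these vanish, one more Jacobian argument makes the mixed difference independent of
    z. The two differences are then undone one at a time: a difference has fibre mean zero, hence
    vanishes once it is constant. No torus is formed: fibre integrals are iterated means over three
    periods, and bounds on a fibre come from integrals of derivatives. *)

Lemma pt_ext (a b c d a' b' c' d' : R) :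
  a = a' -> b = b' -> c = c' -> d = d' -> ((a, b), (c, d)) = ((a', b'), (c', d')).
Proof. congruence. Qed.

Lemma moveE (p X : pt) (s : R) :
  move p X s = ((fst (fst p) + s * fst (fst X), snd (fst p) + s * snd (fst X)),
                (fst (snd p) + s * fst (snd X), snd (snd p) + s * snd (snd X))).
Proof.
  destruct p as [[x t] [y1 y2]], X as [[a b] [c d]]; unfold move, Cplus, Cmult, RtoC; simpl.
  apply pt_ext; ring.
Qed.

Lemma move0 (p X : pt) : move p X 0 = p.
Proof.
  rewrite moveE; destruct p as [[x t] [y1 y2]], X as [[a b] [c d]]; simpl.
  apply pt_ext; ring.
Qed.

Lemma move_move (p X : pt) (r s : R) : move (move p X r) X s = move p X (r + s).
Proof. rewrite !moveE; simpl; apply pt_ext; ring. Qed.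

Lemma moveC (p X Y : pt) (r s : R) : move (move p X r) Y s = move (move p Y s) X r.
Proof. rewrite !moveE; simpl; apply pt_ext; ring. Qed.

Notation pt_space := (prod_UniformSpace C_UniformSpace C_UniformSpace).
Notation R2_space := (prod_UniformSpace R_UniformSpace R_UniformSpace).

Lemma continuous_pt {U : UniformSpace} (a b c d : U -> R) (u : U) :
  continuous a u -> continuous b u -> continuous c u -> continuous d u ->
  @continuous U pt_space
    (fun u => ((a u, b u), (c u, d u)) : pt) u.
Proof.
  intros Ha Hb Hc Hd P [e He].
  apply filterlim_locally with (eps := e) in Ha, Hb, Hc, Hd.
  change (locally u (fun v => P ((a v, b v), (c v, d v)))).
  generalize (filter_and _ _ (filter_and _ _ Ha Hb) (filter_and _ _ Hc Hd)).
  apply filter_imp; intros v [[h1 h2] [h3 h4]].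
  apply He; split; split; assumption.
Qed.

Lemma continuous_coords {U : UniformSpace} (f : U -> pt) (u : U) :
  @continuous U pt_space f u ->
  (continuous (fun u => fst (fst (f u))) u /\ continuous (fun u => snd (fst (f u))) u) /\
  (continuous (fun u => fst (snd (f u))) u /\ continuous (fun u => snd (snd (f u))) u).
Proof.
  intros H; split; split; apply filterlim_locally; intros e;
  generalize (proj1 (filterlim_locally _ _) H e); apply filter_imp;
  intros v [[h1 h2] [h3 h4]]; assumption.
Qed.

Lemma continuous_move_fun {U : UniformSpace} (f : U -> pt) (s : U -> R) (X : pt) (u : U) :
  @continuous U pt_space f u -> continuous s u ->
  @continuous U pt_space (fun u => move (f u) X (s u)) u.
Proof.
  intros Hf Hs; destruct (continuous_coords _ _ Hf) as [[h1 h2] [h3 h4]].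
  apply (continuous_ext (fun u =>
    ((fst (fst (f u)) + s u * fst (fst X), snd (fst (f u)) + s u * snd (fst X)),
     (fst (snd (f u)) + s u * fst (snd X), snd (snd (f u)) + s u * snd (snd X))))).
  { intros v; symmetry; apply moveE. }
  apply continuous_pt;
    (apply (continuous_plus (K := R_AbsRing) (V := R_NormedModule)); [assumption|];
     apply (continuous_mult (K := R_AbsRing)); [assumption|apply continuous_const]).
Qed.

Lemma open_HxC (p : pt) : HxC p ->
  @locally pt_space p HxC.
Proof.
  intros H; exists (mkposreal _ H); intros q [[_ h] _].
  unfold HxC in *; unfold ball in h; simpl in h; unfold AbsRing_ball, abs, minus, plus, opp in h; simpl in h.
  apply Rabs_def2 in h; unfold Im in *; lra.
Qed.

Lemma HxC_move_near (p X : pt) : HxC p -> locally 0 (fun s : R => HxC (move p X s)).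
Proof.
  intros H.
  assert (Hc := @continuous_move_fun R_UniformSpace (fun _ => p) (fun s => s) X 0
     (continuous_const _ _) (continuous_id _)).
  apply Hc; rewrite move0; now apply open_HxC.
Qed.

Lemma HxC_move2_near (p X Y : pt) : HxC p ->
  locally ((0, 0) : R * R) (fun z : R * R => HxC (move (move p X (fst z)) Y (snd z))).
Proof.
  intros H.
  assert (Hc := @continuous_move_fun R2_space
     (fun z => move p X (fst z)) (fun z => snd z) Y (0, 0)
     (continuous_move_fun (U := R2_space) (fun _ => p) (fun z => fst z) X (0,0)
        (continuous_const _ _) (continuous_fst _ _)) (continuous_snd _ _)).
  apply Hc; simpl; rewrite !move0; now apply open_HxC.
Qed.

(* Locked, so that failing unification problems never unfold [Derive]. *)
Fact dird_key : unit.
Proof. exact tt. Qed.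

Definition dird : pt -> (pt -> R) -> pt -> R := locked_with dird_key dirR.

Lemma dirdE : dird = dirR.
Proof. exact (locked_withE dird_key dirR). Qed.

(** [Ck] for one real component: complex maps are handled through their real and imaginary parts, so
    that one-variable real calculus is enough. [csmooth_smooth] makes the link with [smooth]. *)
Fixpoint CkR (k : nat) (phi : pt -> R) : Prop :=
  (forall p, HxC p -> @continuous pt_space R_UniformSpace phi p) /\
  match k with
  | O => True
  | S k' => forall X : pt,
      (forall p, HxC p -> ex_derive (fun s => phi (move p X s)) 0) /\ CkR k' (dird X phi)
  end.

Definition smoothR (phi : pt -> R) : Prop := forall k, CkR k phi.

(** Total maps may take any values off the half-space; since it is open, derivatives at its points
    see only what happens inside. *)
Lemma dirR_ext (X : pt) (phi psi : pt -> R) (p : pt) :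
  (forall q, HxC q -> phi q = psi q) -> HxC p -> dird X phi p = dird X psi p.
Proof.
  intros E H; rewrite !dirdE; apply Derive_ext_loc; generalize (HxC_move_near p X H).
  apply filter_imp; intros s; apply E.
Qed.

Lemma CkR_ext (k : nat) : forall phi psi : pt -> R,
  (forall q, HxC q -> phi q = psi q) -> CkR k phi -> CkR k psi.
Proof.
  induction k as [|k IH]; intros phi psi E [Hc Hd].
  - split; [|exact I]; intros p Hp.
    apply (@continuous_ext_loc pt_space R_UniformSpace psi phi p); [|now apply Hc].
    generalize (open_HxC p Hp); apply filter_imp; intros q Hq; now apply E.
  - split.
    + intros p Hp; apply (@continuous_ext_loc pt_space R_UniformSpace psi phi p); [|now apply Hc].
      generalize (open_HxC p Hp); apply filter_imp; intros q Hq; now apply E.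
    + intros X; destruct (Hd X) as [H1 H2]; split.
      * intros p Hp; apply (ex_derive_ext_loc (fun s => phi (move p X s))); [|now apply H1].
        generalize (HxC_move_near p X Hp); apply filter_imp; intros s; apply E.
      * apply (IH (dird X phi)); [|exact H2].
        intros q Hq; now apply dirR_ext.
Qed.

Lemma CkR_cont (k : nat) (phi : pt -> R) (p : pt) : CkR k phi -> HxC p ->
  @continuous pt_space R_UniformSpace phi p.
Proof. destruct k; intros [H _]; apply H. Qed.

Lemma CkR_S (k : nat) : forall phi, CkR (S k) phi -> CkR k phi.
Proof.
  induction k as [|k IH]; intros phi [Hc Hd]; split; try exact Hc; [exact I|].
  intros X; destruct (Hd X) as [H1 H2]; split; [exact H1|now apply IH].
Qed.

Lemma smoothR_ext (phi psi : pt -> R) :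
  (forall q, HxC q -> phi q = psi q) -> smoothR phi -> smoothR psi.
Proof. intros E H k; exact (CkR_ext k phi psi E (H k)). Qed.

Lemma smoothR_cont (phi : pt -> R) (p : pt) : smoothR phi -> HxC p ->
  @continuous pt_space R_UniformSpace phi p.
Proof. intros H; exact (CkR_cont 0 phi p (H 0%nat)). Qed.

Lemma smoothR_dirR (X : pt) (phi : pt -> R) : smoothR phi -> smoothR (dird X phi).
Proof. intros H k; exact (proj2 (proj2 (H (S k)) X)). Qed.

Lemma smoothR_is_derive0 (X : pt) (phi : pt -> R) (p : pt) : smoothR phi -> HxC p ->
  is_derive (fun s => phi (move p X s)) 0 (dird X phi p).
Proof.
  intros H Hp; rewrite dirdE; apply Derive_correct; exact (proj1 (proj2 (H 1%nat) X) p Hp).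
Qed.

Lemma smoothR_is_derive (X : pt) (phi : pt -> R) (p : pt) (s : R) :
  smoothR phi -> HxC (move p X s) ->
  is_derive (fun s => phi (move p X s)) s (dird X phi (move p X s)).
Proof.
  intros H Hp.
  apply (is_derive_ext (fun r => (fun u => phi (move (move p X s) X u)) (r - s))).
  { intros r; simpl; rewrite move_move; do 2 f_equal; ring. }
  assert (E := smoothR_is_derive0 X phi _ H Hp).
  evar_last.
  - apply (is_derive_comp (fun u => phi (move (move p X s) X u)) (fun r => r - s)).
    + replace (s - s) with 0 by ring; exact E.
    + auto_derive; [trivial|reflexivity].
  - simpl; unfold scal; simpl; unfold mult; simpl; ring.
Qed.

Lemma dirR_eq (X : pt) (phi : pt -> R) (p : pt) (l : R) :
  is_derive (fun s => phi (move p X s)) 0 l -> dird X phi p = l.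
Proof. rewrite dirdE; apply is_derive_unique. Qed.

Lemma CkR_const (c : R) (k : nat) : CkR k (fun _ => c).
Proof.
  revert c; induction k as [|k IH]; intros c; (split; [intros; apply continuous_const|]); [exact I|].
  intros X; split; [intros; apply ex_derive_const|].
  apply (CkR_ext k (fun _ => 0)); [|apply IH].
  intros q _; symmetry; rewrite dirdE; exact (Derive_const c 0).
Qed.

Lemma smoothR_const (c : R) : smoothR (fun _ => c).
Proof. intros k; apply CkR_const. Qed.

Lemma CkR_plus (k : nat) : forall phi psi, CkR k phi -> CkR k psi ->
  CkR k (fun p => phi p + psi p).
Proof.
  induction k as [|k IH]; intros phi psi H1 H2.
  - split; [|exact I]; intros p Hp.
    apply (continuous_plus (K := R_AbsRing) (V := R_NormedModule)); now apply (CkR_cont 0).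
  - split.
    + intros p Hp.
      apply (continuous_plus (K := R_AbsRing) (V := R_NormedModule)); now apply (CkR_cont (S k)).
    + intros X; destruct (proj2 H1 X) as [E1 D1], (proj2 H2 X) as [E2 D2]; split.
      * intros p Hp; apply: ex_derive_plus; auto.
      * apply (CkR_ext k (fun p => dird X phi p + dird X psi p)); [|now apply IH].
        intros q Hq; symmetry; rewrite !dirdE /dirR; apply Derive_plus; auto.
Qed.

Lemma CkR_mult (k : nat) : forall phi psi, CkR k phi -> CkR k psi ->
  CkR k (fun p => phi p * psi p).
Proof.
  induction k as [|k IH]; intros phi psi H1 H2.
  - split; [|exact I]; intros p Hp.
    apply (continuous_mult (K := R_AbsRing)); now apply (CkR_cont 0).
  - split.
    + intros p Hp.
      apply (continuous_mult (K := R_AbsRing)); now apply (CkR_cont (S k)).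
    + intros X; destruct (proj2 H1 X) as [E1 D1], (proj2 H2 X) as [E2 D2]; split.
      * intros p Hp; apply ex_derive_mult; auto.
      * apply (CkR_ext k (fun p => dird X phi p * psi p + phi p * dird X psi p)).
        { intros q Hq; symmetry; rewrite !dirdE /dirR; rewrite Derive_mult; auto; now rewrite !move0. }
        apply CkR_plus; apply IH; trivial; now apply CkR_S.
Qed.

Lemma smoothR_plus (phi psi : pt -> R) : smoothR phi -> smoothR psi ->
  smoothR (fun p => phi p + psi p).
Proof. intros H1 H2 k; now apply CkR_plus. Qed.

Lemma smoothR_mult (phi psi : pt -> R) : smoothR phi -> smoothR psi ->
  smoothR (fun p => phi p * psi p).
Proof. intros H1 H2 k; now apply CkR_mult. Qed.

Lemma smoothR_scal (c : R) (phi : pt -> R) : smoothR phi -> smoothR (fun p => c * phi p).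
Proof. apply (smoothR_mult (fun _ => c)); apply smoothR_const. Qed.

Lemma smoothR_opp (phi : pt -> R) : smoothR phi -> smoothR (fun p => - phi p).
Proof.
  intros H; apply (smoothR_ext (fun p => -1 * phi p)); [intros; ring|now apply smoothR_scal].
Qed.

Lemma smoothR_minus (phi psi : pt -> R) : smoothR phi -> smoothR psi ->
  smoothR (fun p => phi p - psi p).
Proof. intros H1 H2; apply smoothR_plus; [easy|now apply smoothR_opp]. Qed.

Lemma dirR_const (X : pt) (c : R) (p : pt) : dird X (fun _ => c) p = 0.
Proof. rewrite dirdE; exact (Derive_const c 0). Qed.

Lemma dirR_plus (X : pt) (phi psi : pt -> R) (p : pt) :
  smoothR phi -> smoothR psi -> HxC p ->
  dird X (fun q => phi q + psi q) p = dird X phi p + dird X psi p.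
Proof.
  intros H1 H2 Hp; rewrite !dirdE /dirR; apply Derive_plus; eexists; now apply smoothR_is_derive0.
Qed.

Lemma dirR_minus (X : pt) (phi psi : pt -> R) (p : pt) :
  smoothR phi -> smoothR psi -> HxC p ->
  dird X (fun q => phi q - psi q) p = dird X phi p - dird X psi p.
Proof.
  intros H1 H2 Hp; rewrite !dirdE /dirR; apply Derive_minus; eexists; now apply smoothR_is_derive0.
Qed.

Lemma dirR_mult (X : pt) (phi psi : pt -> R) (p : pt) :
  smoothR phi -> smoothR psi -> HxC p ->
  dird X (fun q => phi q * psi q) p = dird X phi p * psi p + phi p * dird X psi p.
Proof.
  intros H1 H2 Hp; rewrite !dirdE /dirR; rewrite Derive_mult; [now rewrite !move0|eexists..];
  now apply smoothR_is_derive0.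
Qed.

Lemma dirR_scal (X : pt) (c : R) (phi : pt -> R) (p : pt) :
  dird X (fun q => c * phi q) p = c * dird X phi p.
Proof. rewrite !dirdE /dirR; apply Derive_scal. Qed.

(** Tangent to the level sets of Im w: lines in such a direction never leave the half-space and keep
    the height t. *)
Definition translation (v : pt) : Prop := Im (fst v) = 0.

Lemma HxC_translation (p v : pt) (s : R) : translation v -> HxC p -> HxC (move p v s).
Proof.
  unfold translation, HxC; rewrite moveE; unfold Im; simpl; intros -> H; lra.
Qed.

Lemma CkR_shift (v : pt) (k : nat) : translation v -> forall phi, CkR k phi ->
  CkR k (fun p => phi (move p v 1)).
Proof.
  intros Hv.
  assert (C : forall phi p, (forall p, HxC p -> @continuous pt_space R_UniformSpace phi p) -> HxC p ->
    @continuous pt_space R_UniformSpace (fun p => phi (move p v 1)) p).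
  { intros phi p H Hp.
    apply (continuous_comp (fun p => move p v 1) phi); [|now apply H, HxC_translation].
    apply (continuous_move_fun (U := pt_space) (fun p => p) (fun _ => 1)).
    apply continuous_id. apply continuous_const. }
  induction k as [|k IH]; intros phi [Hc Hd]; (split; [intros; now apply C|]); [exact I|].
  intros X; destruct (Hd X) as [E D]; split.
  - intros p Hp; apply (ex_derive_ext (fun s => phi (move (move p v 1) X s))).
    { intros s; now rewrite moveC. }
    now apply E, HxC_translation.
  - apply (CkR_ext k (fun p => dird X phi (move p v 1))); [|now apply IH].
    intros q Hq; rewrite !dirdE /dirR; apply Derive_ext; intros s; now rewrite moveC.
Qed.

Lemma smoothR_shift (v : pt) (phi : pt -> R) : translation v -> smoothR phi ->
  smoothR (fun p => phi (move p v 1)).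
Proof. intros Hv H k; now apply CkR_shift. Qed.

Lemma dirR_shift (v X : pt) (phi : pt -> R) (p : pt) :
  dird X (fun q => phi (move q v 1)) p = dird X phi (move p v 1).
Proof. rewrite !dirdE /dirR; apply Derive_ext; intros s; now rewrite moveC. Qed.

Lemma continuous_move2 (X Y p : pt) (phi : pt -> R) (u v : R) : smoothR phi ->
  HxC (move (move p X u) Y v) ->
  continuous (fun z : R * R => phi (move (move p X (fst z)) Y (snd z))) (u, v).
Proof.
  intros H Hp.
  apply (continuous_comp (V := pt_space)
    (fun z : R * R => move (move p X (fst z)) Y (snd z)) phi);
    [|now apply smoothR_cont].
  apply (continuous_move_fun (U := R2_space)); [|apply continuous_snd].
  apply (continuous_move_fun (U := R2_space)); [apply continuous_const|apply continuous_fst].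
Qed.

Definition lincomb (r : R) (X : pt) (s : R) (Y : pt) : pt :=
  (RtoC r * fst X + RtoC s * fst Y, RtoC r * snd X + RtoC s * snd Y)%C.

Lemma move_lincomb (p X Y : pt) (r s u : R) :
  move p (lincomb r X s Y) u = move (move p X (r * u)) Y (s * u).
Proof.
  rewrite !moveE; destruct X as [[x1 x2] [x3 x4]], Y as [[y1 y2] [y3 y4]]; simpl.
  apply pt_ext; ring.
Qed.

(** Linearity in the direction is not built into [CkR], which differentiates along one direction at
    a time. It follows from differentiability in two variables: one partial derivative exists nearby
    and is continuous, the other exists at the point. *)
Lemma dirR_lincomb (r s : R) (X Y : pt) (phi : pt -> R) (p : pt) : smoothR phi -> HxC p ->
  dird (lincomb r X s Y) phi p = r * dird X phi p + s * dird Y phi p.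
Proof.
  intros H Hp; apply dirR_eq.
  set (f := fun u v => phi (move (move p Y v) X u)).
  assert (D : differentiable_pt_lim f 0 0 (dird X phi p) (dird Y phi p)).
  { apply filterdiff_differentiable_pt_lim.
    assert (F := is_derive_filterdiff f 0 0 (fun u v => dird X phi (move (move p Y v) X u)) (dird Y phi p)).
    rewrite !move0 in F. apply F; clear F.
    - generalize (HxC_move2_near p X Y Hp); apply filter_imp; intros [u v] Hz; simpl in *.
      unfold f; apply smoothR_is_derive; trivial; now rewrite moveC.
    - unfold f; apply (is_derive_ext (fun v => phi (move p Y v))).
      { intros v; now rewrite move0. }
      now apply smoothR_is_derive0.
    - apply (continuous_ext (fun z : R * R => dird X phi (move (move p X (fst z)) Y (snd z)))).
      { intros z; now rewrite moveC. }
      apply continuous_move2; [now apply smoothR_dirR|now rewrite !move0]. }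
  apply is_derive_Reals.
  apply (derivable_pt_lim_ext (fun u => f (r * u) (s * u))).
  { intros u; unfold f; rewrite move_lincomb; now rewrite moveC. }
  replace (r * dird X phi p + s * dird Y phi p) with (dird X phi p * r + dird Y phi p * s) by ring.
  apply derivable_pt_lim_comp_2d.
  - now rewrite !Rmult_0_r.
  - apply is_derive_Reals; auto_derive; trivial; ring.
  - apply is_derive_Reals; auto_derive; trivial; ring.
Qed.

(** Schwarz's theorem in the parameters of the two directions; the derivatives that it asks for
    exist on a neighbourhood because the half-space is open. *)
Lemma dirRC (X Y : pt) (phi : pt -> R) (p : pt) : smoothR phi -> HxC p ->
  dird X (dird Y phi) p = dird Y (dird X phi) p.
Proof.
  intros H Hp.
  set (f := fun u v => phi (move (move p X u) Y v)).
  assert (E1 : forall u v, HxC (move (move p X u) Y v) ->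
     is_derive (fun v => f u v) v (dird Y phi (move (move p X u) Y v))).
  { intros u v Hz; now apply smoothR_is_derive. }
  assert (E2 : forall u v, HxC (move (move p X u) Y v) ->
     is_derive (fun u => f u v) u (dird X phi (move (move p X u) Y v))).
  { intros u v Hz; apply (is_derive_ext (fun u => phi (move (move p Y v) X u))).
    { intros w; unfold f; now rewrite moveC. }
    rewrite moveC in Hz |- *; now apply smoothR_is_derive. }
  assert (N : forall u v, HxC (move (move p X u) Y v) ->
    locally ((u, v) : R * R) (fun z : R * R => HxC (move (move p X (fst z)) Y (snd z)))).
  { intros u v Hz.
    assert (Hc := @continuous_move_fun R2_space
     (fun z => move p X (fst z)) (fun z => snd z) Y (u, v)
     (continuous_move_fun (U := R2_space) (fun _ => p) (fun z => fst z) X (u, v)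
        (continuous_const _ _) (continuous_fst _ _)) (continuous_snd _ _)).
    apply Hc; now apply open_HxC. }
  assert (E12 : forall u v, HxC (move (move p X u) Y v) ->
     is_derive (fun u => Derive (fun v => f u v) v) u (dird X (dird Y phi) (move (move p X u) Y v))).
  { intros u v Hz.
    apply (is_derive_ext_loc (fun u => dird Y phi (move (move p Y v) X u))).
    { generalize (locally_2d_1d_const_y _ _ _ (proj2 (locally_2d_locally (fun u v => HxC (move (move p X u) Y v)) _ _) (N u v Hz))).
      apply filter_imp; intros w Hw; symmetry; rewrite moveC; now apply is_derive_unique, E1. }
    rewrite moveC in Hz |- *; apply smoothR_is_derive; [now apply smoothR_dirR|exact Hz]. }
  assert (E21 : forall u v, HxC (move (move p X u) Y v) ->
     is_derive (fun v => Derive (fun u => f u v) u) v (dird Y (dird X phi) (move (move p X u) Y v))).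
  { intros u v Hz.
    apply (is_derive_ext_loc (fun v => dird X phi (move (move p X u) Y v))).
    { generalize (locally_2d_1d_const_x _ _ _ (proj2 (locally_2d_locally (fun u v => HxC (move (move p X u) Y v)) _ _) (N u v Hz))).
      apply filter_imp; intros w Hw; symmetry; now apply is_derive_unique, E2. }
    apply smoothR_is_derive; [now apply smoothR_dirR|exact Hz]. }
  assert (H0 : HxC (move (move p X 0) Y 0)) by now rewrite !move0.
  assert (S := Schwarz f 0 0).
  rewrite (is_derive_unique _ _ _ (E12 0 0 H0)) in S.
  rewrite (is_derive_unique _ _ _ (E21 0 0 H0)) in S.
  rewrite !move0 in S; apply S; clear S.
  - apply locally_2d_locally; generalize (N 0 0 H0); apply filter_imp; intros [u v] Hz; simpl in *.
    repeat split; eexists; [apply (E2 u v Hz)|apply (E1 u v Hz)|apply (E12 u v Hz)|apply (E21 u v Hz)].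
  - apply (continuity_2d_pt_ext_loc (fun u v => dird X (dird Y phi) (move (move p X u) Y v))).
    + apply locally_2d_locally; generalize (N 0 0 H0); apply filter_imp; intros [u v] Hz; symmetry.
      exact (is_derive_unique _ _ _ (E12 u v Hz)).
    + apply continuity_2d_pt_filterlim; apply (continuous_move2 X Y p (dird X (dird Y phi)) 0 0); trivial.
      now do 2 apply smoothR_dirR.
  - apply (continuity_2d_pt_ext_loc (fun u v => dird Y (dird X phi) (move (move p X u) Y v))).
    + apply locally_2d_locally; generalize (N 0 0 H0); apply filter_imp; intros [u v] Hz; symmetry.
      exact (is_derive_unique _ _ _ (E21 u v Hz)).
    + apply continuity_2d_pt_filterlim; apply (continuous_move2 X Y p (dird Y (dird X phi)) 0 0); trivial.
      now do 2 apply smoothR_dirR.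
Qed.

(** * Averages along translations *)

(** Locked for the same reason as [dird]: unification must not open the integral. *)
Fact average_key : unit.
Proof. exact tt. Qed.

Definition average : pt -> (pt -> R) -> pt -> R := locked_with average_key
  (fun v phi p => RInt (fun s => phi (move p v s)) 0 1).

Lemma averageE (v p : pt) (phi : pt -> R) :
  average v phi p = RInt (fun s => phi (move p v s)) 0 1.
Proof. exact (f_equal (fun F => F v phi p) (locked_withE average_key _)). Qed.

Lemma continuous_line (v p : pt) (phi : pt -> R) (s : R) :
  translation v -> smoothR phi -> HxC p -> continuous (fun s => phi (move p v s)) s.
Proof.
  intros Hv H Hp; apply: ex_derive_continuous; eexists.
  now apply smoothR_is_derive; [|apply HxC_translation].
Qed.

Lemma ex_RInt_line (v p : pt) (phi : pt -> R) (a b : R) :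
  translation v -> smoothR phi -> HxC p -> ex_RInt (fun s => phi (move p v s)) a b.
Proof.
  intros Hv H Hp; apply: ex_RInt_continuous; intros z _; now apply continuous_line.
Qed.

Lemma average_ext (v p : pt) (phi psi : pt -> R) : translation v -> HxC p ->
  (forall q, HxC q -> phi q = psi q) -> average v phi p = average v psi p.
Proof.
  intros Hv Hp E; rewrite !averageE; apply RInt_ext; intros s _; now apply E, HxC_translation.
Qed.

(** The tube lemma: continuity is uniform along a compact segment. It makes averages continuous in
    the base point. *)
Lemma line_tube (v p : pt) (phi : pt -> R) (eps : posreal) :
  translation v -> smoothR phi -> HxC p ->
  @locally pt_space p
    (fun q => forall s, 0 <= s <= 1 -> Rabs (phi (move q v s) - phi (move p v s)) <= eps).
Proof.
  intros Hv H Hp.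
  assert (L : forall s0 : R, exists d : posreal, forall (q : pt) (s : R),
    @ball pt_space p d q -> Rabs (s - s0) < d ->
    Rabs (phi (move q v s) - phi (move p v s0)) < eps / 2).
  { intros s0.
    assert (C : @continuous (prod_UniformSpace pt_space R_UniformSpace)
      R_UniformSpace (fun z => phi (move (fst z) v (snd z))) (p, s0)).
    { apply (continuous_comp (V := pt_space)
        (fun z : pt * R => move (fst z) v (snd z)) phi).
      - apply (continuous_move_fun (U := prod_UniformSpace pt_space R_UniformSpace)).
        + apply continuous_fst.
        + apply continuous_snd.
      - apply smoothR_cont; trivial; now apply HxC_translation. }
    destruct (proj1 (filterlim_locally _ _) C (pos_div_2 eps)) as [d Hd].
    exists d; intros q s Hq Hs; exact (Hd (q, s) (conj Hq Hs)). }
  destruct (choice _ L) as [delta Hdelta].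
  destruct (compactness_value_1d 0 1 delta) as [d Hd].
  exists d; intros q Hq s Hs.
  (* The covering lemma gives the centre [s0] only under a double negation. *)
  destruct (NNPP _ (Hd s Hs)) as [s0 [Hs0 [Hss Hle]]].
  assert (B1 := Hdelta s0 q s (ball_le p d (delta s0) Hle q Hq) Hss).
  assert (B2 := Hdelta s0 p s (ball_center p (delta s0)) Hss).
  apply Rabs_def2 in B1; apply Rabs_def2 in B2; apply Rabs_le; lra.
Qed.

Lemma continuous_average (v p : pt) (phi : pt -> R) :
  translation v -> smoothR phi -> HxC p ->
  @continuous pt_space R_UniformSpace (average v phi) p.
Proof.
  intros Hv H Hp; apply filterlim_locally; intros eps.
  generalize (filter_and _ _ (open_HxC p Hp) (line_tube v p phi (pos_div_2 eps) Hv H Hp)).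
  apply filter_imp; intros q [Hq Hs].
  assert (E : average v phi q - average v phi p
              = RInt (fun s => phi (move q v s) - phi (move p v s)) 0 1).
  { rewrite !averageE; symmetry; apply: RInt_minus; now apply ex_RInt_line. }
  unfold ball; simpl; unfold AbsRing_ball, abs, minus, plus, opp; simpl.
  fold (average v phi q - average v phi p); rewrite E.
  apply Rle_lt_trans with ((1 - 0) * (eps / 2)).
  - apply abs_RInt_le_const; [lra| |exact Hs].
    apply: ex_RInt_minus; now apply ex_RInt_line.
  - destruct eps as [e He]; simpl; lra.
Qed.

Lemma is_derive_average (v X p : pt) (phi : pt -> R) :
  translation v -> smoothR phi -> HxC p ->
  is_derive (fun u => average v phi (move p X u)) 0 (average v (dird X phi) p).
Proof.
  intros Hv H Hp.
  assert (E : forall u s, HxC (move p X u) ->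
    is_derive (fun u => phi (move (move p X u) v s)) u (dird X phi (move (move p X u) v s))).
  { intros u s Hu; apply (is_derive_ext (fun u => phi (move (move p v s) X u))).
    { intros w; now rewrite moveC. }
    rewrite moveC; apply smoothR_is_derive; trivial; rewrite moveC.
    now apply HxC_translation. }
  assert (D : is_derive (fun u => average v phi (move p X u)) 0
    (RInt (fun s => Derive (fun u => phi (move (move p X u) v s)) 0) 0 1)).
  { apply (is_derive_ext (fun u => RInt (fun s => phi (move (move p X u) v s)) 0 1)).
    { intros u; now rewrite averageE. }
    apply (is_derive_RInt_param (fun u s => phi (move (move p X u) v s)) 0 1 0).
    - generalize (HxC_move_near p X Hp); apply filter_imp; intros u Hu s _.
      eexists; now apply E.
    - intros s _; apply (continuity_2d_pt_ext_loc (fun u s => dird X phi (move (move p X u) v s))).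
      + apply locally_2d_locally.
        assert (N : @locally R2_space (0, s)
                   (fun z => HxC (move p X (fst z)))).
        { exact (continuous_fst (U := R_UniformSpace) (V := R_UniformSpace) 0 s _ (HxC_move_near p X Hp)). }
        generalize N; apply filter_imp; intros [u w] Hu; simpl in *.
        symmetry; exact (is_derive_unique _ _ _ (E u w Hu)).
      + apply continuity_2d_pt_filterlim.
        apply (continuous_move2 X v p (dird X phi) 0 s); [now apply smoothR_dirR|].
        rewrite move0; now apply HxC_translation.
    - generalize (HxC_move_near p X Hp); apply filter_imp; intros u Hu.
      now apply ex_RInt_line. }
  evar_last; [exact D|].
  rewrite averageE; apply RInt_ext; intros s _.
  rewrite (is_derive_unique _ _ _ (E 0 s ltac:(now rewrite move0))); now rewrite move0.
Qed.

Lemma dirR_average (v X p : pt) (phi : pt -> R) :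
  translation v -> smoothR phi -> HxC p ->
  dird X (average v phi) p = average v (dird X phi) p.
Proof. intros; now apply dirR_eq, is_derive_average. Qed.

Lemma smoothR_average (v : pt) (phi : pt -> R) :
  translation v -> smoothR phi -> smoothR (average v phi).
Proof.
  intros Hv H k; revert phi H; induction k as [|k IH]; intros phi H.
  - split; [intros; now apply continuous_average|exact I].
  - split; [intros; now apply continuous_average|].
    intros X; split.
    + intros p Hp; eexists; now apply is_derive_average.
    + apply (CkR_ext k (average v (dird X phi))).
      * intros q Hq; symmetry; now apply dirR_average.
      * now apply IH, smoothR_dirR.
Qed.

Lemma average_plus (v p : pt) (phi psi : pt -> R) :
  translation v -> smoothR phi -> smoothR psi -> HxC p ->
  average v (fun q => phi q + psi q) p = average v phi p + average v psi p.
Proof. intros; rewrite !averageE; apply: RInt_plus; now apply ex_RInt_line. Qed.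

Lemma average_scal (v p : pt) (c : R) (phi : pt -> R) :
  translation v -> smoothR phi -> HxC p ->
  average v (fun q => c * phi q) p = c * average v phi p.
Proof. intros; rewrite !averageE; apply: RInt_scal; now apply ex_RInt_line. Qed.

Lemma average_le (v p : pt) (phi psi : pt -> R) :
  translation v -> smoothR phi -> smoothR psi -> HxC p ->
  (forall s, phi (move p v s) <= psi (move p v s)) ->
  average v phi p <= average v psi p.
Proof. intros; rewrite !averageE; apply RInt_le; [lra|now apply ex_RInt_line..|auto]. Qed.

Lemma average_const (v p : pt) (c : R) : average v (fun _ => c) p = c.
Proof. rewrite averageE RInt_const; unfold scal; simpl; unfold mult; simpl; ring. Qed.

Lemma average_abs_le (v p : pt) (phi : pt -> R) (M : R) :
  translation v -> smoothR phi -> HxC p ->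
  (forall s, Rabs (phi (move p v s)) <= M) -> Rabs (average v phi p) <= M.
Proof.
  intros Hv H Hp Hs; replace M with ((1 - 0) * M) by ring.
  rewrite averageE; apply abs_RInt_le_const; [lra|now apply ex_RInt_line|auto].
Qed.

Lemma average_dirR (v p : pt) (phi : pt -> R) :
  translation v -> smoothR phi -> HxC p ->
  average v (dird v phi) p = phi (move p v 1) - phi p.
Proof.
  intros Hv H Hp.
  assert (E := is_RInt_derive (V := R_CompleteNormedModule) (fun s => phi (move p v s))
    (fun s => dird v phi (move p v s)) 0 1
    (fun s _ => smoothR_is_derive v phi p s H (HxC_translation p v s Hv Hp))
    (fun s _ => continuous_line v p _ s Hv (smoothR_dirR v phi H) Hp)).
  apply is_RInt_unique in E; rewrite move0 in E; rewrite averageE; exact E.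
Qed.

Lemma average_pos0 (v p : pt) (phi : pt -> R) :
  translation v -> smoothR phi -> HxC p -> (forall q, HxC q -> 0 <= phi q) ->
  average v phi p = 0 -> phi p = 0.
Proof.
  intros Hv H Hp Hpos Hz; destruct (Rle_lt_or_eq_dec _ _ (Hpos p Hp)) as [Hlt|]; [exfalso|easy].
  assert (C : continuous (fun s => phi (move p v s)) 0) by now apply continuous_line.
  destruct (proj1 (filterlim_locally _ _) C (mkposreal _ Hlt)) as [d Hd].
  rewrite move0 in Hd.
  (* On [0, e] the function stays within [phi p] of [phi p], hence is positive; d / 2 keeps the
     segment strictly inside the radius. *)
  set (e := Rmin (d / 2) 1).
  assert (He : 0 < e <= 1).
  { destruct d as [d d0]; unfold e; simpl; split; [apply Rmin_glb_lt; lra|apply Rmin_r]. }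
  assert (P1 : 0 < RInt (fun s => phi (move p v s)) 0 e).
  { apply RInt_gt_0; [lra| |intros; now apply continuous_line].
    intros s Hs; assert (B := Hd s).
    unfold ball in B; simpl in B; unfold AbsRing_ball, abs, minus, plus, opp in B; simpl in B.
    assert (Rabs (s + - 0) < d).
    { rewrite Rabs_pos_eq; [|lra]; assert (e <= d / 2) by apply Rmin_l; destruct d; simpl in *; lra. }
    specialize (B H0); apply Rabs_def2 in B; lra. }
  assert (P2 : 0 <= RInt (fun s => phi (move p v s)) e 1).
  { apply RInt_ge_0; [lra|now apply ex_RInt_line|].
    intros s _; now apply Hpos, HxC_translation. }
  assert (P3 := RInt_Chasles (V := R_CompleteNormedModule) (fun s => phi (move p v s)) 0 e 1
    (ex_RInt_line _ _ _ _ _ Hv H Hp) (ex_RInt_line _ _ _ _ _ Hv H Hp)).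
  unfold plus in P3; simpl in P3; rewrite averageE in Hz; lra.
Qed.

(* Integrate the derivative of (1 - s) phi(p + s v), and use |x| <= 1 + x^2. *)
Lemma average_bound (v p : pt) (phi : pt -> R) :
  translation v -> smoothR phi -> HxC p ->
  phi p <= average v (fun q => phi q + (1 + dird v phi q * dird v phi q)) p.
Proof.
  intros Hv H Hp.
  assert (D : forall s, is_derive (fun s => (s - 1) * phi (move p v s)) s
     (phi (move p v s) + (s - 1) * dird v phi (move p v s))).
  { intros s; evar_last.
    - apply: is_derive_mult; [auto_derive; trivial; reflexivity| |intros; apply Rmult_comm].
      now apply smoothR_is_derive; [|apply HxC_translation].
    - unfold plus, scal; simpl; unfold mult; simpl; ring. }
  assert (Hd := smoothR_dirR v phi H).
  assert (C : forall s, continuous (fun s => phi (move p v s) + (s - 1) * dird v phi (move p v s)) s).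
  { intros s; apply: continuous_plus; [now apply continuous_line|].
    apply: continuous_mult; [|now apply continuous_line].
    apply: continuous_minus; [apply: continuous_id|apply: continuous_const]. }
  assert (E := is_RInt_derive (V := R_CompleteNormedModule) _ _ 0 1 (fun s _ => D s) (fun s _ => C s)).
  apply is_RInt_unique in E; rewrite move0 in E.
  unfold minus, plus, opp in E; simpl in E.
  replace (phi p) with ((1 - 1) * phi (move p v 1) + - ((0 - 1) * phi p)) by ring.
  rewrite -E averageE; apply RInt_le; [lra| | |].
  - apply: ex_RInt_continuous; intros; apply C.
  - apply (ex_RInt_line v p (fun q => phi q + (1 + dird v phi q * dird v phi q)) 0 1 Hv); trivial.
    apply smoothR_plus; [easy|apply (smoothR_plus (fun _ => 1)); [apply smoothR_const|now apply smoothR_mult]].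
  - intros s Hs; set (x := dird v phi (move p v s)).
    assert (0 <= (x + 1 / 2) * (x + 1 / 2)) by apply Rle_0_sqr.
    destruct (Rle_lt_dec 0 x); nra.
Qed.

(** * Fibre integrals *)

Lemma average_shift (v w p : pt) (phi : pt -> R) :
  average v phi (move p w 1) = average v (fun q => phi (move q w 1)) p.
Proof. rewrite !averageE; apply RInt_ext; intros s _; now rewrite moveC. Qed.

Lemma constant_of_derive0 (f : R -> R) (a b : R) :
  (forall x, is_derive f x 0) -> f a = f b.
Proof.
  intros H; destruct (MVT_gen f a b (fun _ => 0)) as [c [_ E]].
  - intros; apply H.
  - intros; apply continuity_pt_filterlim; apply: ex_derive_continuous; eexists; apply H.
  - lra.
Qed.

Lemma constant_along (X p : pt) (phi : pt -> R) (s : R) : translation X -> smoothR phi ->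
  (forall q, HxC q -> dird X phi q = 0) -> HxC p -> phi (move p X s) = phi p.
Proof.
  intros HX H Z Hp; rewrite -{2}(move0 p X).
  apply (constant_of_derive0 (fun s => phi (move p X s))); intros x.
  assert (Hx : HxC (move p X x)) by now apply HxC_translation.
  rewrite -(Z _ Hx); now apply smoothR_is_derive.
Qed.

Ltac smooth_average :=
  repeat match goal with
  | |- smoothR (average _ _) => apply smoothR_average; [assumption|]
  | |- smoothR _ => assumption
  end.

Section Fibration.

(** The periods of the torus fibre. [Hspan] carries facts about derivatives along the periods over
    to every fibre direction. *)
Variables v0 v1 v2 : pt.
Hypothesis Hv0 : translation v0.
Hypothesis Hv1 : translation v1.
Hypothesis Hv2 : translation v2.
Hypothesis Hspan : forall X, translation X ->
  exists c0 c1 c2 : R, X = lincomb 1 (lincomb c0 v0 c1 v1) c2 v2.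

Definition periodic (phi : pt -> R) : Prop := forall p, HxC p ->
  phi (move p v0 1) = phi p /\ phi (move p v1 1) = phi p /\ phi (move p v2 1) = phi p.

Definition smooth_periodic (phi : pt -> R) : Prop := smoothR phi /\ periodic phi.

Lemma sp_dirR (X : pt) (phi : pt -> R) : smooth_periodic phi -> smooth_periodic (dird X phi).
Proof.
  intros [H P]; split; [now apply smoothR_dirR|].
  intros p Hp; rewrite -!dirR_shift; repeat split; apply dirR_ext; trivial; intros q Hq; now apply P.
Qed.

Lemma sp_const (c : R) : smooth_periodic (fun _ => c).
Proof. split; [apply smoothR_const|easy]. Qed.

Lemma sp_plus (phi psi : pt -> R) : smooth_periodic phi -> smooth_periodic psi ->
  smooth_periodic (fun p => phi p + psi p).
Proof.
  intros [H P] [H' P']; split; [now apply smoothR_plus|].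
  intros p Hp; destruct (P p Hp) as [-> [-> ->]], (P' p Hp) as [-> [-> ->]]; easy.
Qed.

Lemma sp_mult (phi psi : pt -> R) : smooth_periodic phi -> smooth_periodic psi ->
  smooth_periodic (fun p => phi p * psi p).
Proof.
  intros [H P] [H' P']; split; [now apply smoothR_mult|].
  intros p Hp; destruct (P p Hp) as [-> [-> ->]], (P' p Hp) as [-> [-> ->]]; easy.
Qed.

Lemma sp_scal (c : R) (phi : pt -> R) : smooth_periodic phi ->
  smooth_periodic (fun p => c * phi p).
Proof. apply sp_mult, sp_const. Qed.

Lemma sp_opp (phi : pt -> R) : smooth_periodic phi -> smooth_periodic (fun p => - phi p).
Proof.
  intros [H P]; split; [now apply smoothR_opp|].
  intros p Hp; destruct (P p Hp) as [-> [-> ->]]; easy.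
Qed.

Lemma sp_minus (phi psi : pt -> R) : smooth_periodic phi -> smooth_periodic psi ->
  smooth_periodic (fun p => phi p - psi p).
Proof. intros H1 H2; apply sp_plus; [easy|now apply sp_opp]. Qed.

Lemma sp_shift (w : pt) (phi : pt -> R) : translation w -> smooth_periodic phi ->
  smooth_periodic (fun p => phi (move p w 1)).
Proof.
  intros Hw [H P]; split; [now apply smoothR_shift|].
  intros p Hp; assert (Hq : HxC (move p w 1)) by now apply HxC_translation.
  destruct (P _ Hq) as [E0 [E1 E2]].
  rewrite (moveC p v0 w) (moveC p v1 w) (moveC p v2 w); repeat split; trivial.
Qed.

(** Mean over the parallelepiped with corner p and edges [v0], [v1], [v2]. For a periodic function
    this is the normalised integral over the torus and depends only on the height of p
    ([fibre_integral_constant]). *)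
Definition fibre_integral (phi : pt -> R) : pt -> R :=
  average v0 (average v1 (average v2 phi)).

Lemma smoothR_fibre (phi : pt -> R) : smoothR phi -> smoothR (fibre_integral phi).
Proof. intros H; unfold fibre_integral; smooth_average. Qed.

Lemma dirR_fibre (X p : pt) (phi : pt -> R) : smoothR phi -> HxC p ->
  dird X (fibre_integral phi) p = fibre_integral (dird X phi) p.
Proof.
  intros H Hp; unfold fibre_integral.
  rewrite dirR_average; trivial; [|smooth_average].
  apply average_ext; trivial; intros q Hq.
  rewrite dirR_average; trivial; [|smooth_average].
  apply average_ext; trivial; intros r Hr; now apply dirR_average.
Qed.

Lemma fibre_ext (p : pt) (phi psi : pt -> R) : HxC p ->
  (forall q, HxC q -> phi q = psi q) -> fibre_integral phi p = fibre_integral psi p.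
Proof.
  intros Hp E; apply average_ext; trivial; intros q Hq.
  apply average_ext; trivial; intros r Hr; now apply average_ext.
Qed.

Lemma fibre_plus (p : pt) (phi psi : pt -> R) : smoothR phi -> smoothR psi -> HxC p ->
  fibre_integral (fun q => phi q + psi q) p = fibre_integral phi p + fibre_integral psi p.
Proof.
  intros H1 H2 Hp; unfold fibre_integral.
  assert (S1 := smoothR_average v2 phi Hv2 H1).
  assert (S2 := smoothR_average v2 psi Hv2 H2).
  rewrite -(average_plus v0 p _ _ Hv0 (smoothR_average v1 _ Hv1 S1) (smoothR_average v1 _ Hv1 S2) Hp).
  apply average_ext; [assumption..|]; intros q Hq.
  rewrite -(average_plus v1 q _ _ Hv1 S1 S2 Hq).
  apply average_ext; [assumption..|]; intros r Hr.
  exact (average_plus v2 r phi psi Hv2 H1 H2 Hr).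
Qed.

Lemma fibre_scal (p : pt) (c : R) (phi : pt -> R) : smoothR phi -> HxC p ->
  fibre_integral (fun q => c * phi q) p = c * fibre_integral phi p.
Proof.
  intros H1 Hp; unfold fibre_integral.
  assert (S1 := smoothR_average v2 phi Hv2 H1).
  rewrite -(average_scal v0 p c _ Hv0 (smoothR_average v1 _ Hv1 S1) Hp).
  apply average_ext; [assumption..|]; intros q Hq.
  rewrite -(average_scal v1 q c _ Hv1 S1 Hq).
  apply average_ext; [assumption..|]; intros r Hr.
  exact (average_scal v2 r c phi Hv2 H1 Hr).
Qed.

Lemma fibre_minus (p : pt) (phi psi : pt -> R) : smoothR phi -> smoothR psi -> HxC p ->
  fibre_integral (fun q => phi q - psi q) p = fibre_integral phi p - fibre_integral psi p.
Proof.
  intros H1 H2 Hp.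
  rewrite (fibre_ext p _ (fun q => phi q + -1 * psi q)); trivial; [|intros; ring].
  rewrite fibre_plus; trivial; [|now apply smoothR_scal].
  rewrite fibre_scal; trivial; ring.
Qed.

Lemma fibre_abs_le (p : pt) (phi : pt -> R) (M : R) : smoothR phi -> HxC p ->
  (forall q, HxC q -> Im (fst q) = Im (fst p) -> Rabs (phi q) <= M) ->
  Rabs (fibre_integral phi p) <= M.
Proof.
  assert (T : forall q v s, translation v -> Im (fst (move q v s)) = Im (fst q)).
  { intros q v s Hv; rewrite moveE; unfold translation, Im in *; simpl; rewrite Hv; ring. }
  intros H Hp B; apply average_abs_le; trivial; [smooth_average|intros s0].
  assert (Hp0 : HxC (move p v0 s0)) by now apply HxC_translation.
  apply average_abs_le; trivial; [smooth_average|intros s1].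
  assert (Hp1 : HxC (move (move p v0 s0) v1 s1)) by now apply HxC_translation.
  apply average_abs_le; trivial; intros s2.
  apply B; [now apply HxC_translation|now rewrite !T].
Qed.

Lemma average_ge0 (v p : pt) (phi : pt -> R) : translation v -> smoothR phi -> HxC p ->
  (forall q, HxC q -> 0 <= phi q) -> 0 <= average v phi p.
Proof.
  intros Hv H Hp Hpos; rewrite -(average_const v p 0).
  apply average_le; trivial; [apply smoothR_const|].
  intros s; now apply Hpos, HxC_translation.
Qed.

Lemma fibre_ge0 (p : pt) (phi : pt -> R) : smoothR phi -> HxC p ->
  (forall q, HxC q -> 0 <= phi q) -> 0 <= fibre_integral phi p.
Proof.
  intros H Hp Hpos; apply average_ge0; trivial; [smooth_average|].
  intros q Hq; apply average_ge0; trivial; [smooth_average|].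
  intros r Hr; now apply average_ge0.
Qed.

Lemma fibre_eq0 (p : pt) (phi : pt -> R) : smoothR phi -> HxC p ->
  (forall q, HxC q -> 0 <= phi q) -> fibre_integral phi p = 0 -> phi p = 0.
Proof.
  intros H Hp Hpos Hz.
  apply (average_pos0 v2); trivial.
  apply (average_pos0 v1); trivial; [smooth_average|intros; now apply average_ge0|].
  apply (average_pos0 v0); trivial; [smooth_average|].
  intros; apply average_ge0; trivial; [smooth_average|intros; now apply average_ge0].
Qed.

(** The derivative moves out through the inner averages until it meets the one along its own period;
    there it becomes a boundary difference, which periodicity cancels. *)
Lemma fibre_period_dirR (p : pt) (phi : pt -> R) : smooth_periodic phi -> HxC p ->
  fibre_integral (dird v0 phi) p = 0 /\ fibre_integral (dird v1 phi) p = 0 /\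
  fibre_integral (dird v2 phi) p = 0.
Proof.
  intros [H P] Hp; unfold fibre_integral.
  assert (H2 := smoothR_average v2 phi Hv2 H).
  assert (H12 := smoothR_average v1 _ Hv1 H2).
  split; [|split].
  - rewrite (average_ext v0 p _ (dird v0 (average v1 (average v2 phi)))); trivial.
    + rewrite average_dirR; trivial; rewrite average_shift.
      rewrite (average_ext v1 p _ (average v2 phi)); trivial; [ring|].
      intros q Hq; rewrite average_shift; apply average_ext; trivial.
      intros r Hr; now apply P.
    + intros q Hq; rewrite dirR_average; trivial.
      apply average_ext; trivial; intros r Hr; now rewrite dirR_average.
  - rewrite (average_ext v0 p _ (fun _ => 0)); trivial; [apply average_const|].
    intros q Hq; rewrite (average_ext v1 q _ (dird v1 (average v2 phi))); trivial.
    + rewrite average_dirR; trivial; rewrite average_shift.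
      rewrite (average_ext v2 q _ phi); trivial; [ring|].
      intros r Hr; now apply P.
    + intros r Hr; now rewrite dirR_average.
  - rewrite (average_ext v0 p _ (fun _ => 0)); trivial; [apply average_const|].
    intros q Hq; rewrite (average_ext v1 q _ (fun _ => 0)); trivial; [apply average_const|].
    intros r Hr; rewrite average_dirR; trivial; destruct (P r Hr) as [_ [_ ->]]; ring.
Qed.

Lemma fibre_dirR (X p : pt) (phi : pt -> R) : translation X -> smooth_periodic phi -> HxC p ->
  fibre_integral (dird X phi) p = 0.
Proof.
  intros HX SP Hp; destruct (Hspan X HX) as [c0 [c1 [c2 ->]]].
  destruct (fibre_period_dirR p phi SP Hp) as [E0 [E1 E2]], SP as [H _].
  assert (D := fun v => smoothR_dirR v phi H).
  rewrite (fibre_ext p _ (fun q => (c0 * dird v0 phi q + c1 * dird v1 phi q) + c2 * dird v2 phi q)); trivial.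
  - rewrite fibre_plus; trivial; [|apply smoothR_plus|]; try now apply smoothR_scal.
    rewrite fibre_plus; trivial; try now apply smoothR_scal.
    rewrite !fibre_scal; trivial; rewrite E0 E1 E2; ring.
  - intros q Hq; rewrite !dirR_lincomb; trivial; ring.
Qed.

Lemma fibre_parts (X p : pt) (phi psi : pt -> R) : translation X ->
  smooth_periodic phi -> smooth_periodic psi -> HxC p ->
  fibre_integral (fun q => dird X phi q * psi q) p
  = - fibre_integral (fun q => phi q * dird X psi q) p.
Proof.
  intros HX S1 S2 Hp.
  assert (E := fibre_dirR X p _ HX (sp_mult _ _ S1 S2) Hp).
  rewrite (fibre_ext p _ _ Hp (fun q Hq => dirR_mult X phi psi q (proj1 S1) (proj1 S2) Hq)) in E.
  rewrite (fibre_plus p (fun q => dird X phi q * psi q) (fun q => phi q * dird X psi q)) in E.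
  - lra.
  - exact (proj1 (sp_mult _ _ (sp_dirR X _ S1) S2)).
  - exact (proj1 (sp_mult _ _ S1 (sp_dirR X _ S2))).
  - exact Hp.
Qed.

(** A Jacobian is a divergence: by parts, both sides are minus the integral of phi D_X D_Y psi. *)
Lemma fibre_jacobian (X Y p : pt) (phi psi : pt -> R) : translation X -> translation Y ->
  smooth_periodic phi -> smooth_periodic psi -> HxC p ->
  fibre_integral (fun q => dird X phi q * dird Y psi q) p
  = fibre_integral (fun q => dird Y phi q * dird X psi q) p.
Proof.
  intros HX HY S1 S2 Hp.
  rewrite (fibre_parts X p phi (dird Y psi) HX S1 (sp_dirR Y _ S2) Hp).
  rewrite (fibre_parts Y p phi (dird X psi) HY S1 (sp_dirR X _ S2) Hp).
  f_equal; apply (fibre_ext p _ _ Hp); intros q Hq.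
  rewrite (dirRC X Y psi q (proj1 S2) Hq); reflexivity.
Qed.

(** Its derivative along the fibre is the fibre integral of a derivative. *)
Lemma fibre_integral_constant (X p : pt) (phi : pt -> R) (s : R) : translation X ->
  smooth_periodic phi -> HxC p -> fibre_integral phi (move p X s) = fibre_integral phi p.
Proof.
  intros HX SP Hp; apply constant_along; trivial.
  - apply smoothR_fibre, SP.
  - intros q Hq; rewrite dirR_fibre; trivial; [now apply fibre_dirR|apply SP].
Qed.

(** By [average_bound] a periodic function is at most the mean, along any one period, of another
    periodic function. Three such steps bound it by a full fibre integral, which is constant on the
    fibre. *)
Lemma sp_bounded_above (phi : pt -> R) (t : R) : 0 < t -> smooth_periodic phi ->
  exists K : R, forall p, Im (fst p) = t -> phi p <= K.
Proof.
  intros Ht SP.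
  assert (B : forall v psi, translation v -> smooth_periodic psi -> exists chi, smooth_periodic chi /\
    forall p, HxC p -> psi p <= average v chi p).
  { intros v psi Hv [H P]; exists (fun q => psi q + (1 + dird v psi q * dird v psi q)); split.
    - apply sp_plus; [easy|apply sp_plus; [apply sp_const|]].
      now apply sp_mult; apply sp_dirR.
    - intros p Hp; now apply average_bound. }
  destruct (B v0 phi Hv0 SP) as [c0 [S0 B0]].
  destruct (B v1 c0 Hv1 S0) as [c1 [S1 B1]].
  destruct (B v2 c1 Hv2 S1) as [c2 [S2 B2]].
  exists (fibre_integral c2 ((0, t), (0, 0))).
  assert (H0 : HxC ((0, t), (0, 0))) by exact Ht.
  intros p Hp.
  assert (E : p = move ((0, t), (0, 0)) ((fst (fst p), 0), snd p) 1).
  { rewrite moveE; destruct p as [[x t'] [y1 y2]]; unfold Im in Hp; simpl in *; apply pt_ext; lra. }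
  assert (Hp' : HxC p) by (unfold HxC; lra).
  assert (T : translation ((fst (fst p), 0), snd p)) by reflexivity.
  rewrite -(fibre_integral_constant _ _ c2 1 T S2 H0) -E.
  destruct S0 as [S0 _], S1 as [S1 _], S2 as [S2 _].
  apply Rle_trans with (1 := B0 p Hp').
  apply average_le; trivial; [smooth_average|intros s0].
  assert (Hp0 : HxC (move p v0 s0)) by now apply HxC_translation.
  apply Rle_trans with (1 := B1 _ Hp0).
  apply average_le; trivial; [smooth_average|intros s1].
  now apply B2, HxC_translation.
Qed.

Lemma sp_bounded (phi : pt -> R) (t : R) : 0 < t -> smooth_periodic phi ->
  exists K : R, forall p, Im (fst p) = t -> Rabs (phi p) <= K.
Proof.
  intros Ht SP.
  destruct (sp_bounded_above phi t Ht SP) as [K1 B1].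
  destruct (sp_bounded_above _ t Ht (sp_opp phi SP)) as [K2 B2].
  exists (Rmax K1 K2); intros p Hp; specialize (B1 p Hp); specialize (B2 p Hp).
  apply Rabs_le; assert (L1 := Rmax_l K1 K2); assert (L2 := Rmax_r K1 K2); lra.
Qed.

(** * The energy identity *)

Definition dir_x : pt := ((1, 0), (0, 0)).
Definition dir_t : pt := ((0, 1), (0, 0)).
Definition dir_1 : pt := ((0, 0), (1, 0)).
Definition dir_2 : pt := ((0, 0), (0, 1)).

(** Mixed second difference with steps u and v. It is small as soon as either step is
    ([diff2_bound]); the two steps serve the two ends of the t-axis. *)
Definition diff2 (u v : pt) (phi : pt -> R) (p : pt) : R :=
  phi (move (move p u 1) v 1) - phi (move p u 1) - phi (move p v 1) + phi p.

(* With F = F1 + i F2, G = G1 + i G2 and d^s = (d_1 - i s d_2) / 2, the system reads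
   F_t = i F_x + (i c1 / t) d^s G  and  G_t = - i G_x + (i c2 / t^2) d^(-s) F. *)
Definition elliptic_system (s c1 c2 : R) (F1 F2 G1 G2 : pt -> R) : Prop :=
  forall p, HxC p -> let t := Im (fst p) in
  dird dir_t F1 p = - dird dir_x F2 p - c1 / (2 * t) * (dird dir_1 G2 p - s * dird dir_2 G1 p) /\
  dird dir_t F2 p = dird dir_x F1 p + c1 / (2 * t) * (dird dir_1 G1 p + s * dird dir_2 G2 p) /\
  dird dir_t G1 p = dird dir_x G2 p - c2 / (2 * t ^ 2) * (dird dir_1 F2 p + s * dird dir_2 F1 p) /\
  dird dir_t G2 p = - dird dir_x G1 p + c2 / (2 * t ^ 2) * (dird dir_1 F1 p - s * dird dir_2 F2 p).

Lemma dird_diff2 (u v X p : pt) (phi : pt -> R) : translation u -> translation v ->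
  smoothR phi -> HxC p -> dird X (diff2 u v phi) p = diff2 u v (dird X phi) p.
Proof.
  intros Hu Hv H Hp; unfold diff2.
  assert (Su := smoothR_shift u phi Hu H).
  assert (Sv := smoothR_shift v phi Hv H).
  assert (Suv := smoothR_shift u _ Hu Sv).
  assert (D1 := dirR_plus X _ phi p (smoothR_minus _ _ (smoothR_minus _ _ Suv Su) Sv) H Hp).
  cbv beta in D1; rewrite D1.
  assert (D2 := dirR_minus X _ _ p (smoothR_minus _ _ Suv Su) Sv Hp).
  cbv beta in D2; rewrite D2.
  assert (D3 := dirR_minus X _ _ p Suv Su Hp).
  cbv beta in D3; rewrite D3.
  rewrite (dirR_shift u X (fun q => phi (move q v 1))) !dirR_shift; reflexivity.
Qed.

Lemma smoothR_diff2 (u v : pt) (phi : pt -> R) : translation u -> translation v ->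
  smoothR phi -> smoothR (diff2 u v phi).
Proof.
  intros Hu Hv H.
  assert (Su := smoothR_shift u phi Hu H).
  assert (Sv := smoothR_shift v phi Hv H).
  assert (Suv := smoothR_shift u _ Hu Sv).
  exact (smoothR_plus _ phi (smoothR_minus _ _ (smoothR_minus _ _ Suv Su) Sv) H).
Qed.

Lemma Im_move (p v : pt) (s : R) : translation v -> Im (fst (move p v s)) = Im (fst p).
Proof. intros Hv; rewrite moveE; unfold translation, Im in *; simpl; rewrite Hv; ring. Qed.

(** The system is linear with coefficients depending on t alone, so translates along the fibre solve
    it too. *)
Lemma elliptic_system_diff2 (u v : pt) (s c1 c2 : R) (F1 F2 G1 G2 : pt -> R) :
  translation u -> translation v ->
  smoothR F1 -> smoothR F2 -> smoothR G1 -> smoothR G2 ->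
  elliptic_system s c1 c2 F1 F2 G1 G2 ->
  elliptic_system s c1 c2 (diff2 u v F1) (diff2 u v F2) (diff2 u v G1) (diff2 u v G2).
Proof.
  intros Hu Hv S1 S2 S3 S4 E p Hp; cbv zeta.
  rewrite !(dird_diff2 u v) //; unfold diff2.
  assert (Hpu : HxC (move p u 1)) by now apply HxC_translation.
  assert (Hpv : HxC (move p v 1)) by now apply HxC_translation.
  assert (Hpuv : HxC (move (move p u 1) v 1)) by now apply HxC_translation.
  destruct (E p Hp) as [e1 [e2 [e3 e4]]].
  destruct (E _ Hpu) as [e1u [e2u [e3u e4u]]].
  destruct (E _ Hpv) as [e1v [e2v [e3v e4v]]].
  destruct (E _ Hpuv) as [e1w [e2w [e3w e4w]]].
  rewrite !Im_move // in e1u e2u e3u e4u e1v e2v e3v e4v e1w e2w e3w e4w.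
  rewrite e1 e2 e3 e4 e1u e2u e3u e4u e1v e2v e3v e4v e1w e2w e3w e4w.
  repeat split; ring.
Qed.

(** Agreement on a single fibre is enough, so factors depending on t may be treated as constants
    under the integral. *)
Lemma fibre_ext_fibre (p : pt) (phi psi : pt -> R) : smoothR phi -> smoothR psi -> HxC p ->
  (forall q, HxC q -> Im (fst q) = Im (fst p) -> phi q = psi q) -> fibre_integral phi p = fibre_integral psi p.
Proof.
  intros H1 H2 Hp E; apply Rminus_diag_uniq.
  rewrite -fibre_minus //.
  assert (B := fibre_abs_le p (fun q => phi q - psi q) 0
    (smoothR_minus _ _ H1 H2) Hp).
  assert (0 <= Rabs (fibre_integral (fun q => phi q - psi q) p)) by apply Rabs_pos.
  assert (Z : Rabs (fibre_integral (fun q => phi q - psi q) p) = 0).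
  { apply Rle_antisym; [apply B|exact H]; intros q Hq Hqp; rewrite (E q Hq Hqp).
    replace (psi q - psi q) with 0 by ring; rewrite Rabs_R0; lra. }
  destruct (Req_dec (fibre_integral (fun q => phi q - psi q) p) 0) as [z|z]; [exact z|].
  exfalso; exact (Rabs_no_R0 _ z Z).
Qed.

Lemma sp_diff2 (u v : pt) (phi : pt -> R) : translation u -> translation v ->
  smooth_periodic phi -> smooth_periodic (diff2 u v phi).
Proof.
  intros Hu Hv H; unfold diff2.
  assert (Su := sp_shift u phi Hu H).
  assert (Sv := sp_shift v phi Hv H).
  assert (Suv := sp_shift u _ Hu Sv).
  exact (sp_plus _ phi (sp_minus _ _ (sp_minus _ _ Suv Su) Sv) H).
Qed.

Ltac solve_sp := repeat first [ assumption
  | match goal with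
    | |- smooth_periodic (fun q => _ + _) => apply sp_plus
    | |- smooth_periodic (fun q => _ - _) => apply sp_minus
    | |- smooth_periodic (fun q => - _) => apply sp_opp
    | |- smooth_periodic (fun q => _ * _) => apply sp_mult
    | |- smooth_periodic (fun q => dird ?X ?f q) => apply (sp_dirR X f)
    | |- smooth_periodic (dird ?X ?f) => apply (sp_dirR X f)
    | |- smooth_periodic (fun _ => ?c) => apply (sp_const c)
    end ].

(** The fibre integral of Re (2 i d^(-s) F conj G). *)
Definition energy (s : R) (F1 F2 G1 G2 : pt -> R) : pt -> R :=
  fibre_integral (fun q => (dird dir_1 F1 q - s * dird dir_2 F2 q) * G2 q
              - (dird dir_1 F2 q + s * dird dir_2 F1 q) * G1 q).

Lemma smoothR_energy (s : R) (F1 F2 G1 G2 : pt -> R) :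
  smooth_periodic F1 -> smooth_periodic F2 -> smooth_periodic G1 -> smooth_periodic G2 -> smoothR (energy s F1 F2 G1 G2).
Proof.
  intros; apply smoothR_fibre; trivial.
  assert (H3 : smooth_periodic (fun q => (dird dir_1 F1 q - s * dird dir_2 F2 q) * G2 q
              - (dird dir_1 F2 q + s * dird dir_2 F1 q) * G1 q)) by solve_sp.
  apply H3.
Qed.

(** Null Lagrangians: divergences and Jacobians, the terms discarded in [energy_derivative]. *)
Definition null (phi : pt -> R) : Prop := smooth_periodic phi /\ forall p, HxC p -> fibre_integral phi p = 0.

Lemma null_plus (phi psi : pt -> R) : null phi -> null psi -> null (fun q => phi q + psi q).
Proof.
  intros [S1 Z1] [S2 Z2]; split; [now apply sp_plus|].
  intros p Hp; rewrite fibre_plus //; [rewrite (Z1 p Hp) (Z2 p Hp); ring|apply S1|apply S2].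
Qed.

Lemma null_scal (c : R) (phi : pt -> R) : null phi -> null (fun q => c * phi q).
Proof.
  intros [S1 Z1]; split; [now apply sp_scal|].
  intros p Hp; rewrite fibre_scal //; [rewrite (Z1 p Hp); ring|apply S1].
Qed.

Lemma null_div (X : pt) (phi psi : pt -> R) : translation X -> smooth_periodic phi -> smooth_periodic psi ->
  null (fun q => dird X phi q * psi q + phi q * dird X psi q).
Proof.
  intros HX S1 S2.
  assert (T1 : smooth_periodic (fun q => dird X phi q * psi q)) by solve_sp.
  assert (T2 : smooth_periodic (fun q => phi q * dird X psi q)) by solve_sp.
  split; [now apply sp_plus|].
  intros p Hp; rewrite fibre_plus //; [|apply T1|apply T2].
  rewrite fibre_parts //; ring.
Qed.

Lemma null_jacobian (X Y : pt) (phi psi : pt -> R) :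
  translation X -> translation Y -> smooth_periodic phi -> smooth_periodic psi ->
  null (fun q => dird X phi q * dird Y psi q - dird Y phi q * dird X psi q).
Proof.
  intros HX HY S1 S2.
  assert (T1 : smooth_periodic (fun q => dird X phi q * dird Y psi q)) by solve_sp.
  assert (T2 : smooth_periodic (fun q => dird Y phi q * dird X psi q)) by solve_sp.
  split; [now apply sp_minus|].
  intros p Hp; rewrite fibre_minus //; [|apply T1|apply T2].
  rewrite (fibre_jacobian X Y) //; ring.
Qed.

Definition sqnorm (phi psi : pt -> R) (q : pt) : R := phi q * phi q + psi q * psi q.

Lemma sp_sqnorm (phi psi : pt -> R) : smooth_periodic phi -> smooth_periodic psi -> smooth_periodic (sqnorm phi psi).
Proof. intros; unfold sqnorm; solve_sp. Qed.

Definition d_plus (s : R) (F1 F2 : pt -> R) (q : pt) : R := dird dir_1 F1 q + s * dird dir_2 F2 q.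

Lemma sp_d_plus (s : R) (F1 F2 : pt -> R) : smooth_periodic F1 -> smooth_periodic F2 -> smooth_periodic (d_plus s F1 F2).
Proof. intros; unfold d_plus; solve_sp. Qed.

(** In the t-derivative, integration by parts takes the z-derivative off F_t. Inserting the system
    leaves the integrals of |2 d^s G|^2 and |2 d^(-s) F|^2, while i F_x and - i G_x contribute a
    combination of Jacobians. *)
Lemma energy_derivative (s c1 c2 : R) (F1 F2 G1 G2 : pt -> R) (p : pt) :
  smooth_periodic F1 -> smooth_periodic F2 -> smooth_periodic G1 -> smooth_periodic G2 ->
  elliptic_system s c1 c2 F1 F2 G1 G2 -> HxC p -> let t := Im (fst p) in
  dird dir_t (energy s F1 F2 G1 G2) p
  = c1 / (2 * t) * fibre_integral (sqnorm (d_plus s G1 G2) (d_plus (- s) G2 G1)) p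
    + c2 / (2 * t ^ 2) * fibre_integral (sqnorm (d_plus (- s) F1 F2) (d_plus s F2 F1)) p.
Proof.
  intros S1 S2 S3 S4 E Hp t; unfold energy.
  assert (Tx : translation dir_x) by reflexivity.
  assert (T1 : translation dir_1) by reflexivity.
  assert (T2 : translation dir_2) by reflexivity.
  pose (P1 := dird dir_t F1); pose (P2 := dird dir_t F2).
  pose (R1 := dird dir_t G1); pose (R2 := dird dir_t G2).
  assert (SP1 : smooth_periodic P1) by (unfold P1; solve_sp).
  assert (SP2 : smooth_periodic P2) by (unfold P2; solve_sp).
  assert (SR1 : smooth_periodic R1) by (unfold R1; solve_sp).
  assert (SR2 : smooth_periodic R2) by (unfold R2; solve_sp).
  rewrite dirR_fibre //; cycle 1.
  { assert (H3 : smooth_periodic (fun q => (dird dir_1 F1 q - s * dird dir_2 F2 q) * G2 q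
              - (dird dir_1 F2 q + s * dird dir_2 F1 q) * G1 q)) by solve_sp.
    apply H3. }
  (* The discarded part: four divergences, which move D_1 and D_2 from the t-derivatives of F to G,
     and four Jacobians pairing D_x with D_1 or D_2. The final [ring] checks that only the squares
     are left besides it. *)
  pose (W := fun q =>
    ((dird dir_1 P1 q * G2 q + P1 q * dird dir_1 G2 q)
     + (- s) * (dird dir_2 P2 q * G2 q + P2 q * dird dir_2 G2 q)
     + (-1) * (dird dir_1 P2 q * G1 q + P2 q * dird dir_1 G1 q)
     + (- s) * (dird dir_2 P1 q * G1 q + P1 q * dird dir_2 G1 q))
    + ((dird dir_x F1 q * dird dir_1 G1 q - dird dir_1 F1 q * dird dir_x G1 q)
       + s * (dird dir_x F1 q * dird dir_2 G2 q - dird dir_2 F1 q * dird dir_x G2 q)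
       + (dird dir_x F2 q * dird dir_1 G2 q - dird dir_1 F2 q * dird dir_x G2 q)
       + (- s) * (dird dir_x F2 q * dird dir_2 G1 q - dird dir_2 F2 q * dird dir_x G1 q))).
  assert (NW : null W).
  { unfold W; repeat first [apply null_div; assumption | apply null_jacobian; assumption
                           | apply null_plus | apply null_scal]. }
  pose (A := sqnorm (d_plus s G1 G2) (d_plus (- s) G2 G1)).
  pose (B := sqnorm (d_plus (- s) F1 F2) (d_plus s F2 F1)).
  assert (SA : smooth_periodic A) by (apply sp_sqnorm; apply sp_d_plus; assumption).
  assert (SB : smooth_periodic B) by (apply sp_sqnorm; apply sp_d_plus; assumption).
  fold A B.
  rewrite (fibre_ext_fibre p _ (fun q => (c1 / (2 * t) * A q + c2 / (2 * t ^ 2) * B q) + W q)) //.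
  - rewrite fibre_plus //; [|apply smoothR_plus; apply smoothR_scal; [apply SA|apply SB]|apply NW].
    rewrite (proj2 NW p Hp) fibre_plus //; try (apply smoothR_scal; [apply SA || apply SB]).
    rewrite !fibre_scal //; [ring|apply SB|apply SA].
  - apply smoothR_dirR.
    assert (H3 : smooth_periodic (fun q => (dird dir_1 F1 q - s * dird dir_2 F2 q) * G2 q
              - (dird dir_1 F2 q + s * dird dir_2 F1 q) * G1 q)) by solve_sp.
    apply H3.
  - apply smoothR_plus; [apply smoothR_plus; apply smoothR_scal; [apply SA|apply SB]|apply NW].
  - intros q Hq Hqp.
    destruct (E q Hq) as [e1 [e2 [e3 e4]]]; rewrite Hqp in e1 e2 e3 e4; fold t in e1, e2, e3, e4.
    assert (X1 : smooth_periodic (fun q => dird dir_1 F1 q - s * dird dir_2 F2 q)) by solve_sp.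
    assert (X2 : smooth_periodic (fun q => dird dir_1 F2 q + s * dird dir_2 F1 q)) by solve_sp.
    assert (X3 : smooth_periodic (fun q => s * dird dir_2 F2 q)) by solve_sp.
    assert (X4 : smooth_periodic (fun q => s * dird dir_2 F1 q)) by solve_sp.
    rewrite (dirR_minus dir_t _ _ q (proj1 (sp_mult _ _ X1 S4)) (proj1 (sp_mult _ _ X2 S3)) Hq).
    rewrite (dirR_mult dir_t _ _ q (proj1 X1) (proj1 S4) Hq).
    rewrite (dirR_mult dir_t _ _ q (proj1 X2) (proj1 S3) Hq).
    rewrite (dirR_minus dir_t _ _ q (proj1 (sp_dirR dir_1 _ S1)) (proj1 X3) Hq).
    rewrite (dirR_plus dir_t _ _ q (proj1 (sp_dirR dir_1 _ S2)) (proj1 X4) Hq).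
    rewrite !dirR_scal.
    rewrite (dirRC dir_t dir_1 F1 q (proj1 S1) Hq) (dirRC dir_t dir_2 F1 q (proj1 S1) Hq).
    rewrite (dirRC dir_t dir_1 F2 q (proj1 S2) Hq) (dirRC dir_t dir_2 F2 q (proj1 S2) Hq).
    unfold W, A, B, sqnorm, d_plus; fold P1 P2 R1 R2.
    change (P1 q = - dird dir_x F2 q - c1 / (2 * t) * (dird dir_1 G2 q - s * dird dir_2 G1 q)) in e1.
    change (P2 q = dird dir_x F1 q + c1 / (2 * t) * (dird dir_1 G1 q + s * dird dir_2 G2 q)) in e2.
    change (R1 q = dird dir_x G2 q - c2 / (2 * t ^ 2) * (dird dir_1 F2 q + s * dird dir_2 F1 q)) in e3.
    change (R2 q = - dird dir_x G1 q + c2 / (2 * t ^ 2) * (dird dir_1 F1 q - s * dird dir_2 F2 q)) in e4.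
    rewrite e1 e2 e3 e4.
    set (k1 := c1 / (2 * t)); set (k2 := c2 / (2 * t ^ 2)).
    ring.
Qed.

(** * Bounds on fibre translations *)

(** A norm on fibre directions; the t-component, 0 for these, is left out. *)
Definition nrm (X : pt) : R := Rabs (fst (fst X)) + (Rabs (fst (snd X)) + Rabs (snd (snd X))).

Lemma translation_coords (X : pt) : translation X ->
  X = lincomb 1 (lincomb (fst (fst X)) dir_x (fst (snd X)) dir_1) (snd (snd X)) dir_2.
Proof.
  destruct X as [[x t] [y1 y2]]; unfold translation, Im; simpl; intros ->.
  unfold lincomb, dir_x, dir_1, dir_2, Cplus, Cmult, RtoC; simpl; apply pt_ext; ring.
Qed.

Lemma dird_coords (X p : pt) (phi : pt -> R) : translation X -> smoothR phi -> HxC p ->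
  dird X phi p = fst (fst X) * dird dir_x phi p + fst (snd X) * dird dir_1 phi p
                 + snd (snd X) * dird dir_2 phi p.
Proof.
  intros HX H Hp; rewrite {1}(translation_coords X HX) !dirR_lincomb //; ring.
Qed.

Lemma mean_value_bound (X p : pt) (phi : pt -> R) (M : R) : translation X -> smoothR phi ->
  HxC p -> (forall s, Rabs (dird X phi (move p X s)) <= M) ->
  Rabs (phi (move p X 1) - phi p) <= M.
Proof.
  intros HX H Hp B.
  assert (D : forall s, is_derive (fun s => phi (move p X s)) s (dird X phi (move p X s))).
  { intros s; apply smoothR_is_derive; [assumption|now apply HxC_translation]. }
  destruct (MVT_gen (fun s => phi (move p X s)) 0 1 (fun s => dird X phi (move p X s)))
    as [c [_ E]].
  - intros s _; apply D.
  - intros s _; apply continuity_pt_filterlim; apply: ex_derive_continuous; eexists; apply D.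
  - rewrite move0 in E; rewrite E.
    replace (dird X phi (move p X c) * (1 - 0)) with (dird X phi (move p X c)) by ring; apply B.
Qed.

(** Periodicity bounds the gradient on the whole fibre, so one constant serves all base points at
    height t. *)
Lemma sp_lipschitz (phi : pt -> R) (t : R) : 0 < t -> smooth_periodic phi ->
  exists K, 0 <= K /\ forall X p, translation X -> Im (fst p) = t ->
    Rabs (phi (move p X 1) - phi p) <= K * nrm X.
Proof.
  intros Ht S.
  assert (SB := sp_bounded).
  destruct (SB _ t Ht (sp_dirR dir_x _ S)) as [K0 B0].
  destruct (SB _ t Ht (sp_dirR dir_1 _ S)) as [K1 B1].
  destruct (SB _ t Ht (sp_dirR dir_2 _ S)) as [K2 B2].
  assert (P0 : 0 <= K0) by (apply Rle_trans with (2 := B0 ((0, t), (0, 0)) erefl); apply Rabs_pos).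
  assert (P1 : 0 <= K1) by (apply Rle_trans with (2 := B1 ((0, t), (0, 0)) erefl); apply Rabs_pos).
  assert (P2 : 0 <= K2) by (apply Rle_trans with (2 := B2 ((0, t), (0, 0)) erefl); apply Rabs_pos).
  exists (K0 + K1 + K2); split; [lra|].
  intros X p HX Hp.
  assert (Hp' : HxC p) by (unfold HxC; lra).
  apply mean_value_bound; [assumption|apply S|assumption|].
  intros s.
  assert (Hs : HxC (move p X s)) by now apply HxC_translation.
  rewrite dird_coords; [|assumption|apply S|assumption].
  assert (Ht' : Im (fst (move p X s)) = t) by (rewrite Im_move; assumption).
  specialize (B0 _ Ht'); specialize (B1 _ Ht'); specialize (B2 _ Ht').
  eapply Rle_trans; [apply Rabs_triang|].
  eapply Rle_trans; [apply Rplus_le_compat_r, Rabs_triang|].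
  rewrite !Rabs_mult; unfold nrm.
  generalize (Rabs_pos (fst (fst X))) (Rabs_pos (fst (snd X))) (Rabs_pos (snd (snd X))).
  set (x := Rabs (fst (fst X))); set (y1 := Rabs (fst (snd X))); set (y2 := Rabs (snd (snd X))).
  intros Hx Hy1 Hy2.
  assert (x * Rabs (dird dir_x phi (move p X s)) <= x * K0) by (apply Rmult_le_compat_l; assumption).
  assert (y1 * Rabs (dird dir_1 phi (move p X s)) <= y1 * K1) by (apply Rmult_le_compat_l; assumption).
  assert (y2 * Rabs (dird dir_2 phi (move p X s)) <= y2 * K2) by (apply Rmult_le_compat_l; assumption).
  nra.
Qed.

(** Grouping the four values in pairs along u, or along v, leaves two first differences: hence a
    bound by either step, with twice the Lipschitz constant. *)
Lemma diff2_bound (phi : pt -> R) (t : R) : 0 < t -> smooth_periodic phi ->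
  exists K, 0 <= K /\ forall u v p, translation u -> translation v -> Im (fst p) = t ->
    Rabs (diff2 u v phi p) <= K * nrm u /\ Rabs (diff2 u v phi p) <= K * nrm v.
Proof.
  intros Ht S; destruct (sp_lipschitz phi t Ht S) as [K [HK B]].
  exists (2 * K); split; [lra|].
  intros u v p Hu Hv Hp.
  assert (A1 := B u p Hu Hp).
  assert (A2 := B v p Hv Hp).
  assert (Hpu : Im (fst (move p u 1)) = t) by (rewrite Im_move; assumption).
  assert (Hpv : Im (fst (move p v 1)) = t) by (rewrite Im_move; assumption).
  assert (A3 := B v _ Hv Hpu).
  assert (A4 := B u _ Hu Hpv).
  rewrite moveC in A4; unfold diff2.
  set (a := phi (move (move p u 1) v 1)) in *; set (b := phi (move p u 1)) in *.
  set (c := phi (move p v 1)) in *; set (d := phi p) in *.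
  clearbody a b c d.
  apply Rabs_le_between in A1, A2, A3, A4; split; apply Rabs_le; lra.
Qed.

(** X differs by an arbitrarily small step from some w preserving the value at p, and the Lipschitz
    constant is uniform on the fibre. *)
Lemma dense_periods (phi : pt -> R) (X p : pt) : translation X -> smooth_periodic phi -> HxC p ->
  (forall eps : R, 0 < eps -> exists w, translation w /\ phi (move p w 1) = phi p /\
     nrm (lincomb 1 X (-1) w) <= eps) ->
  phi (move p X 1) = phi p.
Proof.
  intros HX S Hp A.
  destruct (sp_lipschitz phi (Im (fst p)) Hp S) as [K [HK B]].
  apply cond_eq; intros eps He.
  (* K may be 0, hence the denominator K + 1. *)
  destruct (A (eps / (K + 1))) as [w [Hw [Ew Nw]]]; [apply Rdiv_lt_0_compat; lra|].
  assert (T : translation (lincomb 1 X (-1) w)).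
  { destruct X as [[x t] [y1 y2]], w as [[x' t'] [y1' y2']]; unfold translation, Im in *; simpl in *.
    rewrite HX Hw; ring. }
  assert (E := B (lincomb 1 X (-1) w) (move p w 1) T (Im_move p w 1 Hw)).
  replace (move (move p w 1) (lincomb 1 X (-1) w) 1) with (move p X 1) in E.
  2: { rewrite move_lincomb !moveE; simpl; apply pt_ext; ring. }
  rewrite Ew in E; apply Rle_lt_trans with (1 := E).
  apply Rle_lt_trans with (K * (eps / (K + 1))); [apply Rmult_le_compat_l; assumption|].
  apply Rmult_lt_reg_r with (K + 1); [lra|].
  replace (K * (eps / (K + 1)) * (K + 1)) with (K * eps) by (field; lra); nra.
Qed.

Lemma fibre_diff_zero (w : pt) (phi : pt -> R) (p : pt) : translation w -> smooth_periodic phi -> HxC p ->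
  fibre_integral (fun q => phi (move q w 1) - phi q) p = 0.
Proof.
  intros Hw S Hp.
  assert (S' := sp_shift w phi Hw S).
  rewrite fibre_minus //; [|apply S'|apply S].
  replace (fibre_integral (fun q => phi (move q w 1)) p) with (fibre_integral phi (move p w 1)).
  - rewrite fibre_integral_constant //; ring.
  - unfold fibre_integral; rewrite average_shift; apply average_ext; [assumption..|]; intros q Hq.
    rewrite average_shift; apply average_ext; [assumption..|]; intros r Hr; apply average_shift.
Qed.

Lemma fibre_of_constant (phi : pt -> R) (p : pt) : smooth_periodic phi -> HxC p ->
  (forall X, translation X -> phi (move p X 1) = phi p) -> fibre_integral phi p = phi p.
Proof.
  intros S Hp C.
  rewrite (fibre_ext_fibre p phi (fun _ => phi p)).
  - unfold fibre_integral.
    rewrite (average_ext v0 p _ (fun _ => phi p)) ?average_const //; intros q Hq.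
    rewrite (average_ext v1 q _ (fun _ => phi p)) ?average_const //; intros r Hr.
    now rewrite average_const.
  - apply S.
  - apply smoothR_const.
  - assumption.
  - intros q Hq Hqp.
    rewrite -(C (lincomb 1 q (-1) p)).
    + f_equal; rewrite move_lincomb !moveE; destruct q as [[x t] [y1 y2]]; simpl; apply pt_ext; ring.
    + destruct p as [[x t] [y1 y2]], q as [[x' t'] [y1' y2']]; unfold translation, Im in *; simpl in *.
      rewrite Hqp; ring.
Qed.

(* Cauchy-Riemann functions on the fibre do not depend on z: the null form
   D_1 phi D_2 psi - D_2 phi D_1 psi is then, up to sign, the squared gradient. *)
Lemma cauchy_riemann_gradient (s : R) (phi psi : pt -> R) : smooth_periodic phi -> smooth_periodic psi -> s * s = 1 ->
  (forall q, HxC q -> sqnorm (d_plus (- s) phi psi) (d_plus s psi phi) q = 0) ->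
  forall q, HxC q -> (dird dir_1 phi q = 0 /\ dird dir_2 phi q = 0) /\
                     (dird dir_1 psi q = 0 /\ dird dir_2 psi q = 0).
Proof.
  intros S1 S2 Hs Z.
  assert (CR : forall q, HxC q -> dird dir_1 phi q = s * dird dir_2 psi q /\
                                  dird dir_1 psi q = - s * dird dir_2 phi q).
  { intros q Hq; specialize (Z q Hq); unfold sqnorm, d_plus in Z.
    set (x := dird dir_1 phi q + - s * dird dir_2 psi q) in Z.
    set (y := dird dir_1 psi q + s * dird dir_2 phi q) in Z.
    destruct (Rplus_sqr_eq_0 x y Z) as [X0 Y0]; unfold x, y in *; lra. }
  intros q Hq.
  pose (A := sqnorm (dird dir_2 phi) (dird dir_2 psi)).
  assert (SA : smooth_periodic A) by (apply sp_sqnorm; apply sp_dirR; assumption).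
  assert (J := fibre_jacobian dir_1 dir_2 q phi psi erefl erefl S1 S2 Hq).
  pose (M1 := fun r => dird dir_1 phi r * dird dir_2 psi r).
  pose (M2 := fun r => dird dir_2 phi r * dird dir_1 psi r).
  assert (SM1 : smooth_periodic M1) by (apply sp_mult; apply sp_dirR; assumption).
  assert (SM2 : smooth_periodic M2) by (apply sp_mult; apply sp_dirR; assumption).
  assert (IA : fibre_integral A q = 0).
  { rewrite (fibre_ext q A (fun r => s * (M1 r - M2 r)) Hq).
    - rewrite fibre_scal //; [|apply smoothR_minus; [apply SM1|apply SM2]].
      rewrite fibre_minus //; [|apply SM1|apply SM2].
      unfold M1, M2; rewrite J; ring.
    - intros r Hr; destruct (CR r Hr) as [e1 e2]; unfold A, sqnorm, M1, M2; rewrite e1 e2.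
      replace (s * (s * dird dir_2 psi r * dird dir_2 psi r - dird dir_2 phi r * (- s * dird dir_2 phi r)))
        with ((s * s) * (dird dir_2 psi r * dird dir_2 psi r + dird dir_2 phi r * dird dir_2 phi r)) by ring.
      rewrite Hs; ring. }
  assert (Z0 : A q = 0).
  { apply (fibre_eq0 q A (proj1 SA) Hq); [|assumption].
    intros r _; unfold A, sqnorm; nra. }
  destruct (Rplus_sqr_eq_0 _ _ Z0) as [z1 z2].
  destruct (CR q Hq) as [e1 e2]; rewrite z1 in e2; rewrite z2 in e1; lra.
Qed.

(** * Automorphic rescaling *)

Definition scale_act (P : R) (r : C) (p : pt) : pt := (RtoC P * fst p, r * snd p)%C.

Lemma scale_act_move (P : R) (r : C) (p X : pt) (s : R) :
  scale_act P r (move p X s) = move (scale_act P r p) (scale_act P r X) s.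
Proof. unfold scale_act, move; simpl; f_equal; ring. Qed.

Lemma Im_scale_act (P : R) (r : C) (p : pt) : Im (fst (scale_act P r p)) = P * Im (fst p).
Proof. destruct p as [[x t] z]; unfold Im; simpl; ring. Qed.

Lemma HxC_scale_act (P : R) (r : C) (p : pt) : 0 < P -> HxC p -> HxC (scale_act P r p).
Proof. intros HP Hp; unfold HxC; rewrite Im_scale_act; now apply Rmult_lt_0_compat. Qed.

Lemma translation_scale_act (P : R) (r : C) (v : pt) : translation v -> translation (scale_act P r v).
Proof. unfold translation; rewrite Im_scale_act; intros ->; ring. Qed.

Lemma RtoC_neq0 (P : R) : P <> 0 -> RtoC P <> RtoC 0.
Proof. intros HP E; apply HP; now injection E. Qed.

Lemma scale_act_K (P : R) (r : C) (p : pt) : P <> 0 -> r <> RtoC 0 ->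
  scale_act P r (scale_act (/ P) (/ r)%C p) = p.
Proof.
  intros HP Hr; destruct p as [w z]; unfold scale_act; simpl.
  apply RtoC_neq0 in HP as HP'.
  rewrite RtoC_inv //; f_equal; field; assumption.
Qed.

Lemma Cmod_abs_parts (z x : C) :
  Rabs (Re z * Re x + - Im z * Im x) <= Cmod z * (Rabs (Re x) + Rabs (Im x)) /\
  Rabs (Re z * Im x + Im z * Re x) <= Cmod z * (Rabs (Re x) + Rabs (Im x)).
Proof.
  assert (A1 := Rle_trans _ _ _ (Rmax_l _ _) (Rmax_Cmod z)).
  assert (A2 := Rle_trans _ _ _ (Rmax_r _ _) (Rmax_Cmod z)).
  fold (Re z) in A1; fold (Im z) in A2.
  assert (0 <= Rabs (Re x)) by apply Rabs_pos.
  assert (0 <= Rabs (Im x)) by apply Rabs_pos.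
  split; (eapply Rle_trans; [apply Rabs_triang|]); rewrite !Rabs_mult ?Rabs_Ropp; nra.
Qed.

Definition automorphic (F : pt -> C) (P : R) (r mu : C) : Prop :=
  forall p, HxC p -> F (scale_act P r p) = (mu * F p)%C.

Lemma automorphic_parts (F : pt -> C) (P : R) (r mu : C) (p : pt) : automorphic F P r mu ->
  HxC p -> Re (F (scale_act P r p)) = Re mu * Re (F p) - Im mu * Im (F p) /\
           Im (F (scale_act P r p)) = Re mu * Im (F p) + Im mu * Re (F p).
Proof. intros A Hp; rewrite (A p Hp); split; reflexivity. Qed.

Lemma automorphic_comp (F : pt -> C) (P Q : R) (r r' mu nu : C) : 0 < Q ->
  automorphic F P r mu -> automorphic F Q r' nu -> automorphic F (P * Q) (r * r')%C (mu * nu)%C.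
Proof.
  intros HQ A1 A2 p Hp.
  replace (scale_act (P * Q) (r * r') p) with (scale_act P r (scale_act Q r' p)).
  - rewrite A1; [rewrite A2; [ring|assumption]|now apply HxC_scale_act].
  - unfold scale_act; simpl; rewrite RtoC_mult; f_equal; ring.
Qed.

Lemma automorphic_inv (F : pt -> C) (P : R) (r mu : C) : 0 < P -> r <> RtoC 0 -> mu <> RtoC 0 ->
  automorphic F P r mu -> automorphic F (/ P) (/ r)%C (/ mu)%C.
Proof.
  intros HP Hr Hm A p Hp.
  assert (E := A (scale_act (/ P) (/ r)%C p) (HxC_scale_act _ _ _ (Rinv_0_lt_compat _ HP) Hp)).
  rewrite scale_act_K in E; [|lra|assumption].
  rewrite E; field; assumption.
Qed.

Lemma automorphic_pow (F : pt -> C) (P : R) (r mu : C) (n : nat) : 0 < P ->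
  automorphic F P r mu -> automorphic F (P ^ n) (r ^ n)%C (mu ^ n)%C.
Proof.
  intros HP A; induction n as [|n IH].
  - intros p Hp; simpl; replace (scale_act 1 1%C p) with p; [ring|].
    destruct p; unfold scale_act; simpl; f_equal; ring.
  - simpl; apply automorphic_comp; trivial; now apply pow_lt.
Qed.

Definition re_part (F : pt -> C) (p : pt) : R := Re (F p).
Definition im_part (F : pt -> C) (p : pt) : R := Im (F p).

(** Rescaling conjugates translations: a difference at the image point is mu times a difference at p
    whose steps are rescaled backwards. Multiplication by mu mixes the real and imaginary parts. *)
Lemma automorphic_diff2 (F : pt -> C) (P : R) (r mu : C) (u v p : pt) :
  0 < P -> r <> RtoC 0 -> automorphic F P r mu -> translation u -> translation v -> HxC p ->
  let u' := scale_act (/ P) (/ r)%C u in let v' := scale_act (/ P) (/ r)%C v in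
  diff2 u v (re_part F) (scale_act P r p)
    = Re mu * diff2 u' v' (re_part F) p + - Im mu * diff2 u' v' (im_part F) p /\
  diff2 u v (im_part F) (scale_act P r p)
    = Re mu * diff2 u' v' (im_part F) p + Im mu * diff2 u' v' (re_part F) p.
Proof.
  intros HP Hr A Hu Hv Hp u' v'.
  assert (Hu' : translation u') by now apply translation_scale_act.
  assert (Hv' : translation v') by now apply translation_scale_act.
  assert (Eu : scale_act P r u' = u) by (apply scale_act_K; [lra|assumption]).
  assert (Ev : scale_act P r v' = v) by (apply scale_act_K; [lra|assumption]).
  assert (Hpu : HxC (move p u' 1)) by now apply HxC_translation.
  assert (Hpv : HxC (move p v' 1)) by now apply HxC_translation.
  assert (Hpuv : HxC (move (move p u' 1) v' 1)) by now apply HxC_translation.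
  assert (E1 : move (scale_act P r p) u 1 = scale_act P r (move p u' 1)).
  { rewrite scale_act_move Eu; reflexivity. }
  assert (E2 : move (scale_act P r p) v 1 = scale_act P r (move p v' 1)).
  { rewrite scale_act_move Ev; reflexivity. }
  assert (E3 : move (scale_act P r (move p u' 1)) v 1 = scale_act P r (move (move p u' 1) v' 1)).
  { rewrite (scale_act_move _ _ _ v') Ev; reflexivity. }
  unfold diff2, re_part, im_part; rewrite E1 E2 E3.
  destruct (automorphic_parts F P r mu _ A Hp) as [-> ->].
  destruct (automorphic_parts F P r mu _ A Hpu) as [-> ->].
  destruct (automorphic_parts F P r mu _ A Hpv) as [-> ->].
  destruct (automorphic_parts F P r mu _ A Hpuv) as [-> ->].
  split; ring.
Qed.

(** The chain rule: the direction X too is rescaled backwards. The combination with c1 and c2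
    accommodates the mixing of real and imaginary parts by a multiplier. *)
Lemma dird_scale_act (phi phi1 phi2 : pt -> R) (P : R) (r : C) (c1 c2 : R) (X p : pt) :
  P <> 0 -> r <> RtoC 0 -> smoothR phi1 -> smoothR phi2 ->
  (forall q, HxC q -> phi (scale_act P r q) = c1 * phi1 q + c2 * phi2 q) -> HxC p ->
  dird X phi (scale_act P r p)
  = c1 * dird (scale_act (/ P) (/ r)%C X) phi1 p + c2 * dird (scale_act (/ P) (/ r)%C X) phi2 p.
Proof.
  intros HP Hr S1 S2 E Hp; set (Y := scale_act (/ P) (/ r)%C X).
  apply dirR_eq.
  apply (is_derive_ext_loc (fun s => c1 * phi1 (move p Y s) + c2 * phi2 (move p Y s))).
  - generalize (HxC_move_near p Y Hp); apply filter_imp; intros s Hs.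
    rewrite -(E _ Hs) scale_act_move; unfold Y; rewrite scale_act_K //.
  - apply: is_derive_plus; apply: is_derive_scal; now apply smoothR_is_derive0.
Qed.

(** Rescaling backwards divides a z-direction by r; this is the source of the factor 1 / |r| in the
    gradient bounds. *)
Lemma vertical_inverse_coords (P : R) (r : C) (X : pt) :
  r <> RtoC 0 -> X = dir_1 \/ X = dir_2 ->
  let Y := scale_act (/ P) (/ r)%C X in
  translation Y /\ fst (fst Y) = 0 /\ Rabs (fst (snd Y)) <= / Cmod r /\ Rabs (snd (snd Y)) <= / Cmod r.
Proof.
  intros Hr HX Y.
  assert (T : translation Y) by (apply translation_scale_act; destruct HX as [-> | ->]; reflexivity).
  split; [exact T|].
  assert (B : Cmod (snd Y) <= / Cmod r).
  { unfold Y, scale_act; simpl; rewrite Cmod_mult Cmod_inv //.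
    assert (0 < / Cmod r) by (apply Rinv_0_lt_compat; now apply Cmod_gt_0).
    assert (Cmod (snd X) = 1).
    { destruct HX as [-> | ->]; unfold Cmod; simpl.
      - replace (1 * (1 * 1) + 0 * (0 * 1)) with 1 by ring; apply sqrt_1.
      - replace (0 * (0 * 1) + 1 * (1 * 1)) with 1 by ring; apply sqrt_1. }
    rewrite H0; lra. }
  assert (M := Rmax_Cmod (snd Y)).
  assert (M1 := Rmax_l (Rabs (fst (snd Y))) (Rabs (snd (snd Y)))).
  assert (M2 := Rmax_r (Rabs (fst (snd Y))) (Rabs (snd (snd Y)))).
  repeat split; [|lra..].
  unfold Y, scale_act; destruct HX as [-> | ->]; simpl; ring.
Qed.

Definition csmooth_periodic (F : pt -> C) : Prop := smooth_periodic (re_part F) /\ smooth_periodic (im_part F).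

(** The constant K comes from the fibre t = 1 and serves every height P: the point is carried to
    that fibre at the price of a factor |mu|, and the steps become the rescaled ones. N may be the
    length of either of them. *)
Lemma automorphic_value_bound (F : pt -> C) : csmooth_periodic F ->
  exists K, 0 <= K /\ forall P r mu u v p N, 0 < P -> r <> RtoC 0 -> automorphic F P r mu ->
    translation u -> translation v -> Im (fst p) = P ->
    N = nrm (scale_act (/ P) (/ r)%C u) \/ N = nrm (scale_act (/ P) (/ r)%C v) ->
    Rabs (diff2 u v (re_part F) p) <= Cmod mu * (K * N) /\
    Rabs (diff2 u v (im_part F) p) <= Cmod mu * (K * N).
Proof.
  intros [S1 S2].
  destruct (diff2_bound _ 1 Rlt_0_1 S1) as [K1 [P1 B1]].
  destruct (diff2_bound _ 1 Rlt_0_1 S2) as [K2 [P2 B2]].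
  exists (K1 + K2); split; [lra|].
  intros P r mu u v p N HP Hr A Hu Hv Hp HN.
  set (p' := scale_act (/ P) (/ r)%C p).
  assert (Ep : p = scale_act P r p') by (symmetry; apply scale_act_K; [lra|assumption]).
  assert (Hp' : Im (fst p') = 1) by (unfold p'; rewrite Im_scale_act Hp; field; lra).
  assert (Hp'' : HxC p') by (unfold HxC; lra).
  destruct (automorphic_diff2 F P r mu u v p' HP Hr A Hu Hv Hp'') as [E1 E2].
  rewrite -Ep in E1 E2; rewrite E1 E2; clear E1 E2.
  set (u' := scale_act (/ P) (/ r)%C u) in *; set (v' := scale_act (/ P) (/ r)%C v) in *.
  destruct (B1 u' v' p' (translation_scale_act _ _ _ Hu) (translation_scale_act _ _ _ Hv) Hp') as [X1 X2].
  destruct (B2 u' v' p' (translation_scale_act _ _ _ Hu) (translation_scale_act _ _ _ Hv) Hp') as [Y1 Y2].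
  set (x := diff2 u' v' (re_part F) p') in *; set (y := diff2 u' v' (im_part F) p') in *.
  assert (Hx : Rabs x <= K1 * N) by (destruct HN as [-> | ->]; assumption).
  assert (Hy : Rabs y <= K2 * N) by (destruct HN as [-> | ->]; assumption).
  destruct (Cmod_abs_parts mu (x, y)) as [Z1 Z2]; simpl in Z1, Z2.
  assert (L : Cmod mu * (Rabs x + Rabs y) <= Cmod mu * ((K1 + K2) * N)).
  { apply Rmult_le_compat_l; [apply Cmod_ge_0|lra]. }
  split; [exact (Rle_trans _ _ _ Z1 L)|exact (Rle_trans _ _ _ Z2 L)].
Qed.

Lemma automorphic_gradient_bound (F : pt -> C) : csmooth_periodic F ->
  exists K, 0 <= K /\ forall P r mu u v p N X, 0 < P -> r <> RtoC 0 -> automorphic F P r mu ->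
    translation u -> translation v -> Im (fst p) = P ->
    N = nrm (scale_act (/ P) (/ r)%C u) \/ N = nrm (scale_act (/ P) (/ r)%C v) ->
    X = dir_1 \/ X = dir_2 ->
    Rabs (dird X (diff2 u v (re_part F)) p) <= Cmod mu / Cmod r * (K * N) /\
    Rabs (dird X (diff2 u v (im_part F)) p) <= Cmod mu / Cmod r * (K * N).
Proof.
  intros [S1 S2].
  assert (DB := fun X f Sf => diff2_bound _ 1 Rlt_0_1 (sp_dirR X f Sf)).
  destruct (DB dir_1 _ S1) as [K1 [P1 B1]].
  destruct (DB dir_2 _ S1) as [K2 [P2 B2]].
  destruct (DB dir_1 _ S2) as [K3 [P3 B3]].
  destruct (DB dir_2 _ S2) as [K4 [P4 B4]].
  exists (K1 + K2 + K3 + K4); split; [lra|].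
  intros P r mu u v p N X HP Hr A Hu Hv Hp HN HX.
  set (p' := scale_act (/ P) (/ r)%C p).
  assert (Ep : p = scale_act P r p') by (symmetry; apply scale_act_K; [lra|assumption]).
  assert (Hp' : Im (fst p') = 1) by (unfold p'; rewrite Im_scale_act Hp; field; lra).
  assert (Hp'' : HxC p') by (unfold HxC; lra).
  set (u' := scale_act (/ P) (/ r)%C u) in *; set (v' := scale_act (/ P) (/ r)%C v) in *.
  assert (Tu : translation u') by (apply translation_scale_act; assumption).
  assert (Tv : translation v') by (apply translation_scale_act; assumption).
  assert (SR := smoothR_diff2 u' v' (re_part F) Tu Tv (proj1 S1)).
  assert (SI := smoothR_diff2 u' v' (im_part F) Tu Tv (proj1 S2)).
  assert (HP0 : P <> 0) by lra.
  assert (E1 := dird_scale_act (diff2 u v (re_part F)) _ _ P r (Re mu) (- Im mu) X p' HP0 Hr SR SI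
    (fun q Hq => proj1 (automorphic_diff2 F P r mu u v q HP Hr A Hu Hv Hq)) Hp'').
  assert (E2 := dird_scale_act (diff2 u v (im_part F)) _ _ P r (Re mu) (Im mu) X p' HP0 Hr SI SR
    (fun q Hq => proj2 (automorphic_diff2 F P r mu u v q HP Hr A Hu Hv Hq)) Hp'').
  rewrite -Ep in E1 E2; rewrite E1 E2; clear E1 E2.
  destruct (vertical_inverse_coords P r X Hr HX) as [TY [Yx [Y1 Y2]]].
  set (Y := scale_act (/ P) (/ r)%C X) in *.
  assert (L : forall f K K', smooth_periodic f -> 0 <= K -> 0 <= K' ->
    (forall u v p, translation u -> translation v -> Im (fst p) = 1 ->
       Rabs (diff2 u v (dird dir_1 f) p) <= K * nrm u /\ Rabs (diff2 u v (dird dir_1 f) p) <= K * nrm v) ->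
    (forall u v p, translation u -> translation v -> Im (fst p) = 1 ->
       Rabs (diff2 u v (dird dir_2 f) p) <= K' * nrm u /\ Rabs (diff2 u v (dird dir_2 f) p) <= K' * nrm v) ->
    Rabs (dird Y (diff2 u' v' f) p') <= / Cmod r * ((K + K') * N)).
  { intros f K K' Sf HK HK' B B'.
    rewrite dird_coords //; [|apply smoothR_diff2; trivial; apply Sf].
    rewrite Yx !(dird_diff2 u' v') //; try apply Sf.
    destruct (B u' v' p' Tu Tv Hp') as [b1 b2], (B' u' v' p' Tu Tv Hp') as [b1' b2'].
    set (x := diff2 u' v' (dird dir_1 f) p') in *; set (y := diff2 u' v' (dird dir_2 f) p') in *.
    assert (Hx : Rabs x <= K * N) by (destruct HN as [-> | ->]; assumption).
    assert (Hy : Rabs y <= K' * N) by (destruct HN as [-> | ->]; assumption).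
    rewrite Rmult_0_l Rplus_0_l.
    eapply Rle_trans; [apply Rabs_triang|]; rewrite !Rabs_mult.
    assert (Rabs (fst (snd Y)) * Rabs x <= / Cmod r * (K * N)).
    { apply Rmult_le_compat; try apply Rabs_pos; assumption. }
    assert (Rabs (snd (snd Y)) * Rabs y <= / Cmod r * (K' * N)).
    { apply Rmult_le_compat; try apply Rabs_pos; assumption. }
    lra. }
  assert (LR := L _ K1 K2 S1 P1 P2 B1 B2).
  assert (LI := L _ K3 K4 S2 P3 P4 B3 B4).
  set (x := dird Y (diff2 u' v' (re_part F)) p') in *; set (y := dird Y (diff2 u' v' (im_part F)) p') in *.
  destruct (Cmod_abs_parts mu (x, y)) as [Z1 Z2]; simpl in Z1, Z2.
  assert (LL : Cmod mu * (Rabs x + Rabs y) <= Cmod mu / Cmod r * ((K1 + K2 + K3 + K4) * N)).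
  { replace (Cmod mu / Cmod r * ((K1 + K2 + K3 + K4) * N))
      with (Cmod mu * (/ Cmod r * ((K1 + K2) * N) + / Cmod r * ((K3 + K4) * N))) by (unfold Rdiv; ring).
    apply Rmult_le_compat_l; [apply Cmod_ge_0|lra]. }
  split; [exact (Rle_trans _ _ _ Z1 LL)|exact (Rle_trans _ _ _ Z2 LL)].
Qed.

Definition diff2_energy (s : R) (F G : pt -> C) (u v : pt) : pt -> R :=
  energy s (diff2 u v (re_part F)) (diff2 u v (im_part F))
                    (diff2 u v (re_part G)) (diff2 u v (im_part G)).

(** A gradient of F times a value of G: |mu| / |r| from the first, |nu| from the second, and one
    factor N from each. *)
Lemma energy_bound (s : R) (F G : pt -> C) : csmooth_periodic F -> csmooth_periodic G -> Rabs s <= 1 ->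
  exists K, 0 <= K /\ forall P r mu nu u v p N, 0 < P -> r <> RtoC 0 ->
    automorphic F P r mu -> automorphic G P r nu ->
    translation u -> translation v -> Im (fst p) = P ->
    N = nrm (scale_act (/ P) (/ r)%C u) \/ N = nrm (scale_act (/ P) (/ r)%C v) ->
    Rabs (diff2_energy s F G u v p) <= K * (Cmod mu * Cmod nu / Cmod r) * (N * N).
Proof.
  intros SF SG Hs.
  destruct (automorphic_gradient_bound F SF) as [K [HK B]].
  destruct (automorphic_value_bound G SG) as [K' [HK' B']].
  (* The integrand has two products, each with a first factor at most 2 a and a second at most b, in
     the notation set below. *)
  exists (4 * (K * K')); split; [nra|].
  intros P r mu nu u v p N HP Hr AF AG Hu Hv Hp HN.
  destruct SF as [S1 S2], SG as [S3 S4].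
  assert (T1 := sp_diff2 u v _ Hu Hv S1).
  assert (T2 := sp_diff2 u v _ Hu Hv S2).
  assert (T3 := sp_diff2 u v _ Hu Hv S3).
  assert (T4 := sp_diff2 u v _ Hu Hv S4).
  apply fibre_abs_le; try assumption.
  - assert (D := fun X f Sf => sp_dirR X f Sf).
    assert (X1 := sp_minus _ _ (D dir_1 _ T1) (sp_scal s _ (D dir_2 _ T2))).
    assert (X2 := sp_plus _ _ (D dir_1 _ T2) (sp_scal s _ (D dir_2 _ T1))).
    exact (proj1 (sp_minus _ _ (sp_mult _ _ X1 T4) (sp_mult _ _ X2 T3))).
  - unfold HxC; lra.
  - intros q _ Hq; rewrite Hp in Hq.
    destruct (B P r mu u v q N dir_1 HP Hr AF Hu Hv Hq HN (or_introl erefl)) as [b1 b2].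
    destruct (B P r mu u v q N dir_2 HP Hr AF Hu Hv Hq HN (or_intror erefl)) as [b3 b4].
    destruct (B' P r nu u v q N HP Hr AG Hu Hv Hq HN) as [b5 b6].
    set (x1 := dird dir_1 (diff2 u v (re_part F)) q) in *.
    set (x2 := dird dir_1 (diff2 u v (im_part F)) q) in *.
    set (y1 := dird dir_2 (diff2 u v (re_part F)) q) in *.
    set (y2 := dird dir_2 (diff2 u v (im_part F)) q) in *.
    set (g1 := diff2 u v (re_part G) q) in *; set (g2 := diff2 u v (im_part G) q) in *.
    set (a := Cmod mu / Cmod r * (K * N)) in *; set (b := Cmod nu * (K' * N)) in *.
    replace (4 * (K * K') * (Cmod mu * Cmod nu / Cmod r) * (N * N)) with (4 * (a * b))
      by (unfold a, b, Rdiv; ring).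
    clearbody x1 x2 y1 y2 g1 g2 a b.
    assert (a0 : 0 <= a) by (apply Rle_trans with (2 := b1); apply Rabs_pos).
    assert (b0 : 0 <= b) by (apply Rle_trans with (2 := b5); apply Rabs_pos).
    assert (SY : forall y, Rabs y <= a -> Rabs (s * y) <= a).
    { intros y Hy; rewrite Rabs_mult; generalize (Rabs_pos y); generalize (Rabs_pos s); nra. }
    assert (C1 : Rabs (x1 - s * y2) <= 2 * a).
    { apply Rle_trans with (Rabs x1 + Rabs (s * y2)); [|specialize (SY y2 b4); lra].
      unfold Rminus; rewrite -(Rabs_Ropp (s * y2)); apply Rabs_triang. }
    assert (C2 : Rabs (x2 + s * y1) <= 2 * a).
    { apply Rle_trans with (1 := Rabs_triang _ _); specialize (SY y1 b3); lra. }
    apply Rle_trans with (Rabs ((x1 - s * y2) * g2) + Rabs ((x2 + s * y1) * g1)).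
    { unfold Rminus at 1; rewrite -(Rabs_Ropp ((x2 + s * y1) * g1)); apply Rabs_triang. }
    rewrite !Rabs_mult.
    assert (Rabs (x1 - s * y2) * Rabs g2 <= 2 * a * b).
    { apply Rmult_le_compat; try apply Rabs_pos; assumption. }
    assert (Rabs (x2 + s * y1) * Rabs g1 <= 2 * a * b).
    { apply Rmult_le_compat; try apply Rabs_pos; assumption. }
    lra.
Qed.

(** * Dense periods *)

Definition period (w : pt) (phi : pt -> R) : Prop :=
  forall p, HxC p -> phi (move p w 1) = phi p.

Lemma period_INR (w p : pt) (phi : pt -> R) (n : nat) : translation w -> period w phi ->
  HxC p -> phi (move p w (INR n)) = phi p.
Proof.
  intros Hw P Hp; induction n as [|n IH]; [now rewrite move0|].
  rewrite S_INR -move_move P //; now apply HxC_translation.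
Qed.

Lemma period_IZR (w p : pt) (phi : pt -> R) (k : Z) : translation w -> period w phi ->
  HxC p -> phi (move p w (IZR k)) = phi p.
Proof.
  intros Hw P Hp; destruct (Z_lt_le_dec k 0) as [H|H]; swap 1 2.
  - rewrite -(Z2Nat.id k H) -INR_IZR_INZ; now apply period_INR.
  - assert (E := period_INR w (move p w (IZR k)) phi (Z.to_nat (- k)) Hw P (HxC_translation _ _ _ Hw Hp)).
    rewrite -E move_move; rewrite INR_IZR_INZ Z2Nat.id; [|lia].
    rewrite -plus_IZR Z.add_opp_diag_r move0; reflexivity.
Qed.

Lemma floor_remainder (x : R) : Rabs (x - IZR (Int_part x)) <= 1.
Proof. destruct (base_Int_part x); apply Rabs_le; lra. Qed.

Lemma translation_lincomb (r s : R) (X Y : pt) : translation X -> translation Y ->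
  translation (lincomb r X s Y).
Proof.
  destruct X as [[x t] [y1 y2]], Y as [[x' t'] [y1' y2']]; unfold translation, Im; simpl.
  intros -> ->; ring.
Qed.

Definition horizontal (L : R) : pt := ((L, 0), (0, 0)).
Definition vertical (z : C) : pt := ((0, 0), z).

(** For large n the point t lies between alpha^(-n) and alpha^n, so h t lies between two values that
    tend to 0. *)
Lemma monotone_squeeze (h : R -> R) (alpha A B q q' : R) : 1 < alpha ->
  (forall x y, 0 < x <= y -> h x <= h y) -> 0 <= q < 1 -> 0 <= q' < 1 ->
  (forall n : nat, Rabs (h (alpha ^ n)) <= A * q ^ n) ->
  (forall n : nat, Rabs (h (/ alpha ^ n)) <= B * q' ^ n) ->
  forall t, 0 < t -> h t = 0.
Proof.
  intros Ha Hm Hq Hq' HA HB t Ht.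
  apply cond_eq; intros eps He; rewrite Rminus_0_r.
  assert (HA0 : 0 <= A).
  { specialize (HA 0%nat); simpl in HA; apply Rle_trans with (1 := Rabs_pos _) in HA; lra. }
  assert (HB0 : 0 <= B).
  { specialize (HB 0%nat); simpl in HB; apply Rle_trans with (1 := Rabs_pos _) in HB; lra. }
  assert (Small : forall D r, 0 <= D -> 0 <= r < 1 ->
    exists N : nat, forall n, (n >= N)%coq_nat -> D * r ^ n < eps).
  { intros D r HD Hr.
    destruct (pow_lt_1_zero r) with (y := eps / (D + 1)) as [N HN].
    - rewrite Rabs_pos_eq; lra.
    - apply Rdiv_lt_0_compat; lra.
    - exists N; intros n Hn; specialize (HN n Hn).
      assert (0 <= r ^ n) by (apply pow_le; lra).
      rewrite Rabs_pos_eq // in HN.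
      apply Rle_lt_trans with ((D + 1) * r ^ n); [nra|].
      apply Rmult_lt_reg_l with (/ (D + 1)); [apply Rinv_0_lt_compat; lra|].
      replace (/ (D + 1) * ((D + 1) * r ^ n)) with (r ^ n) by (field; lra).
      unfold Rdiv in HN; lra. }
  destruct (Small A q HA0 Hq) as [N1 H1].
  destruct (Small B q' HB0 Hq') as [N2 H2].
  (* A power above both t and 1 / t puts t between [/ alpha ^ n] and [alpha ^ n]. *)
  destruct (Pow_x_infinity alpha) with (b := Rmax t (/ t)) as [N3 H3].
  { rewrite Rabs_pos_eq; lra. }
  set (n := Nat.add N1 (Nat.add N2 N3)).
  assert (X1 : A * q ^ n < eps) by (apply H1; unfold n, ge; lia).
  assert (X2 : B * q' ^ n < eps) by (apply H2; unfold n, ge; lia).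
  assert (X3 : Rabs (alpha ^ n) >= Rmax t (/ t)) by (apply H3; unfold n, ge; lia).
  assert (Pn : 0 < alpha ^ n) by (apply pow_lt; lra).
  rewrite Rabs_pos_eq in X3; [|lra].
  assert (M1 := Rmax_l t (/ t)); assert (M2 := Rmax_r t (/ t)).
  assert (U : h t <= h (alpha ^ n)) by (apply Hm; lra).
  assert (L : h (/ alpha ^ n) <= h t).
  { apply Hm; split; [now apply Rinv_0_lt_compat|].
    rewrite -(Rinv_inv t); apply Rinv_le_contravar; [now apply Rinv_0_lt_compat|lra]. }
  specialize (HA n); specialize (HB n).
  apply Rabs_le_between in HA, HB; apply Rabs_def1; lra.
Qed.

(** Once phi does not depend on z, a period with small x-part acts as a small translation in x,
    however large its z-part. *)
Lemma constant_of_vertical (phi : pt -> R) : smooth_periodic phi ->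
  (forall q, HxC q -> dird dir_1 phi q = 0 /\ dird dir_2 phi q = 0) ->
  (forall eps, 0 < eps -> exists w, translation w /\ period w phi /\
     0 < Rabs (fst (fst w)) <= eps) ->
  forall X p, translation X -> HxC p -> phi (move p X 1) = phi p.
Proof.
  intros S V P X p HX Hp.
  assert (Vert : forall q z, HxC q -> phi (move q (vertical z) 1) = phi q).
  { intros q z Hq.
    assert (T : translation (vertical z)) by reflexivity.
    apply constant_along; [exact T|apply S| |exact Hq].
    intros r Hr; rewrite dird_coords; [|exact T|apply S|exact Hr].
    destruct (V r Hr) as [-> ->]; simpl; ring. }
  apply (dense_periods phi X p HX S Hp).
  intros eps He; destruct (P eps He) as [w [Tw [Pw [h0 h1]]]].
  assert (Hne : fst (fst w) <> 0) by (intros E; rewrite E Rabs_R0 in h0; lra).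
  (* k copies of w reach the x-part of X up to |h|; the vertical step z then makes the z-parts agree
     exactly. *)
  set (h := fst (fst w)) in *; set (k := Int_part (fst (fst X) / h)).
  set (z := (snd X - RtoC (IZR k) * snd w)%C).
  exists (lincomb (IZR k) w 1 (vertical z)).
  assert (T : translation (vertical z)) by reflexivity.
  split; [now apply translation_lincomb|split].
  - rewrite move_lincomb !Rmult_1_r Vert; [now apply period_IZR|now apply HxC_translation].
  - assert (B := floor_remainder (fst (fst X) / h)); fold k in B.
    assert (E : nrm (lincomb 1 X (-1) (lincomb (IZR k) w 1 (vertical z)))
                = Rabs ((fst (fst X) / h - IZR k) * h)).
    { unfold nrm, lincomb, vertical, z; destruct X as [[x t] [y1 y2]], w as [[x' t'] [y1' y2']].
      unfold h in *; simpl in *.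
      match goal with |- Rabs ?a + (Rabs ?b + Rabs ?c) = Rabs ?d =>
        replace b with 0 by ring; replace c with 0 by ring; replace a with d by (field; exact Hne) end.
      rewrite Rabs_R0; ring. }
    rewrite E Rabs_mult; generalize (Rabs_pos h); nra.
Qed.

(** With phi independent of x only the z-parts of periods count. Those of w and w' are u and beta u,
    an R-basis of C because beta is not real; they generate a lattice of mesh comparable to |u|. *)
Lemma constant_of_horizontal (beta : C) (phi : pt -> R) : smooth_periodic phi -> Im beta <> 0 -> Cmod beta <= 1 ->
  (forall L q, HxC q -> phi (move q (horizontal L) 1) = phi q) ->
  (forall eps, 0 < eps -> exists w w', translation w /\ translation w' /\
     period w phi /\ period w' phi /\ snd w' = (beta * snd w)%C /\ 0 < Cmod (snd w) <= eps) ->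
  forall X p, translation X -> HxC p -> phi (move p X 1) = phi p.
Proof.
  intros S Hbeta Hb1 Hor P X p HX Hp.
  apply (dense_periods phi X p HX S Hp).
  (* The remainder d below has modulus at most 2 |u|, by |beta| <= 1, and [nrm] counts its two
     coordinates: 4 |u| in all. *)
  intros eps He; destruct (P (eps / 4)) as [w [w' [Tw [Tw' [Pw [Pw' [Ew [h0 h1]]]]]]]]; [lra|].
  set (u := snd w) in *.
  assert (Hu : u <> RtoC 0) by now apply Cmod_gt_0.
  (* s and r are the real coordinates of c in the basis 1, beta; their integer parts give the period
     used. *)
  set (c := (snd X / u)%C); set (r := Im c / Im beta); set (s := Re c - r * Re beta).
  assert (Ec : c = (RtoC s + RtoC r * beta)%C).
  { unfold s, r; destruct c as [c1 c2], beta as [b1 b2]; unfold Cplus, Cmult, RtoC; simpl in *.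
    f_equal; field; exact Hbeta. }
  set (k := Int_part s); set (j := Int_part r).
  set (L := fst (fst X) - IZR k * fst (fst w) - IZR j * fst (fst w')).
  assert (TL : translation (horizontal L)) by reflexivity.
  set (W := lincomb 1 (lincomb (IZR k) w (IZR j) w') 1 (horizontal L)).
  exists W; split; [now repeat apply translation_lincomb|split].
  - unfold W; rewrite move_lincomb !Rmult_1_r Hor.
    + rewrite move_lincomb !Rmult_1_r.
      rewrite (period_IZR w' _ phi j Tw' Pw' (HxC_translation p w _ Tw Hp)).
      now apply period_IZR.
    + apply HxC_translation; [now apply translation_lincomb|exact Hp].
  - set (d := (RtoC (s - IZR k) * u + RtoC (r - IZR j) * (beta * u))%C).
    assert (E : lincomb 1 X (-1) W = vertical d).
    { assert (E2 : snd X = (RtoC s * u + RtoC r * (beta * u))%C).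
      { replace (snd X) with (c * u)%C by (unfold c; field; exact Hu).
        rewrite Ec; ring. }
      unfold vertical; apply injective_projections.
      - unfold W, lincomb, horizontal, L; simpl; revert HX Tw Tw'; unfold translation, Im.
        destruct X as [[x t] ?], w as [[x' t'] ?], w' as [[x'' t''] ?]; simpl.
        intros -> -> ->; unfold Cplus, Cmult, RtoC; simpl; f_equal; ring.
      - unfold W, lincomb, horizontal; simpl; rewrite E2 Ew; fold u; unfold d.
        replace (0, 0) with (RtoC 0) by reflexivity.
        rewrite !RtoC_minus; ring. }
    assert (M1 := Rle_trans _ _ _ (Rmax_l _ _) (Rmax_Cmod d)).
    assert (M2 := Rle_trans _ _ _ (Rmax_r _ _) (Rmax_Cmod d)).
    assert (M : Cmod d <= 2 * Cmod u).
    { unfold d; eapply Rle_trans; [apply Cmod_triangle|].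
      rewrite !Cmod_mult !Cmod_R.
      assert (A1 := floor_remainder s); assert (A2 := floor_remainder r); fold k in A1; fold j in A2.
      assert (B0 := Cmod_ge_0 beta).
      assert (Rabs (s - IZR k) * Cmod u <= 1 * Cmod u) by (apply Rmult_le_compat_r; lra).
      assert (Rabs (r - IZR j) * (Cmod beta * Cmod u) <= 1 * (1 * Cmod u)).
      { apply Rmult_le_compat; [apply Rabs_pos|nra|exact A2|apply Rmult_le_compat_r; lra]. }
      lra. }
    rewrite E; clearbody d; unfold nrm, vertical; simpl; rewrite Rabs_R0.
    lra.
Qed.

Lemma diff2_shift (u v q : pt) (phi : pt -> R) :
  diff2 u v phi q = (fun r => phi (move r u 1) - phi r) (move q v 1)
                    - (fun r => phi (move r u 1) - phi r) q.
Proof. unfold diff2; rewrite (moveC q v u); ring. Qed.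

(** A difference has fibre mean 0 by translation invariance; being constant on the fibre, it equals
    that mean. *)
Lemma constant_diff_zero (w : pt) (phi : pt -> R) : translation w -> smooth_periodic phi ->
  (forall X p, translation X -> HxC p ->
     phi (move (move p X 1) w 1) - phi (move p X 1) = phi (move p w 1) - phi p) ->
  forall p, HxC p -> phi (move p w 1) = phi p.
Proof.
  intros Hw S Cst p Hp.
  assert (S' := sp_minus _ _ (sp_shift w phi Hw S) S).
  assert (E := fibre_of_constant _ p S' Hp (fun X HX => Cst X p HX Hp)).
  rewrite fibre_diff_zero // in E; cbv beta in E; lra.
Qed.

Lemma period_shift (w u : pt) (phi : pt -> R) : translation u -> period w phi ->
  period w (fun q => phi (move q u 1)).
Proof.
  intros Hu P p Hp; rewrite moveC; apply P; now apply HxC_translation.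
Qed.

Lemma period_minus (w : pt) (phi psi : pt -> R) : period w phi -> period w psi ->
  period w (fun q => phi q - psi q).
Proof. intros P Q p Hp; rewrite (P p Hp) (Q p Hp); reflexivity. Qed.

Lemma dird_vertical_zero (phi : pt -> R) (q : pt) :
  (forall z, phi (move q (vertical z) 1) = phi q) ->
  dird dir_1 phi q = 0 /\ dird dir_2 phi q = 0.
Proof.
  intros V.
  assert (E1 : forall s, move q dir_1 s = move q (vertical (s, 0)) 1).
  { intros s; rewrite !moveE; simpl; apply pt_ext; ring. }
  assert (E2 : forall s, move q dir_2 s = move q (vertical (0, s)) 1).
  { intros s; rewrite !moveE; simpl; apply pt_ext; ring. }
  split; apply dirR_eq; apply (is_derive_ext (fun _ => phi q)); try apply @is_derive_const;
    intros s; rewrite ?E1 ?E2 V; reflexivity.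
Qed.

(** The mixed difference is constant on fibres, hence 0, so the horizontal difference psi does not
    depend on z. Then psi is itself constant on fibres, hence 0, so phi does not depend on x, and
    the periods with small z-part conclude. *)
Lemma fibre_constant (beta : C) (phi : pt -> R) : smooth_periodic phi -> Im beta <> 0 -> Cmod beta <= 1 ->
  (forall eps, 0 < eps -> exists w, translation w /\ period w phi /\
     0 < Rabs (fst (fst w)) <= eps) ->
  (forall eps, 0 < eps -> exists w w', translation w /\ translation w' /\
     period w phi /\ period w' phi /\ snd w' = (beta * snd w)%C /\ 0 < Cmod (snd w) <= eps) ->
  (forall L z q, HxC q -> dird dir_1 (diff2 (horizontal L) (vertical z) phi) q = 0 /\
                          dird dir_2 (diff2 (horizontal L) (vertical z) phi) q = 0) ->
  forall X p, translation X -> HxC p -> phi (move p X 1) = phi p.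
Proof.
  intros S Hbeta Hb1 Px Pz V.
  apply (constant_of_horizontal beta); try assumption.
  intros L; set (u := horizontal L).
  assert (Tu : translation u) by reflexivity.
  set (psi := fun r => phi (move r u 1) - phi r).
  assert (Spsi : smooth_periodic psi) by (apply sp_minus; [now apply (sp_shift u)|exact S]).
  assert (Ppsi : forall w, period w phi -> period w psi).
  { intros w P; apply (period_minus w (fun r => phi (move r u 1)) phi); [now apply period_shift|exact P]. }
  assert (Vpsi : forall z q, HxC q -> psi (move q (vertical z) 1) = psi q).
  { intros z; set (v := vertical z).
    assert (Tv : translation v) by reflexivity.
    apply (constant_diff_zero v psi Tv Spsi).
    assert (Sd : smooth_periodic (diff2 u v phi)) by now apply sp_diff2.
    assert (K := constant_of_vertical (diff2 u v phi) Sd (V L z)).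
    intros X p HX Hp; unfold psi; rewrite -!(diff2_shift u v _ phi); apply K; trivial.
    intros eps He; destruct (Px eps He) as [w [Tw [Pw Bw]]].
    exists w; split; [exact Tw|split; [|exact Bw]].
    intros q Hq; rewrite !diff2_shift.
    change (psi (move (move q w 1) v 1) - psi (move q w 1) = psi (move q v 1) - psi q).
    rewrite (period_shift w v psi Tv (Ppsi w Pw) q Hq) (Ppsi w Pw q Hq); reflexivity. }
  apply (constant_diff_zero u phi Tu S).
  intros X p HX Hp; change (psi (move p X 1) = psi p).
  apply (constant_of_vertical psi Spsi); trivial.
  - intros q Hq; apply dird_vertical_zero; intros z; now apply Vpsi.
  - intros eps He; destruct (Px eps He) as [w [Tw [Pw Bw]]].
    exists w; split; [exact Tw|split; [now apply Ppsi|exact Bw]].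
Qed.

(** * Rigidity *)

Definition cperiod (w : pt) (F : pt -> C) : Prop := forall p, HxC p -> F (move p w 1) = F p.

Lemma cperiod_parts (w : pt) (F : pt -> C) : cperiod w F ->
  period w (re_part F) /\ period w (im_part F).
Proof. intros P; split; intros p Hp; unfold re_part, im_part; now rewrite P. Qed.

(** Automorphy conjugates the translation by w' to the one by w, and the nonzero multiplier
    cancels. *)
Lemma cperiod_scale (F : pt -> C) (P : R) (r mu : C) (w w' : pt) : 0 < P -> mu <> RtoC 0 ->
  automorphic F P r mu -> translation w' -> scale_act P r w' = w -> cperiod w F -> cperiod w' F.
Proof.
  intros HP Hm A Hw' Ew Per p Hp.
  assert (E := A _ (HxC_translation p w' 1 Hw' Hp)).
  rewrite scale_act_move Ew Per in E; [|now apply HxC_scale_act].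
  rewrite (A p Hp) in E.
  replace (F (move p w' 1)) with (/ mu * (mu * F (move p w' 1)))%C by (field; exact Hm).
  rewrite -E; field; exact Hm.
Qed.

Lemma Cpow_neq0 (r : C) (n : nat) : r <> RtoC 0 -> (r ^ n)%C <> RtoC 0.
Proof.
  intros Hr; apply Cmod_gt_0; rewrite Cmod_pow; apply pow_lt; now apply Cmod_gt_0.
Qed.

Lemma pow_small (q D eps : R) : 0 <= q < 1 -> 0 < eps -> exists n : nat, q ^ n * D <= eps.
Proof.
  intros Hq He.
  destruct (pow_lt_1_zero q) with (y := eps / (Rabs D + 1)) as [N HN].
  - rewrite Rabs_pos_eq; lra.
  - apply Rdiv_lt_0_compat; [lra|generalize (Rabs_pos D); lra].
  - exists N; specialize (HN N (le_n N)).
    assert (0 <= q ^ N) by (apply pow_le; lra).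
    rewrite Rabs_pos_eq // in HN.
    assert (B := Rle_abs D); assert (B0 := Rabs_pos D).
    apply Rle_trans with (q ^ N * (Rabs D + 1)); [apply Rmult_le_compat_l; lra|].
    apply Rmult_le_reg_r with (/ (Rabs D + 1)); [apply Rinv_0_lt_compat; lra|].
    replace (q ^ N * (Rabs D + 1) * / (Rabs D + 1)) with (q ^ N) by (field; lra).
    unfold Rdiv in HN; lra.
Qed.

(** The setting of [rigidity], common to both chiralities: s = 1 for D^+ and s = -1 for D^-. The
    vectors wa and wb are lattice vectors with nonzero x-part and nonzero z-part. *)
Variables (F G : pt -> C) (s c1 c2 alpha : R) (beta mu nu : C) (wa wb : pt).
Hypothesis SF : csmooth_periodic F.
Hypothesis SG : csmooth_periodic G.
Hypothesis Halpha : 1 < alpha.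
Hypothesis Hbeta : Im beta <> 0.
Hypothesis Hvol : alpha * Cmod beta ^ 2 = 1.
Hypothesis Hmu : mu <> RtoC 0.
Hypothesis Hnu : nu <> RtoC 0.
Hypothesis AF : automorphic F alpha beta mu.
Hypothesis AG : automorphic G alpha beta nu.
(** The window in which both geometric ratios of [scaled_energy_bounds] are below 1. *)
Hypothesis Hkappa : / alpha < Cmod mu * Cmod nu / Cmod beta < alpha ^ 2.
Hypothesis Hs : s * s = 1.
Hypothesis Hc1 : 0 < c1.
Hypothesis Hc2 : 0 < c2.
Hypothesis Sys : elliptic_system s c1 c2 (re_part F) (im_part F) (re_part G) (im_part G).
Hypothesis Twa : translation wa.
Hypothesis Twb : translation wb.
Hypothesis Nwa : fst (fst wa) <> 0.
Hypothesis Nwb : snd wb <> RtoC 0.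
Hypothesis PFa : cperiod wa F.
Hypothesis PFb : cperiod wb F.
Hypothesis PGa : cperiod wa G.
Hypothesis PGb : cperiod wb G.

Lemma beta_neq0 : beta <> RtoC 0.
Proof. intros E; apply Hbeta; now rewrite E. Qed.

Lemma Cmod_beta_lt1 : 0 < Cmod beta < 1.
Proof.
  assert (B : 0 < Cmod beta) by (apply Cmod_gt_0, beta_neq0).
  split; [exact B|].
  destruct (Rlt_le_dec (Cmod beta) 1) as [|H]; [assumption|exfalso].
  assert (1 <= Cmod beta ^ 2) by (simpl; nra); nra.
Qed.

Lemma Rabs_s : Rabs s <= 1.
Proof. apply Rabs_le; nra. Qed.

Lemma scaled_energy_bounds (L : R) (z : C) :
  exists A B q q', (0 <= q < 1 /\ 0 <= q' < 1) /\
  (forall (n : nat) p, Im (fst p) = alpha ^ n ->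
     Rabs (diff2_energy s F G (horizontal L) (vertical z) p) <= A * q ^ n) /\
  (forall (n : nat) p, Im (fst p) = / alpha ^ n ->
     Rabs (diff2_energy s F G (horizontal L) (vertical z) p) <= B * q' ^ n).
Proof.
  destruct (energy_bound s F G SF SG Rabs_s) as [K [HK EB]].
  set (kappa := Cmod mu * Cmod nu / Cmod beta) in *.
  assert (b0 := Cmod_beta_lt1); assert (bn := beta_neq0).
  assert (ia : 0 < / alpha) by (apply Rinv_0_lt_compat; lra).
  assert (T1 : translation (horizontal L)) by reflexivity.
  assert (T2 : translation (vertical z)) by reflexivity.
  (* Upwards the ratio is kappa times the squared rescaling alpha^(-2) of L; downwards it is 1 /
     kappa times |beta|^2 = 1 / alpha from z. The factor 2 compares [nrm] with the modulus. *)
  exists (K * (Rabs L * Rabs L)), (K * (2 * Cmod z * (2 * Cmod z))), (kappa / alpha ^ 2), (/ (kappa * alpha)).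
  assert (a2 : 0 < alpha ^ 2) by (apply pow_lt; lra).
  assert (k0 : 0 < kappa) by lra.
  assert (ka : 1 < kappa * alpha).
  { apply Rmult_lt_reg_r with (/ alpha); [exact ia|].
    replace (kappa * alpha * / alpha) with kappa by (field; lra); lra. }
  split; [split; split|split].
  - apply Rlt_le, Rdiv_lt_0_compat; assumption.
  - apply Rmult_lt_reg_r with (alpha ^ 2); [exact a2|].
    replace (kappa / alpha ^ 2 * alpha ^ 2) with kappa by (field; lra); lra.
  - apply Rlt_le, Rinv_0_lt_compat; lra.
  - rewrite -Rinv_1; apply Rinv_lt_contravar; lra.
  - intros n q Hq.
    assert (an : 0 < alpha ^ n) by (apply pow_lt; lra).
    eapply Rle_trans.
    { apply (EB (alpha ^ n) (beta ^ n)%C (mu ^ n)%C (nu ^ n)%C (horizontal L) (vertical z) q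
        (nrm (scale_act (/ alpha ^ n) (/ beta ^ n)%C (horizontal L)))); trivial.
      - now apply Cpow_neq0.
      - apply automorphic_pow; [lra|exact AF].
      - apply automorphic_pow; [lra|exact AG].
      - now left. }
    assert (E : nrm (scale_act (/ alpha ^ n) (/ beta ^ n)%C (horizontal L)) = / alpha ^ n * Rabs L).
    { unfold nrm, scale_act, horizontal; simpl.
      rewrite !Rmult_0_r !Rminus_0_r !Rplus_0_r Rabs_R0 Rabs_mult (Rabs_pos_eq (/ alpha ^ n)); [ring|].
      apply Rlt_le, Rinv_0_lt_compat; exact an. }
    rewrite E !Cmod_pow; apply Req_le.
    unfold kappa; rewrite /Rdiv !Rpow_mult_distr !pow_inv.
    replace ((alpha ^ 2) ^ n) with (alpha ^ n * alpha ^ n) by (simpl; rewrite Rmult_1_r Rpow_mult_distr; ring).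
    assert (Cmod beta ^ n <> 0) by (apply pow_nonzero; lra).
    field; lra.
  - intros n q Hq.
    assert (an : 0 < alpha ^ n) by (apply pow_lt; lra).
    assert (Bn : (beta ^ n)%C <> RtoC 0) by now apply Cpow_neq0.
    assert (Mn : (mu ^ n)%C <> RtoC 0) by now apply Cpow_neq0.
    assert (Nn : (nu ^ n)%C <> RtoC 0) by now apply Cpow_neq0.
    assert (Bi : (/ beta ^ n)%C <> RtoC 0).
    { apply Cmod_gt_0; rewrite Cmod_inv //; apply Rinv_0_lt_compat; now apply Cmod_gt_0. }
    set (N := nrm (scale_act (/ / alpha ^ n) (/ / beta ^ n)%C (vertical z))).
    eapply Rle_trans.
    { apply (EB (/ alpha ^ n) (/ beta ^ n)%C (/ mu ^ n)%C (/ nu ^ n)%C (horizontal L) (vertical z) q N); trivial.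
      - now apply Rinv_0_lt_compat.
      - apply automorphic_inv; trivial; apply automorphic_pow; [lra|exact AF].
      - apply automorphic_inv; trivial; apply automorphic_pow; [lra|exact AG].
      - now right. }
    assert (E : N <= 2 * (Cmod beta ^ n * Cmod z)).
    { unfold N, nrm, scale_act, vertical.
      assert (Z : (/ / beta ^ n * z)%C = (beta ^ n * z)%C) by (field; repeat split; assumption).
      cbv [fst snd]; fold (fst (/ / beta ^ n * z)%C) (snd (/ / beta ^ n * z)%C); rewrite Z.
      assert (M1 := Rle_trans _ _ _ (Rmax_l _ _) (Rmax_Cmod (beta ^ n * z)%C)).
      assert (M2 := Rle_trans _ _ _ (Rmax_r _ _) (Rmax_Cmod (beta ^ n * z)%C)).
      rewrite Cmod_mult Cmod_pow in M1 M2.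
      simpl; simpl in M1, M2.
      replace (/ / alpha ^ n * 0 - 0 * 0) with 0 by ring; rewrite Rabs_R0; lra. }
    assert (N0 : 0 <= N) by (unfold N, nrm; generalize (Rabs_pos (fst (fst (scale_act (/ / alpha ^ n) (/ / beta ^ n)%C (vertical z)))));
      generalize (Rabs_pos (fst (snd (scale_act (/ / alpha ^ n) (/ / beta ^ n)%C (vertical z)))));
      generalize (Rabs_pos (snd (snd (scale_act (/ / alpha ^ n) (/ / beta ^ n)%C (vertical z))))); lra).
    assert (NN : N * N <= (2 * (Cmod beta ^ n * Cmod z)) * (2 * (Cmod beta ^ n * Cmod z)))
      by (apply Rmult_le_compat; assumption).
    rewrite !Cmod_inv // !Cmod_pow.
    assert (M0 : 0 < Cmod mu) by now apply Cmod_gt_0.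
    assert (V0 : 0 < Cmod nu) by now apply Cmod_gt_0.
    assert (bn0 : 0 < Cmod beta ^ n) by (apply pow_lt; lra).
    assert (mn0 : 0 < Cmod mu ^ n) by (apply pow_lt; lra).
    assert (nn0 : 0 < Cmod nu ^ n) by (apply pow_lt; lra).
    eapply Rle_trans; [apply Rmult_le_compat_l; [|exact NN]|].
    { apply Rmult_le_pos; [exact HK|].
      apply Rlt_le, Rdiv_lt_0_compat; [apply Rmult_lt_0_compat|]; now apply Rinv_0_lt_compat. }
    apply Req_le.
    replace ((/ (kappa * alpha)) ^ n) with (Cmod beta ^ n * Cmod beta ^ n * Cmod beta ^ n * (/ Cmod mu ^ n * / Cmod nu ^ n)).
    + field; lra.
    + rewrite -!pow_inv -!Rpow_mult_distr; f_equal; unfold kappa.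
      replace (/ (Cmod mu * Cmod nu / Cmod beta * alpha))
        with (/ Cmod mu * / Cmod nu * Cmod beta * / alpha) by (field; lra).
      replace (/ alpha) with (Cmod beta * Cmod beta); [ring|].
      apply Rmult_eq_reg_l with alpha; [|lra]; rewrite Rinv_r; [|lra]; rewrite -Hvol; ring.
Qed.

Lemma diff2_energy_derivative (L : R) (z : C) (p : pt) : HxC p ->
  let u := horizontal L in let v := vertical z in
  dird dir_t (diff2_energy s F G u v) p
  = c1 / (2 * Im (fst p)) * fibre_integral
      (sqnorm (d_plus s (diff2 u v (re_part G)) (diff2 u v (im_part G)))
              (d_plus (- s) (diff2 u v (im_part G)) (diff2 u v (re_part G)))) p
    + c2 / (2 * Im (fst p) ^ 2) * fibre_integral
      (sqnorm (d_plus (- s) (diff2 u v (re_part F)) (diff2 u v (im_part F)))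
              (d_plus s (diff2 u v (im_part F)) (diff2 u v (re_part F)))) p.
Proof.
  intros Hp u v.
  assert (Tu : translation u) by reflexivity.
  assert (Tv : translation v) by reflexivity.
  destruct SF as [S1 S2], SG as [S3 S4].
  apply energy_derivative; try assumption; try (apply sp_diff2; assumption).
  apply elliptic_system_diff2; try assumption; [apply S1|apply S2|apply S3|apply S4].
Qed.

Lemma fibre_sqnorm_ge0 (a b : pt -> R) (p : pt) : smooth_periodic a -> smooth_periodic b -> HxC p ->
  0 <= fibre_integral (sqnorm a b) p.
Proof.
  intros Sa Sb Hp; apply fibre_ge0; try assumption; [apply (sp_sqnorm a b Sa Sb)|].
  intros q _; unfold sqnorm; nra.
Qed.

(** Along the ray in the t-direction through p the energy is nondecreasing, and geometric bounds
    squeeze it at both ends. *)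
Lemma diff2_energy_zero (L : R) (z : C) (p : pt) : HxC p ->
  diff2_energy s F G (horizontal L) (vertical z) p = 0.
Proof.
  intros Hp; set (u := horizontal L); set (v := vertical z).
  assert (Tu : translation u) by reflexivity.
  assert (Tv : translation v) by reflexivity.
  set (E := diff2_energy s F G u v).
  (* The foot of the ray, at height 0 and so outside the half-space; [move p0 dir_t t] has height
     exactly t. *)
  set (p0 := ((fst (fst p), 0), snd p) : pt).
  assert (Im0 : forall t, Im (fst (move p0 dir_t t)) = t).
  { intros t; rewrite moveE; unfold Im; simpl; ring. }
  assert (SE : smoothR E).
  { destruct SF as [S1 S2], SG as [S3 S4]; apply smoothR_energy; try assumption; now apply sp_diff2. }
  assert (D : forall t, 0 < t -> is_derive (fun t => E (move p0 dir_t t)) t (dird dir_t E (move p0 dir_t t))).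
  { intros t Ht; apply smoothR_is_derive; [exact SE|unfold HxC; rewrite Im0; exact Ht]. }
  assert (M : forall x y, 0 < x <= y -> E (move p0 dir_t x) <= E (move p0 dir_t y)).
  { intros x y Hxy.
    destruct (MVT_gen (fun t => E (move p0 dir_t t)) x y (fun t => dird dir_t E (move p0 dir_t t)))
      as [c [Hc Ec]].
    - intros t Ht; apply D; rewrite Rmin_left in Ht; lra.
    - intros t Ht; apply continuity_pt_filterlim; apply: ex_derive_continuous; eexists; apply D.
      rewrite Rmin_left in Ht; lra.
    - rewrite Rmin_left in Hc; [|lra].
      assert (Hcp : HxC (move p0 dir_t c)) by (unfold HxC; rewrite Im0; lra).
      assert (P : 0 <= dird dir_t E (move p0 dir_t c)).
      { unfold E; rewrite diff2_energy_derivative // Im0.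
        destruct SF as [S1 S2], SG as [S3 S4].
        assert (c0 : 0 < c) by lra.
        assert (cc : 0 < c ^ 2) by (apply pow_lt; lra).
        apply Rplus_le_le_0_compat; apply Rmult_le_pos;
          try (apply Rlt_le, Rdiv_lt_0_compat; lra);
          apply fibre_sqnorm_ge0; try assumption; apply sp_d_plus; now apply sp_diff2. }
      nra. }
  destruct (scaled_energy_bounds L z) as [A [B [q [q' [[Hq Hq'] [BA BB]]]]]].
  assert (Z := monotone_squeeze (fun t => E (move p0 dir_t t)) alpha A B q q' Halpha M Hq Hq'
    (fun n => BA n _ (Im0 _)) (fun n => BB n _ (Im0 _)) (Im (fst p)) Hp).
  replace p with (move p0 dir_t (Im (fst p))); [exact Z|].
  rewrite moveE; destruct p as [[x t] [y1 y2]]; unfold Im; simpl; apply pt_ext; ring.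
Qed.

(** The derivative of the vanishing energy is a sum of two nonnegative terms, so both fibre
    integrals are 0, and a nonnegative integrand with zero fibre integral vanishes pointwise. *)
Lemma diff2_cauchy_riemann (L : R) (z : C) (p : pt) : HxC p ->
  let u := horizontal L in let v := vertical z in
  sqnorm (d_plus s (diff2 u v (re_part G)) (diff2 u v (im_part G)))
         (d_plus (- s) (diff2 u v (im_part G)) (diff2 u v (re_part G))) p = 0 /\
  sqnorm (d_plus (- s) (diff2 u v (re_part F)) (diff2 u v (im_part F)))
         (d_plus s (diff2 u v (im_part F)) (diff2 u v (re_part F))) p = 0.
Proof.
  intros Hp u v.
  assert (Tu : translation u) by reflexivity.
  assert (Tv : translation v) by reflexivity.
  assert (D := diff2_energy_derivative L z p Hp).
  assert (D0 : dird dir_t (diff2_energy s F G (horizontal L) (vertical z)) p = 0).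
  { rewrite (dirR_ext dir_t _ (fun _ => 0) p); [apply dirR_const| |exact Hp].
    intros q Hq; now apply diff2_energy_zero. }
  cbv zeta in D; fold u v in D; fold u v in D0; rewrite D0 in D; clear D0.
  destruct SF as [S1 S2], SG as [S3 S4].
  set (A := sqnorm (d_plus s (diff2 u v (re_part G)) (diff2 u v (im_part G)))
         (d_plus (- s) (diff2 u v (im_part G)) (diff2 u v (re_part G)))) in *.
  set (B := sqnorm (d_plus (- s) (diff2 u v (re_part F)) (diff2 u v (im_part F)))
         (d_plus s (diff2 u v (im_part F)) (diff2 u v (re_part F)))) in *.
  assert (SA : smooth_periodic A) by (apply sp_sqnorm; apply sp_d_plus; now apply sp_diff2).
  assert (SB : smooth_periodic B) by (apply sp_sqnorm; apply sp_d_plus; now apply sp_diff2).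
  assert (PA : forall q, HxC q -> 0 <= A q) by (intros q _; unfold A, sqnorm; nra).
  assert (PB : forall q, HxC q -> 0 <= B q) by (intros q _; unfold B, sqnorm; nra).
  assert (IA := fibre_ge0 p A (proj1 SA) Hp PA).
  assert (IB := fibre_ge0 p B (proj1 SB) Hp PB).
  assert (t0 : 0 < Im (fst p)) by exact Hp.
  assert (tt : 0 < Im (fst p) ^ 2) by (apply pow_lt; exact t0).
  assert (k1 : 0 < c1 / (2 * Im (fst p))) by (apply Rdiv_lt_0_compat; lra).
  assert (k2 : 0 < c2 / (2 * Im (fst p) ^ 2)) by (apply Rdiv_lt_0_compat; lra).
  split.
  - apply (fibre_eq0 p A (proj1 SA) Hp PA).
    apply Rle_antisym; [|exact IA].
    apply Rmult_le_reg_l with (1 := k1); assert (0 <= c2 / (2 * Im (fst p) ^ 2) * fibre_integral B p) by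
      (apply Rmult_le_pos; lra); lra.
  - apply (fibre_eq0 p B (proj1 SB) Hp PB).
    apply Rle_antisym; [|exact IB].
    apply Rmult_le_reg_l with (1 := k2); assert (0 <= c1 / (2 * Im (fst p)) * fibre_integral A p) by
      (apply Rmult_le_pos; lra); lra.
Qed.

(** Pulling wa back n times divides its x-part by alpha^n, while its z-part grows. *)
Lemma small_horizontal_periods (H : pt -> C) (m : C) : m <> RtoC 0 ->
  automorphic H alpha beta m -> cperiod wa H ->
  forall eps, 0 < eps -> exists w, translation w /\ cperiod w H /\ 0 < Rabs (fst (fst w)) <= eps.
Proof.
  intros Hm AH PH eps He.
  destruct (pow_small (/ alpha) (Rabs (fst (fst wa))) eps) as [n Hn].
  { split; [apply Rlt_le, Rinv_0_lt_compat; lra|rewrite -Rinv_1; apply Rinv_lt_contravar; lra]. }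
  { exact He. }
  assert (an : 0 < alpha ^ n) by (apply pow_lt; lra).
  assert (Bn : (beta ^ n)%C <> RtoC 0) by apply Cpow_neq0, beta_neq0.
  exists (scale_act (/ alpha ^ n) (/ beta ^ n)%C wa).
  assert (T : translation (scale_act (/ alpha ^ n) (/ beta ^ n)%C wa)) by now apply translation_scale_act.
  split; [exact T|split].
  - apply (cperiod_scale H (alpha ^ n) (beta ^ n)%C (m ^ n)%C wa); trivial.
    + now apply Cpow_neq0.
    + apply automorphic_pow; [lra|exact AH].
    + apply scale_act_K; [lra|exact Bn].
  - assert (E : fst (fst (scale_act (/ alpha ^ n) (/ beta ^ n)%C wa)) = / alpha ^ n * fst (fst wa)).
    { unfold scale_act; simpl; ring. }
    assert (0 < / alpha ^ n) by now apply Rinv_0_lt_compat.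
    rewrite E Rabs_mult (Rabs_pos_eq (/ alpha ^ n)); [|lra]; rewrite -pow_inv in H0 |- *; split; [|exact Hn].
    apply Rmult_lt_0_compat; [exact H0|now apply Rabs_pos_lt].
Qed.

(** Pushing wb forward n times multiplies its z-part by beta^n. The next power supplies the second
    period, whose z-part is beta times the first. *)
Lemma small_vertical_periods (H : pt -> C) (m : C) : m <> RtoC 0 ->
  automorphic H alpha beta m -> cperiod wb H ->
  forall eps, 0 < eps -> exists w w', translation w /\ translation w' /\
    cperiod w H /\ cperiod w' H /\ snd w' = (beta * snd w)%C /\ 0 < Cmod (snd w) <= eps.
Proof.
  intros Hm AH PH eps He.
  assert (b1 := Cmod_beta_lt1).
  destruct (pow_small (Cmod beta) (Cmod (snd wb)) eps) as [n Hn]; [lra|exact He|].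
  assert (Tn : forall n, translation (scale_act (alpha ^ n) (beta ^ n)%C wb)).
  { intros k; now apply translation_scale_act. }
  assert (Pn : forall n, cperiod (scale_act (alpha ^ n) (beta ^ n)%C wb) H).
  { intros k.
    assert (ak : 0 < alpha ^ k) by (apply pow_lt; lra).
    assert (Bk : (beta ^ k)%C <> RtoC 0) by apply Cpow_neq0, beta_neq0.
    assert (Mk : (m ^ k)%C <> RtoC 0) by now apply Cpow_neq0.
    apply (cperiod_scale H (/ alpha ^ k) (/ beta ^ k)%C (/ m ^ k)%C wb).
    - now apply Rinv_0_lt_compat.
    - apply Cmod_gt_0; rewrite Cmod_inv //; apply Rinv_0_lt_compat; now apply Cmod_gt_0.
    - apply automorphic_inv; trivial; apply automorphic_pow; [lra|exact AH].
    - apply Tn.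
    - unfold scale_act; destruct wb as [wx wz]; simpl.
      assert (Ak : RtoC (alpha ^ k) <> RtoC 0) by (apply RtoC_neq0; lra).
      rewrite RtoC_inv; [|lra]; f_equal; field; assumption.
    - exact PH. }
  exists (scale_act (alpha ^ n) (beta ^ n)%C wb), (scale_act (alpha ^ S n) (beta ^ S n)%C wb).
  split; [apply Tn|split; [apply Tn|split; [apply Pn|split; [apply Pn|split]]]].
  - unfold scale_act; simpl; ring.
  - unfold scale_act; simpl; rewrite Cmod_mult Cmod_pow; split; [|exact Hn].
    apply Rmult_lt_0_compat; [apply pow_lt; lra|now apply Cmod_gt_0].
Qed.

Lemma fibre_constant_complex (H : pt -> C) (m : C) : csmooth_periodic H -> m <> RtoC 0 ->
  automorphic H alpha beta m -> cperiod wa H -> cperiod wb H ->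
  (forall L z q, HxC q ->
     (dird dir_1 (diff2 (horizontal L) (vertical z) (re_part H)) q = 0 /\
      dird dir_2 (diff2 (horizontal L) (vertical z) (re_part H)) q = 0) /\
     (dird dir_1 (diff2 (horizontal L) (vertical z) (im_part H)) q = 0 /\
      dird dir_2 (diff2 (horizontal L) (vertical z) (im_part H)) q = 0)) ->
  forall X p, translation X -> HxC p -> H (move p X 1) = H p.
Proof.
  intros [S1 S2] Hm AH Pa Pb V X p HX Hp.
  assert (b1 := Cmod_beta_lt1).
  assert (Px := small_horizontal_periods H m Hm AH Pa).
  assert (Pz := small_vertical_periods H m Hm AH Pb).
  assert (K : forall phi, smooth_periodic phi -> (forall w, cperiod w H -> period w phi) ->
    (forall L z q, HxC q -> dird dir_1 (diff2 (horizontal L) (vertical z) phi) q = 0 /\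
                            dird dir_2 (diff2 (horizontal L) (vertical z) phi) q = 0) ->
    phi (move p X 1) = phi p).
  { intros phi S P V'.
    apply (fibre_constant beta phi S Hbeta); trivial; [lra|..]; intros eps He.
    - destruct (Px eps He) as [w [T [Pw B]]]; exists w; auto.
    - destruct (Pz eps He) as [w [w' [T [T' [Pw [Pw' B]]]]]]; exists w, w'.
      split; [exact T|split; [exact T'|split; [now apply P|split; [now apply P|exact B]]]]. }
  apply injective_projections.
  - apply (K (re_part H) S1); [intros w P; apply (cperiod_parts _ _ P)|intros L z q Hq; apply (V L z q Hq)].
  - apply (K (im_part H) S2); [intros w P; apply (cperiod_parts _ _ P)|intros L z q Hq; apply (V L z q Hq)].
Qed.

Theorem rigidity (X p : pt) : translation X -> HxC p ->
  F (move p X 1) = F p /\ G (move p X 1) = G p.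
Proof.
  intros HX Hp.
  assert (CR := cauchy_riemann_gradient).
  split.
  - apply (fibre_constant_complex F mu); trivial.
    intros L z; apply (CR s); trivial; try (now apply sp_diff2; [..|apply SF]).
    intros r Hr; now apply diff2_cauchy_riemann.
  - apply (fibre_constant_complex G nu); trivial.
    (* The mixed difference of F satisfies d^(-s) F = 0 and that of G satisfies d^s G = 0, so the
       sign is reversed. *)
    intros L z; apply (CR (- s)); try (now apply sp_diff2; [..|apply SG]).
    + rewrite -Hs; ring.
    + intros r Hr; rewrite Ropp_involutive; now apply diff2_cauchy_riemann.
Qed.

End Fibration.

(** * The Dirac operator in the frame *)

Lemma im_w_move (p X : pt) (s : R) : im_w (move p X s) = im_w p + s * Im (fst X).
Proof. rewrite moveE; reflexivity. Qed.

Lemma dirR_im_w (X p : pt) (g : R -> R) (l : R) : is_derive g (im_w p) l ->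
  dirR X (fun q => g (im_w q)) p = Im (fst X) * l.
Proof.
  intros H; apply is_derive_unique.
  apply (is_derive_ext (fun s => g (im_w p + s * Im (fst X)))).
  { intros s; now rewrite im_w_move. }
  apply: is_derive_comp.
  - rewrite Rmult_0_l Rplus_0_r; exact H.
  - auto_derive; [trivial|ring].
Qed.

Lemma dirR_loc_const (X p : pt) (phi : pt -> R) (c : R) : HxC p ->
  (forall q, HxC q -> phi q = c) -> dirR X phi p = 0.
Proof.
  intros Hp E; rewrite -dirdE (dirR_ext X phi (fun _ => c) p E Hp); apply dirR_const.
Qed.

Definition delta (i j : nat) : R := if Nat.eqb i j then 1 else 0.
(** e_i (log t): only e_1 = t d/dt changes the height. *)
Definition tau (i : nat) : R := delta i 1.
(** The exponent of t in the coefficient of e_i: t for e_0 and e_1, t^(-1/2) for e_2 and e_3. *)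
Definition frame_weight (i : nat) : R := match i with 0%nat | 1%nat => 1 | _ => - (1 / 2) end.

Lemma lt4_cases (i : nat) : (i < 4)%coq_nat ->
  i = 0%nat \/ i = 1%nat \/ i = 2%nat \/ i = 3%nat.
Proof. lia. Qed.

Lemma sqrt_pos_facts (t : R) : 0 < t -> 0 < sqrt t /\ sqrt t * sqrt t = t.
Proof. intros H; split; [now apply sqrt_lt_R0|apply sqrt_sqrt; lra]. Qed.

Lemma tricerri_frame (i j : nat) (p : pt) : (i < 4)%coq_nat -> (j < 4)%coq_nat -> HxC p ->
  tricerri p (frame i p) (frame j p) = delta i j.
Proof.
  intros Hi Hj Hp; unfold HxC in Hp; fold (im_w p) in Hp.
  destruct (sqrt_pos_facts _ Hp) as [r0 rr].
  destruct (lt4_cases i Hi) as [-> | [-> | [-> | ->]]], (lt4_cases j Hj) as [-> | [-> | [-> | ->]]];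
    unfold tricerri, frame, delta, im_w; fold (im_w p); simpl;
    set (t := im_w p) in *; set (r := sqrt t) in *; rewrite -?rr; field; lra.
Qed.

Lemma Im_frame (i : nat) (p : pt) : (i < 4)%coq_nat -> Im (fst (frame i p)) = tau i * im_w p.
Proof.
  intros Hi; destruct (lt4_cases i Hi) as [-> | [-> | [-> | ->]]]; unfold tau, delta; simpl; ring.
Qed.

Lemma Re_frame (i : nat) (p : pt) : (i < 4)%coq_nat -> Re (fst (frame i p)) = delta i 0 * im_w p.
Proof.
  intros Hi; destruct (lt4_cases i Hi) as [-> | [-> | [-> | ->]]]; unfold delta; simpl; ring.
Qed.

Lemma dirC_frame (i : nat) (X p : pt) : (i < 4)%coq_nat -> HxC p ->
  (dirC X (fun q => fst (frame i q)) p, dirC X (fun q => snd (frame i q)) p)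
  = (RtoC (Im (fst X) * frame_weight i / im_w p) * fst (frame i p),
     RtoC (Im (fst X) * frame_weight i / im_w p) * snd (frame i p))%C.
Proof.
  intros Hi Hp; unfold HxC in Hp; fold (im_w p) in Hp.
  destruct (sqrt_pos_facts _ Hp) as [r0 rr].
  assert (D1 : dirR X (fun q => im_w q) p = Im (fst X)).
  { rewrite -[RHS]Rmult_1_r; exact (dirR_im_w X p (fun t => t) 1 (is_derive_id _)). }
  assert (D2 : is_derive (fun t => / sqrt t) (im_w p) (- / (2 * im_w p * sqrt (im_w p)))).
  { auto_derive; [split; [lra|split; [lra|trivial]]|].
    set (r := sqrt (im_w p)) in *; clearbody r; rewrite -rr; field; lra. }
  assert (D3 : dirR X (fun q => / sqrt (im_w q)) p = Im (fst X) * - / (2 * im_w p * sqrt (im_w p))).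
  { exact (dirR_im_w X p _ _ D2). }
  assert (Z : forall c, dirR X (fun _ => c) p = 0) by (intros c; exact (Derive_const c 0)).
  assert (E : forall phi psi : pt -> R, (forall q, phi q = psi q) -> dirR X phi p = dirR X psi p).
  { intros phi psi H; apply Derive_ext; intros s; apply H. }
  destruct (lt4_cases i Hi) as [-> | [-> | [-> | ->]]];
    unfold dirC, frame, frame_weight, Cmult, RtoC, Ci, Re, Im; simpl; apply pt_ext;
    first
    [ rewrite Z; field; lra
    | rewrite D1; unfold Im; field; lra
    | rewrite D3; unfold Im; field; lra
    | rewrite (E _ (fun _ => 0)); [rewrite Z; field; lra|intros; ring]
    | rewrite (E _ (fun q => im_w q)); [rewrite D1; unfold Im; field; lra|intros; ring]
    | rewrite (E _ (fun q => / sqrt (im_w q))); [rewrite D3; unfold Im; field; lra|intros; ring] ].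
Qed.

(** Each e_i is a power of t times a constant vector, so the brackets have constant coefficients:
    the frame spans a solvable Lie algebra. *)
Lemma lie_bracket_frame (i j : nat) (p : pt) : (i < 4)%coq_nat -> (j < 4)%coq_nat -> HxC p ->
  lie_bracket (frame i) (frame j) p
  = lincomb (tau i * frame_weight j) (frame j p) (- (tau j * frame_weight i)) (frame i p).
Proof.
  intros Hi Hj Hp.
  assert (t0 : im_w p <> 0) by (unfold HxC in Hp; unfold im_w; lra).
  assert (E1 := dirC_frame j (frame i p) p Hj Hp).
  assert (E2 := dirC_frame i (frame j p) p Hi Hp).
  unfold lie_bracket; cbv zeta; rewrite E1 E2 /= !Im_frame //.
  replace (tau i * im_w p * frame_weight j / im_w p) with (tau i * frame_weight j) by (field; exact t0).
  replace (tau j * im_w p * frame_weight i / im_w p) with (tau j * frame_weight i) by (field; exact t0).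
  unfold lincomb; rewrite RtoC_opp; f_equal; ring.
Qed.

Lemma tricerri_lincomb (p X Y Z : pt) (r s : R) :
  tricerri p (lincomb r X s Y) Z = r * tricerri p X Z + s * tricerri p Y Z.
Proof.
  destruct X as [[x1 x2] [x3 x4]], Y as [[y1 y2] [y3 y4]], Z as [[z1 z2] [z3 z4]].
  unfold tricerri, lincomb, Cplus, Cmult, Cconj, RtoC, Re; simpl; unfold Rdiv; ring.
Qed.

Lemma delta_sym (i j : nat) : delta i j = delta j i.
Proof. unfold delta; now rewrite Nat.eqb_sym. Qed.

Lemma frame_weight_delta (i j : nat) : frame_weight i * delta i j = frame_weight j * delta i j.
Proof. unfold delta; destruct (Nat.eqb_spec i j) as [->|]; ring. Qed.

(** In an orthonormal frame the derivative terms of the Koszul formula vanish, and the bracket terms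
    are constants. *)
Lemma levi_civita_frame (i j k : nat) (p : pt) : (i < 4)%coq_nat -> (j < 4)%coq_nat ->
  (k < 4)%coq_nat -> HxC p ->
  levi_civita (frame i) (frame j) (frame k) p
  = frame_weight i * (tau k * delta i j - tau j * delta i k).
Proof.
  intros Hi Hj Hk Hp; unfold levi_civita; cbv zeta.
  assert (D : forall X m n, (m < 4)%coq_nat -> (n < 4)%coq_nat ->
     dirR X (fun q => tricerri q (frame m q) (frame n q)) p = 0).
  { intros X m n Hm Hn; apply (dirR_loc_const X p _ (delta m n) Hp).
    intros q Hq; now apply tricerri_frame. }
  rewrite !D // !lie_bracket_frame // !tricerri_lincomb !tricerri_frame //.
  assert (W1 := frame_weight_delta j k); assert (W2 := frame_weight_delta i k).
  assert (W3 := frame_weight_delta i j).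
  rewrite (delta_sym k j) (delta_sym j i) (delta_sym k i).
  replace (tau k * frame_weight j * delta i j) with (tau k * (frame_weight j * delta i j)) by ring.
  transitivity ((tau i * (frame_weight j * delta j k - frame_weight k * delta j k)
     + tau j * (- (frame_weight i * delta i k) - frame_weight k * delta i k)
     + tau k * (frame_weight i * delta i j + frame_weight j * delta i j)) / 2); [field|].
  rewrite W1 -W2 -W3; field.
Qed.

(** The squared norm h is t^(-2) t = 1 / t. Its logarithm changes only along e_1 = J e_0, so the
    connection form is nonzero on e_0 alone. *)
Lemma chern_frame (i : nat) (p : pt) : (i < 4)%coq_nat -> HxC p ->
  chern_anticanonical (frame i p) p = (Ci / RtoC 2 * RtoC (delta i 0))%C.
Proof.
  intros Hi Hp; unfold chern_anticanonical; cbv zeta.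
  assert (t0 : 0 < im_w p) by exact Hp.
  set (JX := ((Ci * fst (frame i p))%C, (Ci * snd (frame i p))%C)).
  assert (J : Im (fst JX) = delta i 0 * im_w p).
  { rewrite -Re_frame // /JX; simpl; unfold Re; ring. }
  rewrite -dirdE (dirR_ext JX _ (fun q => - ln (im_w q)) p).
  - rewrite dirdE (dirR_im_w JX p (fun t => - ln t) (- / im_w p)).
    + rewrite J; replace (delta i 0 * im_w p * - / im_w p) with (- delta i 0) by (field; lra).
      rewrite RtoC_opp; ring.
    + auto_derive; [exact t0|ring].
  - intros q Hq; assert (tq : 0 < im_w q) by exact Hq.
    rewrite -ln_Rinv //; f_equal.
    unfold tricerri, Cconj, Cmult, RtoC, Re; simpl; field; lra.
  - exact Hp.
Qed.

(** Clifford multiplication by e_i, with constant matrices because frame and spinor trivialization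
    are both unitary ([clifford_frame]). *)
Definition clifford_std (i : nat) (s : spinor) : spinor :=
  let '((f, h), (u, v)) := s in
  match i with
  | 0%nat => ((- u, v), (f, - h))
  | 1%nat => ((Ci * u, Ci * v), (Ci * f, Ci * h))
  | 2%nat => ((- v, - u), (h, f))
  | _ => ((Ci * v, - (Ci * u)), (- (Ci * h), Ci * f))
  end%C.

Lemma clifford_frame (i : nat) (p : pt) (s : spinor) : (i < 4)%coq_nat -> HxC p ->
  clifford p (frame i p) s = clifford_std i s.
Proof.
  intros Hi Hp; assert (t0 : 0 < im_w p) by exact Hp.
  assert (t1 : RtoC (im_w p) <> RtoC 0) by (intros E; injection E; lra).
  assert (r0 := sqrt_lt_R0 _ t0).
  assert (r1 : RtoC (sqrt (im_w p)) <> RtoC 0) by (intros E; injection E; lra).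
  assert (Z1 : (RtoC (im_w p) / RtoC (im_w p) = 1)%C) by (field; exact t1).
  assert (Z2 : (RtoC (im_w p) * Ci / RtoC (im_w p) = Ci)%C) by (field; exact t1).
  assert (Z3 : (RtoC (sqrt (im_w p)) * RtoC (/ sqrt (im_w p)) = 1)%C).
  { rewrite RtoC_inv; [field; exact r1|lra]. }
  assert (Z4 : (RtoC (sqrt (im_w p)) * (RtoC (/ sqrt (im_w p)) * Ci) = Ci)%C).
  { rewrite RtoC_inv; [field; exact r1|lra]. }
  assert (Z5 : (RtoC 0 / RtoC (im_w p) = 0)%C) by (field; exact t1).
  assert (K0 : Cconj (RtoC 0) = RtoC 0) by (unfold Cconj, RtoC; simpl; f_equal; ring).
  assert (K1 : Cconj (RtoC 1) = RtoC 1) by (unfold Cconj, RtoC; simpl; f_equal; ring).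
  assert (Ki : Cconj Ci = (- Ci)%C) by (unfold Cconj, Ci, Copp; simpl; f_equal; ring).
  destruct s as [[f h] [u v]].
  destruct (lt4_cases i Hi) as [-> | [-> | [-> | ->]]]; unfold clifford, frame, clifford_std; simpl fst; simpl snd;
    rewrite ?Z1 ?Z2 ?Z3 ?Z4 ?Z5 ?K0 ?K1 ?Ki ?Cmult_0_r ?K0;
    f_equal; f_equal; ring.
Qed.

Lemma spinor_plusE (f h u v f' h' u' v' : C) :
  plus (((f, h), (u, v)) : spinor) ((f', h'), (u', v'))
  = ((f + f', h + h'), (u + u', v + v'))%C.
Proof. reflexivity. Qed.

Lemma sum_n3 (g : nat -> spinor) :
  sum_n g 3 = plus (plus (plus (g 0%nat) (g 1%nat)) (g 2%nat)) (g 3%nat).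
Proof. rewrite !sum_Sn sum_O; reflexivity. Qed.

(** This form explains the cancellation in the Dirac operator: there e_i e_i e_1 = - e_1, the
    coefficients for e_0, e_2, e_3 are 1/2, -1/4, -1/4, of sum 0, and the one for e_1 is 0. *)
Lemma connection_frame (i : nat) (p : pt) (s : spinor) : (i < 4)%coq_nat -> HxC p ->
  sum_n (fun j => sum_n (fun k =>
         spinor_scale (RtoC (levi_civita (frame i) (frame j) (frame k) p / 4))
           (clifford p (frame j p) (clifford p (frame k p) s))) 3) 3
  = spinor_scale (RtoC (frame_weight i / 2 * (1 - tau i))) (clifford_std i (clifford_std 1 s)).
Proof.
  intros Hi Hp.
  assert (L0 : (0 < 4)%coq_nat) by lia. assert (L1 : (1 < 4)%coq_nat) by lia.
  assert (L2 : (2 < 4)%coq_nat) by lia. assert (L3 : (3 < 4)%coq_nat) by lia.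
  rewrite !sum_n3 !levi_civita_frame // !clifford_frame //.
  destruct s as [[[f1 f2] [h1 h2]] [[u1 u2] [v1 v2]]].
  destruct (lt4_cases i Hi) as [-> | [-> | [-> | ->]]]; unfold delta, tau, delta, frame_weight; simpl Nat.eqb; cbv iota;
    unfold clifford_std, spinor_scale; rewrite !spinor_plusE;
    unfold Cplus, Cmult, Copp, Ci, RtoC; cbn [fst snd];
    (apply f_equal2; [apply f_equal2|apply f_equal2]); apply f_equal2; field.
Qed.

Lemma sum_n_ext4 (g g' : nat -> spinor) : (forall i, (i < 4)%coq_nat -> g i = g' i) ->
  sum_n g 3 = sum_n g' 3.
Proof. intros H; apply sum_n_ext_loc; intros i Hi; apply H; lia. Qed.

(* The Levi-Civita terms cancel in the sum; only the connection form of K^{-1} survives. *)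
Lemma dirac_frame (psi : pt -> spinor) (p : pt) : HxC p ->
  dirac psi p = plus (sum_n (fun i => clifford_std i (dirS (frame i p) psi p)) 3)
                     (spinor_scale (Ci / RtoC 4)%C (clifford_std 0 (psi p))).
Proof.
  intros Hp; unfold dirac, spinc_nabla, spinor_add.
  rewrite (sum_n_ext4 _ (fun i => clifford_std i (plus (dirS (frame i p) psi p)
    (plus (spinor_scale (RtoC (frame_weight i / 2 * (1 - tau i))) (clifford_std i (clifford_std 1 (psi p))))
          (spinor_scale (Ci / RtoC 2 * RtoC (delta i 0) / RtoC 2)%C (psi p)))))).
  2: { intros i Hi; rewrite clifford_frame // connection_frame // chern_frame //. }
  rewrite !sum_n3; unfold delta, tau, delta, frame_weight; simpl Nat.eqb; cbv iota.
  set (q := RtoC (/ 4)).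
  assert (k0 : RtoC (1 / 2 * (1 - 0)) = (q + q)%C) by (unfold q; rewrite -RtoC_plus; f_equal; field).
  assert (k1 : RtoC (1 / 2 * (1 - 1)) = RtoC 0) by (f_equal; field).
  assert (k2 : RtoC (- (1 / 2) / 2 * (1 - 0)) = (- q)%C) by (unfold q; rewrite -RtoC_opp; f_equal; field).
  assert (k3 : (Ci / RtoC 2 * RtoC 1 / RtoC 2)%C = (Ci * q)%C).
  { unfold q; rewrite RtoC_inv; [|lra].
    replace (RtoC 4) with (RtoC 2 * RtoC 2)%C by (rewrite -RtoC_mult; f_equal; ring).
    assert (RtoC 2 <> RtoC 0) by (apply RtoC_neq0; lra); field; assumption. }
  assert (k4 : (Ci / RtoC 2 * RtoC 0 / RtoC 2)%C = RtoC 0) by (unfold Cdiv; ring).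
  assert (k5 : (Ci / RtoC 4)%C = (Ci * q)%C) by (unfold q; rewrite RtoC_inv //; lra).
  rewrite k0 k1 k2 k3 k4 k5; clearbody q; clear k0 k1 k2 k3 k4 k5.
  assert (Ci2 : (Ci * Ci = - (1))%C) by (unfold Ci, Cmult, Copp, RtoC; simpl; f_equal; ring).
  destruct (psi p) as [[f h] [u v]], (dirS (frame 0 p) psi p) as [[f0 h0] [u0 v0]],
    (dirS (frame 1 p) psi p) as [[f1 h1] [u1 v1]], (dirS (frame 2 p) psi p) as [[f2 h2] [u2 v2]],
    (dirS (frame 3 p) psi p) as [[f3 h3] [u3 v3]].
  unfold clifford_std, spinor_scale; rewrite !spinor_plusE.
  (apply f_equal2; [apply f_equal2|apply f_equal2]); ring [Ci2].
Qed.

Lemma clifford_d_log (alpha : R) (p : pt) (s : spinor) : 1 < alpha -> HxC p ->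
  clifford_d (fun q => ln (im_w q) / ln alpha) p s = spinor_scale (RtoC (/ ln alpha)) (clifford_std 1 s).
Proof.
  intros Ha Hp; assert (t0 : 0 < im_w p) by exact Hp.
  assert (la : 0 < ln alpha) by (rewrite -ln_1; apply ln_increasing; lra).
  unfold clifford_d.
  rewrite (sum_n_ext4 _ (fun i => spinor_scale (RtoC (tau i / ln alpha)) (clifford_std i s))).
  2: { intros i Hi; rewrite clifford_frame //.
       rewrite (dirR_im_w (frame i p) p (fun t => ln t / ln alpha) (/ im_w p / ln alpha)).
       - rewrite Im_frame //; f_equal; f_equal; field; lra.
       - auto_derive; [exact t0|field; lra]. }
  rewrite sum_n3; unfold tau, delta; simpl Nat.eqb; cbv iota.
  destruct s as [[[f1 f2] [h1 h2]] [[u1 u2] [v1 v2]]].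
  unfold clifford_std, spinor_scale; rewrite !spinor_plusE;
    unfold Cplus, Cmult, Copp, Ci, RtoC; cbn [fst snd];
    (apply f_equal2; [apply f_equal2|apply f_equal2]); apply f_equal2; field; lra.
Qed.

(** The Chern term (i/4) e_0 and the twist - lam e_1 act on each entry by scalars of the same shape:
    together they give 1/4 - lam on f and v, and 1/4 + lam on h and u. *)
Lemma twisted_dirac_frame (alpha : R) (logz : C) (psi : pt -> spinor) (p : pt)
    (f h u v f0 h0 u0 v0 f1 h1 u1 v1 f2 h2 u2 v2 f3 h3 u3 v3 : C) :
  1 < alpha -> HxC p -> psi p = ((f, h), (u, v)) ->
  dirS (frame 0 p) psi p = ((f0, h0), (u0, v0)) -> dirS (frame 1 p) psi p = ((f1, h1), (u1, v1)) ->
  dirS (frame 2 p) psi p = ((f2, h2), (u2, v2)) -> dirS (frame 3 p) psi p = ((f3, h3), (u3, v3)) ->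
  let lam := (logz / RtoC (ln alpha))%C in
  twisted_dirac alpha logz psi p =
  ((- u0 + Ci * u1 - v2 + Ci * v3 - Ci * (/ RtoC 4 + lam) * u,
    v0 + Ci * v1 - u2 - Ci * u3 + Ci * (/ RtoC 4 - lam) * v),
   (f0 + Ci * f1 + h2 - Ci * h3 + Ci * (/ RtoC 4 - lam) * f,
    - h0 + Ci * h1 + f2 + Ci * f3 - Ci * (/ RtoC 4 + lam) * h))%C.
Proof.
  intros Ha Hp E E0 E1 E2 E3 lam.
  assert (la : 0 < ln alpha) by (rewrite -ln_1; apply ln_increasing; lra).
  unfold twisted_dirac, spinor_add; rewrite dirac_frame // clifford_d_log // sum_n3.
  rewrite E E0 E1 E2 E3.
  unfold clifford_std, spinor_scale; rewrite !spinor_plusE RtoC_inv; [|lra]; unfold lam, Cdiv.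
  (apply f_equal2; [apply f_equal2|apply f_equal2]); ring.
Qed.

(** * Powers of the height *)

Lemma Cexp_plus (x y : C) : Cexp (x + y)%C = (Cexp x * Cexp y)%C.
Proof.
  destruct x as [a b], y as [c d]; unfold Cexp, Cplus, Cmult, Re, Im; simpl.
  rewrite exp_plus cos_plus sin_plus; apply f_equal2; ring.
Qed.

Lemma Cexp_0 : Cexp (RtoC 0) = RtoC 1.
Proof. unfold Cexp, RtoC, Re, Im; simpl; rewrite exp_0 cos_0 sin_0; f_equal; ring. Qed.

Lemma Cexp_RtoC (x : R) : Cexp (RtoC x) = RtoC (exp x).
Proof. unfold Cexp, RtoC, Re, Im; simpl; rewrite cos_0 sin_0; f_equal; ring. Qed.

Lemma Cmod_Cexp (x : C) : Cmod (Cexp x) = exp (Re x).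
Proof.
  destruct x as [a b]; unfold Cmod, Cexp, Re, Im; simpl.
  replace (exp a * cos b * (exp a * cos b * 1) + exp a * sin b * (exp a * sin b * 1))
    with (exp a * exp a * ((sin b)² + (cos b)²)) by (unfold Rsqr; ring).
  rewrite sin2_cos2 Rmult_1_r sqrt_square //; apply Rlt_le, exp_pos.
Qed.

Lemma Cexp_neq0 (x : C) : Cexp x <> RtoC 0.
Proof. apply Cmod_gt_0; rewrite Cmod_Cexp; apply exp_pos. Qed.

Lemma Cexp_opp (x : C) : Cexp (- x)%C = (/ Cexp x)%C.
Proof.
  assert (E : (Cexp x * Cexp (- x))%C = RtoC 1).
  { rewrite -Cexp_plus; replace (x + - x)%C with (RtoC 0) by ring; apply Cexp_0. }
  replace (Cexp (- x))%C with (/ Cexp x * (Cexp x * Cexp (- x)))%C by (field; apply Cexp_neq0).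
  rewrite E; ring.
Qed.

(** t^g for complex g, through the real logarithm of the height. *)
Definition tpow (g : C) (p : pt) : C := Cexp (g * RtoC (ln (im_w p)))%C.

Lemma tpow_plus (g d : C) (p : pt) : tpow (g + d)%C p = (tpow g p * tpow d p)%C.
Proof. unfold tpow; rewrite -Cexp_plus; f_equal; ring. Qed.

Lemma tpow_neq0 (g : C) (p : pt) : tpow g p <> RtoC 0.
Proof. apply Cexp_neq0. Qed.

Lemma tpow_opp (g : C) (p : pt) : tpow (- g)%C p = (/ tpow g p)%C.
Proof. unfold tpow; rewrite -Cexp_opp; f_equal; ring. Qed.

Lemma tpow_1 (p : pt) : HxC p -> tpow (RtoC 1) p = RtoC (im_w p).
Proof.
  intros Hp; unfold tpow; rewrite -RtoC_mult Cexp_RtoC Rmult_1_l exp_ln //.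
Qed.

Lemma tpow_half (p : pt) : HxC p -> tpow (RtoC (1 / 2)) p = RtoC (sqrt (im_w p)).
Proof.
  intros Hp; unfold tpow; rewrite -RtoC_mult Cexp_RtoC -Rpower_sqrt //.
  unfold Rpower; do 2 f_equal; field.
Qed.

Lemma tpow_scale_act (g : C) (P : R) (r : C) (p : pt) : 0 < P -> HxC p ->
  tpow g (scale_act P r p) = (Cexp (g * RtoC (ln P)) * tpow g p)%C.
Proof.
  intros HP Hp; unfold tpow; rewrite -Cexp_plus; f_equal.
  unfold im_w; rewrite Im_scale_act ln_mult // RtoC_plus; ring.
Qed.

Lemma tpow_move (g : C) (v p : pt) (s : R) : translation v -> tpow g (move p v s) = tpow g p.
Proof. intros Hv; unfold tpow, im_w; now rewrite Im_move. Qed.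

Lemma is_derive_tpow (g : C) (X p : pt) : HxC p ->
  is_derive (fun s => Re (tpow g (move p X s))) 0 (Im (fst X) / im_w p * Re (g * tpow g p)%C) /\
  is_derive (fun s => Im (tpow g (move p X s))) 0 (Im (fst X) / im_w p * Im (g * tpow g p)%C).
Proof.
  intros Hp; assert (t0 : 0 < im_w p) by exact Hp.
  destruct g as [g1 g2].
  assert (D : forall g l, is_derive g (ln (im_w p)) l ->
    is_derive (fun s => g (ln (im_w p + s * Im (fst X)))) 0 (Im (fst X) / im_w p * l)).
  { intros g l H; apply: is_derive_comp.
    - rewrite Rmult_0_l Rplus_0_r; exact H.
    - auto_derive; rewrite Rmult_0_l Rplus_0_r; [exact t0|field; lra]. }
  split.
  - apply (is_derive_ext (fun s => exp (g1 * ln (im_w p + s * Im (fst X)))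
                                   * cos (g2 * ln (im_w p + s * Im (fst X))))).
    { intros s; unfold tpow; rewrite im_w_move; unfold Cexp, Re, Im; simpl.
      f_equal; f_equal; ring. }
    set (m := Im (fst X)) in *; set (t := im_w p) in *.
    unfold tpow, Cexp, Re, Im; simpl; fold t.
    replace (g1 * ln t - g2 * 0) with (g1 * ln t) by ring.
    replace (g1 * 0 + g2 * ln t) with (g2 * ln t) by ring.
    evar_last; [apply (D (fun x => exp (g1 * x) * cos (g2 * x)) (g1 * (exp (g1 * ln t) * cos (g2 * ln t)) - g2 * (exp (g1 * ln t) * sin (g2 * ln t)))); auto_derive; [trivial|ring]|field; lra].
  - apply (is_derive_ext (fun s => exp (g1 * ln (im_w p + s * Im (fst X)))
                                   * sin (g2 * ln (im_w p + s * Im (fst X))))).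
    { intros s; unfold tpow; rewrite im_w_move; unfold Cexp, Re, Im; simpl.
      f_equal; f_equal; ring. }
    set (m := Im (fst X)) in *; set (t := im_w p) in *.
    unfold tpow, Cexp, Re, Im; simpl; fold t.
    replace (g1 * ln t - g2 * 0) with (g1 * ln t) by ring.
    replace (g1 * 0 + g2 * ln t) with (g2 * ln t) by ring.
    evar_last; [apply (D (fun x => exp (g1 * x) * sin (g2 * x)) (g1 * (exp (g1 * ln t) * sin (g2 * ln t)) + g2 * (exp (g1 * ln t) * cos (g2 * ln t)))); auto_derive; [trivial|ring]|field; lra].
Qed.

Lemma tpow_pred (g : C) (p : pt) : HxC p ->
  tpow (g - RtoC 1)%C p = (RtoC (/ im_w p) * tpow g p)%C.
Proof.
  intros Hp; assert (t0 : 0 < im_w p) by exact Hp.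
  unfold Cminus; rewrite tpow_plus tpow_opp tpow_1 // RtoC_inv; [ring|lra].
Qed.

(** The derivative of t^g is a multiple of t^(g - 1), so the induction on k runs over all exponents
    at once. *)
Lemma CkR_tpow (k : nat) : forall g,
  CkR k (re_part (tpow g)) /\ CkR k (im_part (tpow g)).
Proof.
  assert (Ck0 : forall p, HxC p -> @continuous pt_space R_UniformSpace
     (fun q => ln (im_w q)) p).
  { intros p Hp; apply (continuous_comp im_w ln).
    - destruct (continuous_coords (U := pt_space) (fun q => q) p (continuous_id _)) as [[_ h] _]; exact h.
    - apply: ex_derive_continuous; auto_derive; exact Hp. }
  assert (C0 : forall g p, HxC p ->
    @continuous pt_space R_UniformSpace (re_part (tpow g)) p /\
    @continuous pt_space R_UniformSpace (im_part (tpow g)) p).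
  { intros [g1 g2] p Hp; split.
    - apply (continuous_ext (fun q => (fun x => exp (g1 * x) * cos (g2 * x)) (ln (im_w q)))).
      { intros q; unfold re_part, tpow, Cexp, Re, Im; simpl; f_equal; f_equal; ring. }
      apply (continuous_comp (fun q => ln (im_w q)) (fun x => exp (g1 * x) * cos (g2 * x))); [now apply Ck0|].
      apply: ex_derive_continuous; auto_derive; trivial.
    - apply (continuous_ext (fun q => (fun x => exp (g1 * x) * sin (g2 * x)) (ln (im_w q)))).
      { intros q; unfold im_part, tpow, Cexp, Re, Im; simpl; f_equal; f_equal; ring. }
      apply (continuous_comp (fun q => ln (im_w q)) (fun x => exp (g1 * x) * sin (g2 * x))); [now apply Ck0|].
      apply: ex_derive_continuous; auto_derive; trivial. }
  induction k as [|k IH]; intros g; (split; (split; [intros p Hp; apply (C0 g p Hp)|])); try exact I.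
  - intros X; split.
    + intros p Hp; eexists; exact (proj1 (is_derive_tpow g X p Hp)).
    + destruct (IH (g - RtoC 1)%C) as [I1 I2].
      apply (CkR_ext k (fun q => Im (fst X) * Re g * re_part (tpow (g - RtoC 1)%C) q
                                 + - Im (fst X) * Im g * im_part (tpow (g - RtoC 1)%C) q)).
      * intros q Hq; rewrite (dirR_eq X _ _ _ (proj1 (is_derive_tpow g X q Hq))).
        unfold re_part, im_part; rewrite tpow_pred //.
        destruct g as [g1 g2], (tpow (g1, g2) q) as [w1 w2]; unfold Re, Im; simpl; unfold Rdiv; ring.
      * apply CkR_plus; apply CkR_mult; trivial; apply CkR_const.
  - intros X; split.
    + intros p Hp; eexists; exact (proj2 (is_derive_tpow g X p Hp)).
    + destruct (IH (g - RtoC 1)%C) as [I1 I2].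
      apply (CkR_ext k (fun q => Im (fst X) * Re g * im_part (tpow (g - RtoC 1)%C) q
                                 + Im (fst X) * Im g * re_part (tpow (g - RtoC 1)%C) q)).
      * intros q Hq; rewrite (dirR_eq X _ _ _ (proj2 (is_derive_tpow g X q Hq))).
        unfold re_part, im_part; rewrite tpow_pred //.
        destruct g as [g1 g2], (tpow (g1, g2) q) as [w1 w2]; unfold Re, Im; simpl; unfold Rdiv; ring.
      * apply CkR_plus; apply CkR_mult; trivial; apply CkR_const.
Qed.

Definition csmooth (F : pt -> C) : Prop := smoothR (re_part F) /\ smoothR (im_part F).

Lemma csmooth_tpow (g : C) : csmooth (tpow g).
Proof. split; intros k; apply CkR_tpow. Qed.

Lemma csmooth_mult (F G : pt -> C) : csmooth F -> csmooth G -> csmooth (fun q => F q * G q)%C.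
Proof.
  intros [F1 F2] [G1 G2]; split.
  - exact (smoothR_minus _ _ (smoothR_mult _ _ F1 G1) (smoothR_mult _ _ F2 G2)).
  - exact (smoothR_plus _ _ (smoothR_mult _ _ F1 G2) (smoothR_mult _ _ F2 G1)).
Qed.

Lemma csmooth_const (c : C) : csmooth (fun _ => c).
Proof. split; [exact (smoothR_const (Re c))|exact (smoothR_const (Im c))]. Qed.

Lemma CkR_of_Ck (k : nat) : forall F, Ck k F -> CkR k (re_part F) /\ CkR k (im_part F).
Proof.
  induction k as [|k IH]; intros F [Hc Hd].
  - split; (split; [intros p Hp|exact I]).
    + apply (continuous_comp F (fst : C -> R)); [now apply Hc|apply (@continuous_fst R_UniformSpace R_UniformSpace)].
    + apply (continuous_comp F (snd : C -> R)); [now apply Hc|apply (@continuous_snd R_UniformSpace R_UniformSpace)].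
  - split; (split; [intros p Hp|]).
    + apply (continuous_comp F (fst : C -> R)); [now apply Hc|apply (@continuous_fst R_UniformSpace R_UniformSpace)].
    + intros X; destruct (Hd X) as [E D]; split; [intros p Hp; apply (E p Hp)|].
      destruct (IH _ D) as [D1 _]; rewrite dirdE; exact D1.
    + apply (continuous_comp F (snd : C -> R)); [now apply Hc|apply (@continuous_snd R_UniformSpace R_UniformSpace)].
    + intros X; destruct (Hd X) as [E D]; split; [intros p Hp; apply (E p Hp)|].
      destruct (IH _ D) as [_ D2]; rewrite dirdE; exact D2.
Qed.

Lemma Ck_of_CkR (k : nat) : forall F, CkR k (re_part F) -> CkR k (im_part F) -> Ck k F.
Proof.
  assert (C0 : forall k F p, CkR k (re_part F) -> CkR k (im_part F) -> HxC p ->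
     @continuous pt_space C_UniformSpace F p).
  { intros m F p H1 H2 Hp; apply filterlim_locally; intros e.
    generalize (filter_and _ _
      (proj1 (filterlim_locally _ _) (CkR_cont m _ p H1 Hp) e)
      (proj1 (filterlim_locally _ _) (CkR_cont m _ p H2 Hp) e)).
    apply filter_imp; intros q [b1 b2]; exact (conj b1 b2). }
  induction k as [|k IH]; intros F H1 H2.
  - split; [intros p Hp; exact (C0 0%nat F p H1 H2 Hp)|exact I].
  - split; [intros p Hp; exact (C0 (S k) F p H1 H2 Hp)|].
    intros X; destruct (proj2 H1 X) as [E1 D1], (proj2 H2 X) as [E2 D2]; split.
    + intros p Hp; split; [apply (E1 p Hp)|apply (E2 p Hp)].
    + apply IH.
      * apply (CkR_ext k (dird X (re_part F))); [|exact D1]; intros q _; now rewrite dirdE.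
      * apply (CkR_ext k (dird X (im_part F))); [|exact D2]; intros q _; now rewrite dirdE.
Qed.

Lemma csmooth_smooth (F : pt -> C) : smooth F <-> csmooth F.
Proof.
  split; [intros H; split; intros k; apply (CkR_of_Ck k F (H k))|].
  intros [H1 H2] k; now apply Ck_of_CkR.
Qed.

Lemma dirC_parts (X p : pt) (F : pt -> C) :
  dirC X F p = (dird X (re_part F) p, dird X (im_part F) p).
Proof. rewrite dirdE; reflexivity. Qed.

Lemma dirC_ext (X p : pt) (F G : pt -> C) : HxC p -> (forall q, HxC q -> F q = G q) ->
  dirC X F p = dirC X G p.
Proof.
  intros Hp E; rewrite !dirC_parts; f_equal; apply dirR_ext; trivial; intros q Hq;
    unfold re_part, im_part; now rewrite E.
Qed.

Lemma dirC_const (X p : pt) (c : C) : dirC X (fun _ => c) p = RtoC 0.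
Proof. rewrite dirC_parts; unfold re_part, im_part; now rewrite !dirR_const. Qed.

Lemma dirC_mult (X p : pt) (F G : pt -> C) : csmooth F -> csmooth G -> HxC p ->
  dirC X (fun q => F q * G q)%C p = (dirC X F p * G p + F p * dirC X G p)%C.
Proof.
  intros [F1 F2] [G1 G2] Hp; rewrite !dirC_parts.
  assert (E1 := dirR_minus X _ _ p (smoothR_mult _ _ F1 G1) (smoothR_mult _ _ F2 G2) Hp).
  assert (E2 := dirR_plus X _ _ p (smoothR_mult _ _ F1 G2) (smoothR_mult _ _ F2 G1) Hp).
  rewrite !dirR_mult // in E1 E2.
  change (dird X (re_part (fun q => F q * G q)%C) p) with
    (dird X (fun p0 => re_part F p0 * re_part G p0 - im_part F p0 * im_part G p0) p).
  change (dird X (im_part (fun q => F q * G q)%C) p) with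
    (dird X (fun p0 => re_part F p0 * im_part G p0 + im_part F p0 * re_part G p0) p).
  rewrite E1 E2; unfold re_part, im_part, Cplus, Cmult, Re, Im; simpl; apply f_equal2; ring.
Qed.

Lemma dirC_tpow (g : C) (X p : pt) : HxC p ->
  dirC X (tpow g) p = (RtoC (Im (fst X) / im_w p) * (g * tpow g p))%C.
Proof.
  intros Hp; rewrite dirC_parts.
  rewrite (dirR_eq X _ _ _ (proj1 (is_derive_tpow g X p Hp))).
  rewrite (dirR_eq X _ _ _ (proj2 (is_derive_tpow g X p Hp))).
  unfold Cmult, RtoC, Re, Im; simpl; apply f_equal2; ring.
Qed.

Lemma dirC_weight (k g : C) (F : pt -> C) (X p : pt) : csmooth F -> HxC p ->
  dirC X (fun q => k * tpow g q * F q)%C p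
  = (k * tpow g p * (dirC X F p + RtoC (Im (fst X) / im_w p) * g * F p))%C.
Proof.
  intros HF Hp.
  assert (Hk := csmooth_const k); assert (Hg := csmooth_tpow g).
  rewrite (dirC_mult X p (fun q => k * tpow g q)%C F (csmooth_mult _ _ Hk Hg) HF Hp).
  rewrite (dirC_mult X p _ _ Hk Hg Hp) dirC_const dirC_tpow //; ring.
Qed.

Lemma dirC_lincomb (r s : R) (X Y p : pt) (F : pt -> C) : csmooth F -> HxC p ->
  dirC (lincomb r X s Y) F p = (RtoC r * dirC X F p + RtoC s * dirC Y F p)%C.
Proof.
  intros [F1 F2] Hp; rewrite !dirC_parts !dirR_lincomb //.
  unfold Cplus, Cmult, RtoC; simpl; apply f_equal2; ring.
Qed.

Lemma dirC_frame_coords (F : pt -> C) (p : pt) : csmooth F -> HxC p ->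
  dirC (frame 0 p) F p = (RtoC (im_w p) * dirC dir_x F p)%C /\
  dirC (frame 1 p) F p = (RtoC (im_w p) * dirC dir_t F p)%C /\
  dirC (frame 2 p) F p = (RtoC (/ sqrt (im_w p)) * dirC dir_1 F p)%C /\
  dirC (frame 3 p) F p = (RtoC (/ sqrt (im_w p)) * dirC dir_2 F p)%C.
Proof.
  intros HF Hp.
  assert (L : forall r X, dirC (lincomb r X 0 X) F p = (RtoC r * dirC X F p)%C).
  { intros r X; rewrite dirC_lincomb //; ring. }
  rewrite -!L; repeat split; f_equal;
    unfold frame, lincomb, dir_x, dir_t, dir_1, dir_2, Cplus, Cmult, RtoC, Ci; simpl; apply pt_ext; ring.
Qed.

(** Since e_1 (log t) = 1 and the other e_i kill t, a weight t^g adds a zeroth-order term g along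
    e_1 only. Suitable weights thus absorb the terms 1/4 - lam and 1/4 + lam of the twisted
    operator. *)
Lemma dirC_weight_frame (k g : C) (F : pt -> C) (p : pt) : csmooth F -> HxC p ->
  let W := (k * tpow g p)%C in let H q := (k * tpow g q * F q)%C in
  dirC (frame 0 p) H p = (W * (RtoC (im_w p) * dirC dir_x F p))%C /\
  dirC (frame 1 p) H p = (W * (RtoC (im_w p) * dirC dir_t F p + g * F p))%C /\
  dirC (frame 2 p) H p = (W * (RtoC (/ sqrt (im_w p)) * dirC dir_1 F p))%C /\
  dirC (frame 3 p) H p = (W * (RtoC (/ sqrt (im_w p)) * dirC dir_2 F p))%C.
Proof.
  intros HF Hp W H; assert (t0 : 0 < im_w p) by exact Hp.
  destruct (dirC_frame_coords F p HF Hp) as [E0 [E1 [E2 E3]]].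
  unfold H, W; rewrite !dirC_weight // E0 E1 E2 E3 !Im_frame; try lia.
  unfold tau, delta; simpl Nat.eqb; cbv iota.
  replace (1 * im_w p / im_w p) with 1 by (field; lra).
  replace (0 * im_w p / im_w p) with 0 by (field; lra).
  repeat split; ring.
Qed.

(** The hypothesis is the shape in which the kernel equations appear; dividing by i t solves them
    for the t-derivatives. *)
Lemma elliptic_of_complex (s c1 c2 : R) (F G : pt -> C) :
  (forall p, HxC p -> let t := RtoC (im_w p) in
     (t * dirC dir_x F p + Ci * t * dirC dir_t F p
      + RtoC (c1 / 2) * (dirC dir_1 G p - RtoC s * Ci * dirC dir_2 G p) = RtoC 0)%C /\
     (- (t * dirC dir_x G p) + Ci * t * dirC dir_t G p
      + RtoC (c2 / (2 * im_w p)) * (dirC dir_1 F p + RtoC s * Ci * dirC dir_2 F p) = RtoC 0)%C) ->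
  elliptic_system s c1 c2 (re_part F) (im_part F) (re_part G) (im_part G).
Proof.
  intros H p Hp; cbv zeta; destruct (H p Hp) as [E1 E2]; clear H.
  assert (t0 : 0 < im_w p) by exact Hp; fold (im_w p).
  rewrite !dirC_parts in E1 E2.
  unfold Cminus, Cplus, Cmult, Copp, RtoC, Ci in E1, E2; simpl in E1, E2.
  injection E1; injection E2; clear E1 E2.
  set (t := im_w p) in *.
  intros e4 e3 e2 e1.
  repeat split; apply (Rmult_eq_reg_l t); try lra.
  - replace (t * (- dird dir_x (im_part F) p - c1 / (2 * t) * (dird dir_1 (im_part G) p - s * dird dir_2 (re_part G) p)))
      with (- t * dird dir_x (im_part F) p - c1 / 2 * (dird dir_1 (im_part G) p - s * dird dir_2 (re_part G) p)) by (field; lra).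
    lra.
  - replace (t * (dird dir_x (re_part F) p + c1 / (2 * t) * (dird dir_1 (re_part G) p + s * dird dir_2 (im_part G) p)))
      with (t * dird dir_x (re_part F) p + c1 / 2 * (dird dir_1 (re_part G) p + s * dird dir_2 (im_part G) p)) by (field; lra).
    lra.
  - replace (t * (dird dir_x (im_part G) p - c2 / (2 * t ^ 2) * (dird dir_1 (im_part F) p + s * dird dir_2 (re_part F) p)))
      with (t * dird dir_x (im_part G) p - c2 / (2 * t) * (dird dir_1 (im_part F) p + s * dird dir_2 (re_part F) p)) by (field; lra).
    lra.
  - replace (t * (- dird dir_x (re_part G) p + c2 / (2 * t ^ 2) * (dird dir_1 (re_part F) p - s * dird dir_2 (im_part F) p)))
      with (- t * dird dir_x (re_part G) p + c2 / (2 * t) * (dird dir_1 (re_part F) p - s * dird dir_2 (im_part F) p)) by (field; lra).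
    lra.
Qed.

(** * Eigenvectors *)

Definition i0 : 'I_3 := inord 0.
Definition i1 : 'I_3 := inord 1.
Definition i2 : 'I_3 := inord 2.

Lemma ord3_cases (i : 'I_3) : i = i0 \/ i = i1 \/ i = i2.
Proof.
  case: i => [[|[|[|n]]] Hi] //; [left|right; left|right; right]; apply: val_inj; rewrite /= inordK //.
Qed.

Lemma big_ord3 {T : Type} (op : T -> T -> T) (e : T) (F : 'I_3 -> T) :
  \big[op/e]_(j < 3) F j = op (F i0) (op (F i1) (op (F i2) e)).
Proof.
  rewrite !big_ord_recl big_ord0; do 3 f_equal; first [f_equal; apply: val_inj; rewrite /= inordK // | idtac].
Qed.

Ltac real_ring := match goal with |- @eq _ ?x ?y => change (@eq R x y) end; ring.

Lemma det2 (B : 'M[R]_2) : determinant B =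
  B (inord 0) (inord 0) * B (inord 1) (inord 1) - B (inord 0) (inord 1) * B (inord 1) (inord 0).
Proof.
  rewrite (expand_det_row _ (ord0 : 'I_2)) !big_ord_recl !big_ord0 /cofactor !det_mx11 !mxE.
  have -> : ord0 = inord 0 :> 'I_2 by apply: val_inj; rewrite /= inordK.
  have -> : lift (inord 0) (ord0 : 'I_1) = inord 1 :> 'I_2 by apply: val_inj; rewrite /= !inordK.
  have -> : lift (inord 1) (GRing.zero : 'I_1) = inord 0 :> 'I_2 by apply: val_inj; rewrite /= !inordK.
  rewrite !inordK // GRing.expr0 GRing.expr1 GRing.mulN1r GRing.mul1r GRing.addr0 -?RoppE -?RmultE -?RplusE.
  set b00 := B (inord 0) (inord 0); set b01 := B (inord 0) (inord 1).
  set b10 := B (inord 1) (inord 0); set b11 := B (inord 1) (inord 1).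
  real_ring.
Qed.

Lemma det3 (A : 'M[R]_3) : determinant A =
  A i0 i0 * (A i1 i1 * A i2 i2 - A i1 i2 * A i2 i1)
  - A i0 i1 * (A i1 i0 * A i2 i2 - A i1 i2 * A i2 i0)
  + A i0 i2 * (A i1 i0 * A i2 i1 - A i1 i1 * A i2 i0).
Proof.
  rewrite (expand_det_row _ i0) big_ord3 /cofactor.
  rewrite (det2 (row' i0 (col' i0 A))) (det2 (row' i0 (col' i1 A))) (det2 (row' i0 (col' i2 A))) !mxE.
  have -> : lift i0 (inord 0 : 'I_2) = i1 by apply: val_inj; rewrite /= !inordK.
  have -> : lift i0 (inord 1 : 'I_2) = i2 by apply: val_inj; rewrite /= !inordK.
  have -> : lift i1 (inord 0 : 'I_2) = i0 by apply: val_inj; rewrite /= !inordK.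
  have -> : lift i1 (inord 1 : 'I_2) = i2 by apply: val_inj; rewrite /= !inordK.
  have -> : lift i2 (inord 0 : 'I_2) = i0 by apply: val_inj; rewrite /= !inordK.
  have -> : lift i2 (inord 1 : 'I_2) = i1 by apply: val_inj; rewrite /= !inordK.
  set a00 := A i0 i0; set a01 := A i0 i1; set a02 := A i0 i2.
  set a10 := A i1 i0; set a11 := A i1 i1; set a12 := A i1 i2.
  set a20 := A i2 i0; set a21 := A i2 i1; set a22 := A i2 i2.
  clearbody a00 a01 a02 a10 a11 a12 a20 a21 a22.
  rewrite /i0 /i1 /i2 !inordK //= GRing.expr0 GRing.expr1 GRing.sqrrN GRing.expr1n.
  rewrite !GRing.mulN1r !GRing.mul1r GRing.addr0 -?RoppE -?RmultE -?RplusE; real_ring.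
Qed.

Lemma det_int_to_R (M : 'M[int]_3) : determinant M = Posz 1 ->
  determinant (map_mx int_to_R M) = 1.
Proof.
  intros hM; rewrite -[1](_ : int_to_R (Posz 1) = 1); last exact: mulr1z.
  rewrite -hM; exact: (det_map_mx (intmul (1 : R))).
Qed.

Definition triple (x y z : R) (j : 'I_3) : R := if j == i0 then x else if j == i1 then y else z.

Lemma tripleE (x y z : R) : triple x y z i0 = x /\ triple x y z i1 = y /\ triple x y z i2 = z.
Proof. rewrite /triple /i0 /i1 /i2 -!val_eqE /= !inordK //. Qed.

Lemma dependent_of_det0 (a x y : 'I_3 -> R) :
  a i0 * (x i1 * y i2 - x i2 * y i1) - a i1 * (x i0 * y i2 - x i2 * y i0)
  + a i2 * (x i0 * y i1 - x i1 * y i0) = 0 ->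
  exists c0 c1 c2 : R, (c0 <> 0 \/ c1 <> 0 \/ c2 <> 0) /\
    forall j, c0 * a j + c1 * x j + c2 * y j = 0.
Proof.
  intros D; set A : 'M[R]_3 := matrix_of_fun matrix_key (fun k j => triple (a j) (x j) (y j) k).
  assert (E : forall j, A i0 j = a j /\ A i1 j = x j /\ A i2 j = y j).
  { intros j; rewrite !mxE; apply tripleE. }
  assert (D0 : determinant A == 0).
  { apply/eqP; rewrite det3; destruct (E i0) as [-> [-> ->]], (E i1) as [-> [-> ->]], (E i2) as [-> [-> ->]].
    rewrite -[RHS]D; real_ring. }
  case/det0P: D0 => v v0 vA.
  exists (v ord0 i0), (v ord0 i1), (v ord0 i2); split.
  - destruct (Req_dec (v ord0 i0) 0) as [z0|]; [|now left].
    destruct (Req_dec (v ord0 i1) 0) as [z1|]; [|now right; left].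
    destruct (Req_dec (v ord0 i2) 0) as [z2|]; [|now right; right].
    exfalso; move/eqP: v0; apply; apply/rowP => j; rewrite mxE.
    case: (ord3_cases j) => [->|[->|->]]; assumption.
  - intros j; move/rowP/(_ j): vA; rewrite [LHS]mxE [RHS]mxE big_ord3.
    have [e0 [e1 e2]] := E j; rewrite e0 e1 e2 GRing.addr0 -!RplusE -!RmultE => H.
    rewrite -[RHS]H; set c0 := v ord0 i0; set c1 := v ord0 i1; set c2 := v ord0 i2.
    real_ring.
Qed.

(** The polynomial M^2 - 2 p M + (p^2 + q^2) kills x and y and multiplies a by (alpha - p)^2 + q^2 >
    0, so a linear relation has no a-term. The remaining relation between x and y, together with its
    image under M, has determinant - q (c1^2 + c2^2), which is nonzero. *)
Lemma eigenbasis (m : 'I_3 -> 'I_3 -> R) (alpha p q : R) (a x y : 'I_3 -> R) :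
  (forall i, m i i0 * a i0 + m i i1 * a i1 + m i i2 * a i2 = alpha * a i) ->
  (forall i, m i i0 * x i0 + m i i1 * x i1 + m i i2 * x i2 = p * x i - q * y i) ->
  (forall i, m i i0 * y i0 + m i i1 * y i1 + m i i2 * y i2 = q * x i + p * y i) ->
  q <> 0 -> (exists i, a i <> 0) -> (exists i, x i <> 0 \/ y i <> 0) ->
  a i0 * (x i1 * y i2 - x i2 * y i1) - a i1 * (x i0 * y i2 - x i2 * y i0)
  + a i2 * (x i0 * y i1 - x i1 * y i0) <> 0.
Proof.
  intros Ha Hx Hy Hq [i ai] [j xyj] D.
  destruct (dependent_of_det0 a x y D) as [c0 [c1 [c2 [Hc L]]]].
  set (u1 := c1 * p + c2 * q); set (u2 := - c1 * q + c2 * p).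
  (* [L2] and [L3] are the images of the relation [L] under M and M^2. *)
  assert (L2 : forall k, c0 * alpha * a k + u1 * x k + u2 * y k = 0).
  { intros k; transitivity (m k i0 * (c0 * a i0 + c1 * x i0 + c2 * y i0)
      + m k i1 * (c0 * a i1 + c1 * x i1 + c2 * y i1) + m k i2 * (c0 * a i2 + c1 * x i2 + c2 * y i2));
      [|rewrite !L; ring].
    transitivity (c0 * (alpha * a k) + c1 * (p * x k - q * y k) + c2 * (q * x k + p * y k)); [unfold u1, u2; ring|].
    rewrite -Ha -Hx -Hy; ring. }
  assert (L3 : forall k, c0 * alpha * alpha * a k + (u1 * p + u2 * q) * x k + (- u1 * q + u2 * p) * y k = 0).
  { intros k; transitivity (m k i0 * (c0 * alpha * a i0 + u1 * x i0 + u2 * y i0)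
      + m k i1 * (c0 * alpha * a i1 + u1 * x i1 + u2 * y i1) + m k i2 * (c0 * alpha * a i2 + u1 * x i2 + u2 * y i2));
      [|rewrite !L2; ring].
    transitivity (c0 * alpha * (alpha * a k) + u1 * (p * x k - q * y k) + u2 * (q * x k + p * y k)); [ring|].
    rewrite -Ha -Hx -Hy; ring. }
  assert (Z : c0 * ((alpha - p) * (alpha - p) + q * q) * a i = 0).
  { transitivity ((c0 * alpha * alpha * a i + (u1 * p + u2 * q) * x i + (- u1 * q + u2 * p) * y i)
      - 2 * p * (c0 * alpha * a i + u1 * x i + u2 * y i) + (p * p + q * q) * (c0 * a i + c1 * x i + c2 * y i)).
    - unfold u1, u2; ring.
    - rewrite L L2 L3; ring. }
  assert (Q : 0 < q * q) by exact (Rsqr_pos_lt q Hq).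
  assert (Q' : 0 <= (alpha - p) * (alpha - p)) by apply Rle_0_sqr.
  assert (Z0 : c0 = 0).
  { apply Rmult_integral in Z; destruct Z as [Z|Z]; [|contradiction].
    apply Rmult_integral in Z; destruct Z as [Z|Z]; [exact Z|lra]. }
  specialize (L j); specialize (L2 j); rewrite Z0 in L, L2, Hc.
  assert (N : 0 < c1 * c1 + c2 * c2).
  { assert (S1 := Rle_0_sqr c1); assert (S2 := Rle_0_sqr c2); unfold Rsqr in *.
    destruct Hc as [H|[H|H]]; [lra|assert (P := Rsqr_pos_lt c1 H)|assert (P := Rsqr_pos_lt c2 H)];
      unfold Rsqr in P; lra. }
  assert (X0 : q * (c1 * c1 + c2 * c2) * x j = 0).
  { transitivity (- u2 * (0 * a j + c1 * x j + c2 * y j) + c2 * (0 * alpha * a j + u1 * x j + u2 * y j)).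
    - unfold u1, u2; ring.
    - rewrite L L2; ring. }
  assert (Y0 : q * (c1 * c1 + c2 * c2) * y j = 0).
  { transitivity (u1 * (0 * a j + c1 * x j + c2 * y j) - c1 * (0 * alpha * a j + u1 * x j + u2 * y j)).
    - unfold u1, u2; ring.
    - rewrite L L2; ring. }
  assert (NZ : q * (c1 * c1 + c2 * c2) <> 0) by (apply Rmult_integral_contrapositive; split; lra).
  destruct xyj as [H|H]; apply H.
  - apply Rmult_integral in X0; destruct X0; [contradiction|assumption].
  - apply Rmult_integral in Y0; destruct Y0; [contradiction|assumption].
Qed.

(** With D the determinant of (a, x, y), that of (M a, M x, M y) is det M times D, and also alpha
    (p^2 + q^2) D. *)
Lemma eigenvalue_product (m : 'I_3 -> 'I_3 -> R) (alpha p q : R) (a x y : 'I_3 -> R) :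
  (forall i, m i i0 * a i0 + m i i1 * a i1 + m i i2 * a i2 = alpha * a i) ->
  (forall i, m i i0 * x i0 + m i i1 * x i1 + m i i2 * x i2 = p * x i - q * y i) ->
  (forall i, m i i0 * y i0 + m i i1 * y i1 + m i i2 * y i2 = q * x i + p * y i) ->
  m i0 i0 * (m i1 i1 * m i2 i2 - m i1 i2 * m i2 i1) - m i0 i1 * (m i1 i0 * m i2 i2 - m i1 i2 * m i2 i0)
  + m i0 i2 * (m i1 i0 * m i2 i1 - m i1 i1 * m i2 i0) = 1 ->
  a i0 * (x i1 * y i2 - x i2 * y i1) - a i1 * (x i0 * y i2 - x i2 * y i0)
  + a i2 * (x i0 * y i1 - x i1 * y i0) <> 0 ->
  alpha * (p * p + q * q) = 1.
Proof.
  intros Ha Hx Hy D1; set (D := a i0 * _ - _ + _); intros HD.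
  apply (Rmult_eq_reg_r D); [|exact HD].
  pose (A i := m i i0 * a i0 + m i i1 * a i1 + m i i2 * a i2).
  pose (X i := m i i0 * x i0 + m i i1 * x i1 + m i i2 * x i2).
  pose (Y i := m i i0 * y i0 + m i i1 * y i1 + m i i2 * y i2).
  transitivity (A i0 * (X i1 * Y i2 - X i2 * Y i1) - A i1 * (X i0 * Y i2 - X i2 * Y i0)
    + A i2 * (X i0 * Y i1 - X i1 * Y i0)).
  - unfold A, X, Y; rewrite !Ha !Hx !Hy; unfold D; ring.
  - rewrite -D1; unfold A, X, Y, D; ring.
Qed.

Lemma eigenvector_real_parts (M : 'M[int]_3) (lambda : C) (v : 'I_3 -> C) :
  is_eigenvector M lambda v ->
  (forall i, int_to_R (M i i0) * Re (v i0) + int_to_R (M i i1) * Re (v i1) + int_to_R (M i i2) * Re (v i2)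
     = Re lambda * Re (v i) - Im lambda * Im (v i)) /\
  (forall i, int_to_R (M i i0) * Im (v i0) + int_to_R (M i i1) * Im (v i1) + int_to_R (M i i2) * Im (v i2)
     = Im lambda * Re (v i) + Re lambda * Im (v i)).
Proof.
  intros [_ H]; split; intros i; specialize (H i); rewrite big_ord3 in H.
  - apply (f_equal Re) in H; unfold Re, Im, Cplus, Cmult, RtoC in *; cbn [fst snd] in H; rewrite -H; ring.
  - apply (f_equal Im) in H; unfold Re, Im, Cplus, Cmult, RtoC in *; cbn [fst snd] in H.
    transitivity (fst lambda * snd (v i) + snd lambda * fst (v i)); [rewrite -H; ring|ring].
Qed.

Lemma inoue_linear_algebra (M : 'M[int]_3) (alpha : R) (beta : C) (a : 'I_3 -> R) (b : 'I_3 -> C) :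
  determinant M = Posz 1 -> beta <> Cconj beta ->
  is_eigenvector M (RtoC alpha) (fun i => RtoC (a i)) -> is_eigenvector M beta b ->
  Im beta <> 0 /\ alpha * Cmod beta ^ 2 = 1 /\
  forall X0 X1 X2 : R, exists c0 c1 c2 : R,
    X0 = c0 * a i0 + c1 * a i1 + c2 * a i2 /\
    X1 = c0 * Re (b i0) + c1 * Re (b i1) + c2 * Re (b i2) /\
    X2 = c0 * Im (b i0) + c1 * Im (b i1) + c2 * Im (b i2).
Proof.
  intros hM hbeta ha hb.
  assert (q0 : Im beta <> 0).
  { intros E; apply hbeta; destruct beta as [p q]; unfold Im in E; unfold Cconj; cbn [fst snd] in *; rewrite E.
    f_equal; ring. }
  destruct (eigenvector_real_parts _ _ _ ha) as [A _].
  destruct (eigenvector_real_parts _ _ _ hb) as [X Y].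
  cbn [Re Im RtoC fst snd] in A.
  assert (A' : forall i, int_to_R (M i i0) * a i0 + int_to_R (M i i1) * a i1 + int_to_R (M i i2) * a i2 = alpha * a i).
  { intros i; rewrite A; unfold Im; simpl; ring. }
  assert (na : exists i, a i <> 0).
  { destruct (proj1 ha) as [i Hi]; exists i; intros E; apply Hi; now rewrite E. }
  assert (nb : exists i, Re (b i) <> 0 \/ Im (b i) <> 0).
  { destruct (proj1 hb) as [i Hi]; exists i.
    destruct (Req_dec (Re (b i)) 0) as [z1|]; [|now left].
    destruct (Req_dec (Im (b i)) 0) as [z2|]; [|now right].
    exfalso; apply Hi; apply injective_projections; assumption. }
  assert (D := eigenbasis (fun i j => int_to_R (M i j)) _ _ _ _ _ _ A' X Y q0 na nb).
  split; [exact q0|split].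
  - assert (D1 := det_int_to_R M hM); rewrite det3 !mxE in D1.
    assert (E := eigenvalue_product (fun i j => int_to_R (M i j)) _ _ _ _ _ _ A' X Y D1 D).
    rewrite -E; f_equal; unfold Cmod; rewrite pow2_sqrt; [unfold Re, Im; ring|nra].
  - intros X0 X1 X2.
    set (a0 := a i0) in *; set (a1 := a i1) in *; set (a2 := a i2) in *.
    set (x0 := Re (b i0)) in *; set (x1 := Re (b i1)) in *; set (x2 := Re (b i2)) in *.
    set (y0 := Im (b i0)) in *; set (y1 := Im (b i1)) in *; set (y2 := Im (b i2)) in *.
    clearbody a0 a1 a2 x0 x1 x2 y0 y1 y2.
    set (d := a0 * (x1 * y2 - x2 * y1) - a1 * (x0 * y2 - x2 * y0) + a2 * (x0 * y1 - x1 * y0)) in *.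
    (* Cramer's rule: each numerator is d with one column replaced by (X0, X1, X2). *)
    exists ((X0 * (x1 * y2 - x2 * y1) - a1 * (X1 * y2 - x2 * X2) + a2 * (X1 * y1 - x1 * X2)) / d).
    exists ((a0 * (X1 * y2 - x2 * X2) - X0 * (x0 * y2 - x2 * y0) + a2 * (x0 * X2 - X1 * y0)) / d).
    exists ((a0 * (x1 * X2 - X1 * y1) - a1 * (x0 * X2 - X1 * y0) + X0 * (x0 * y1 - x1 * y0)) / d).
    repeat split; unfold d in *; field; exact D.
Qed.

(** * Kernel equations *)

Lemma spinor_of_formE (omega : Defs.form) (q : pt) :
  spinor_of_form omega q =
  ((fst (fst (omega q)), RtoC (2 * sqrt (im_w q)) * snd (fst (omega q))),
   (RtoC (sqrt 2 * im_w q) * fst (snd (omega q)), RtoC (sqrt 2 / sqrt (im_w q)) * snd (snd (omega q))))%C.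
Proof. unfold spinor_of_form; now destruct (omega q) as [[f h] [u v]]. Qed.

Lemma dirS_ext (X p : pt) (psi : pt -> spinor) (f h u v : pt -> C) : HxC p ->
  (forall q, HxC q -> psi q = ((f q, h q), (u q, v q))) ->
  dirS X psi p = ((dirC X f p, dirC X h p), (dirC X u p, dirC X v p)).
Proof.
  intros Hp E; unfold dirS; (apply f_equal2; apply f_equal2); apply dirC_ext; trivial;
    intros q Hq; now rewrite E.
Qed.

Lemma Cmult_cancel_zero (x y : C) : x <> RtoC 0 -> (x * y)%C = RtoC 0 -> y = RtoC 0.
Proof.
  intros Hx E; replace y with (/ x * (x * y))%C by (field; exact Hx); rewrite E; ring.
Qed.

Lemma tpow_mul_opp (c : C) (q : pt) (x : C) : (tpow c q * (tpow (- c) q * x))%C = x.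
Proof. rewrite tpow_opp; field; apply tpow_neq0. Qed.

Lemma RtoC_quarter : (/ RtoC 4)%C = RtoC (1 / 4).
Proof. rewrite -RtoC_inv; [f_equal; field|lra]. Qed.

(** With lam = logz / ln alpha, the exponent c = lam - 1/4 absorbs the zeroth-order term on f, and c
    + 1/2 the one on h. The unitary coefficient of the (0,2)-part is 2 sqrt t times the coordinate
    one, so the single weight t^(-c) serves both coordinate coefficients; the factor 2 is the origin
    of the constants 4 and 1. *)
Lemma plus_system (alpha : R) (logz : C) (omega : Defs.form) : 1 < alpha ->
  csmooth (fun q => fst (fst (omega q))) -> csmooth (fun q => snd (fst (omega q))) ->
  section_plus omega ->
  (forall p, HxC p -> twisted_dirac alpha logz (spinor_of_form omega) p = zero) ->
  let c := (logz / RtoC (ln alpha) - RtoC (1 / 4))%C in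
  let F q := (tpow (- c) q * fst (fst (omega q)))%C in
  let G q := (tpow (- c) q * snd (fst (omega q)))%C in
  elliptic_system 1 4 1 (re_part F) (im_part F) (re_part G) (im_part G).
Proof.
  intros Ha Sf Sh Sec Ker c F G.
  assert (SF : csmooth F) by (apply csmooth_mult; [apply csmooth_tpow|exact Sf]).
  assert (SG : csmooth G) by (apply csmooth_mult; [apply csmooth_tpow|exact Sh]).
  set (e := (c + RtoC (1 / 2))%C).
  assert (E : forall q, HxC q -> spinor_of_form omega q =
    ((RtoC 1 * tpow c q * F q, RtoC 2 * tpow e q * G q), (RtoC 0, RtoC 0))%C).
  { intros q Hq; rewrite spinor_of_formE (Sec q Hq); cbn [fst snd]; unfold F, G, e.
    rewrite tpow_plus tpow_half // RtoC_mult.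
    (apply f_equal2; apply f_equal2); [| |ring|ring].
    - rewrite Cmult_1_l tpow_mul_opp; reflexivity.
    - rewrite -{1}(tpow_mul_opp c q (snd (fst (omega q)))); ring. }
  apply elliptic_of_complex; intros p Hp; cbv zeta.
  assert (t0 : 0 < im_w p) by exact Hp.
  destruct (sqrt_pos_facts _ t0) as [r0 rr].
  destruct (dirC_weight_frame (RtoC 1) c F p SF Hp) as [f0 [f1 [f2 f3]]].
  destruct (dirC_weight_frame (RtoC 2) e G p SG Hp) as [h0 [h1 [h2 h3]]].
  assert (D := fun i => dirS_ext (frame i p) p _ _ _ _ _ Hp E).
  assert (T := twisted_dirac_frame alpha logz _ p _ _ _ _ _ _ _ _ _ _ _ _ _ _ _ _ _ _ _ _
    Ha Hp (E p Hp) (D 0%nat) (D 1%nat) (D 2%nat) (D 3%nat)).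
  cbv zeta in T; rewrite (Ker p Hp) in T.
  assert (Tu := f_equal (fun s => fst (snd s)) T); assert (Tv := f_equal (fun s => snd (snd s)) T).
  cbn [fst snd] in Tu, Tv; clear T.
  change (fst (snd (zero : spinor))) with (RtoC 0) in Tu.
  change (snd (snd (zero : spinor))) with (RtoC 0) in Tv.
  rewrite f0 f1 h2 h3 in Tu; rewrite f2 f3 h0 h1 in Tv; clear f0 f1 f2 f3 h0 h1 h2 h3 D E Ker.
  rewrite RtoC_quarter in Tu, Tv.
  set (rho := RtoC (sqrt (im_w p))) in *.
  assert (Hrho : rho <> RtoC 0) by (apply RtoC_neq0; lra).
  assert (H2 : RtoC 2 <> RtoC 0) by (apply RtoC_neq0; lra).
  assert (Et : RtoC (im_w p) = (rho * rho)%C) by (unfold rho; rewrite -RtoC_mult rr; reflexivity).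
  assert (Er : RtoC (/ sqrt (im_w p)) = (/ rho)%C) by (unfold rho; rewrite RtoC_inv; [reflexivity|lra]).
  assert (Ee : tpow e p = (rho * tpow c p)%C) by (unfold e; rewrite tpow_plus tpow_half //; fold rho; ring).
  assert (E1 : RtoC (1 / (2 * im_w p)) = (/ (RtoC 2 * (rho * rho)))%C).
  { rewrite -Et -RtoC_mult -RtoC_inv; [f_equal; field; lra|nra]. }
  assert (E2 : RtoC (4 / 2) = RtoC 2) by (f_equal; field).
  assert (Eh : RtoC (1 / 2) = (RtoC (1 / 4) + RtoC (1 / 4))%C) by (rewrite -RtoC_plus; f_equal; field).
  rewrite Et Er Ee in Tu; rewrite Et Er Ee in Tv; rewrite Et E1 E2.
  assert (Ee' : e = (c + (RtoC (1 / 4) + RtoC (1 / 4)))%C) by (unfold e; now rewrite Eh).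
  assert (El : (logz / RtoC (ln alpha))%C = (c + RtoC (1 / 4))%C) by (unfold c; ring).
  rewrite El in Tu; rewrite El Ee' in Tv.
  assert (W0 := tpow_neq0 c p).
  split; [apply (Cmult_cancel_zero (tpow c p) _ W0)|apply (Cmult_cancel_zero (RtoC 2 * (rho * tpow c p))%C)].
  - refine (eq_trans _ (esym Tu)); field; assumption.
  - repeat apply Cmult_neq_0; assumption.
  - refine (eq_trans _ (esym Tv)); field; repeat split; assumption.
Qed.

(** Here c = lam + 1/4 absorbs the zeroth-order term on u, and c - 1/2 the one on v; for coordinate
    coefficients these exponents become c - 1 and c. F comes from conj(dz) and G from conj(dw),
    whence s = -1, and the factor -1 in G makes both coupling constants positive. *)
Lemma minus_system (alpha : R) (logz : C) (omega : Defs.form) : 1 < alpha ->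
  csmooth (fun q => fst (snd (omega q))) -> csmooth (fun q => snd (snd (omega q))) ->
  section_minus omega ->
  (forall p, HxC p -> twisted_dirac alpha logz (spinor_of_form omega) p = zero) ->
  let c := (logz / RtoC (ln alpha) + RtoC (1 / 4))%C in
  let F q := (tpow (- c) q * snd (snd (omega q)))%C in
  let G q := (tpow (RtoC 1 - c) q * (RtoC (-1) * fst (snd (omega q))))%C in
  elliptic_system (-1) 2 2 (re_part F) (im_part F) (re_part G) (im_part G).
Proof.
  intros Ha Su Sv Sec Ker c.
  assert (El : (logz / RtoC (ln alpha))%C = (c - RtoC (1 / 4))%C) by (unfold c; ring).
  clearbody c; intros F G.
  assert (SF : csmooth F) by (apply csmooth_mult; [apply csmooth_tpow|exact Sv]).
  assert (SG : csmooth G).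
  { apply csmooth_mult; [apply csmooth_tpow|apply csmooth_mult; [apply csmooth_const|exact Su]]. }
  set (e := (c - RtoC (1 / 2))%C).
  assert (E : forall q, HxC q -> spinor_of_form omega q =
    ((RtoC 0, RtoC 0), (- RtoC (sqrt 2) * tpow c q * G q, RtoC (sqrt 2) * tpow e q * F q))%C).
  { intros q Hq; rewrite spinor_of_formE (Sec q Hq); cbn [fst snd]; unfold F, G, e, Cminus.
    assert (t0 : 0 < im_w q) by exact Hq.
    destruct (sqrt_pos_facts _ t0) as [r0 _].
    rewrite !tpow_plus !tpow_opp tpow_1 // tpow_half // /Rdiv !RtoC_mult RtoC_inv; [|lra].
    assert (n1 := tpow_neq0 c q).
    assert (n2 : RtoC (sqrt (im_w q)) <> RtoC 0) by (apply RtoC_neq0; lra).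
    (apply f_equal2; apply f_equal2); [ring|ring| |field; split; assumption].
    replace (RtoC (-1)) with (- RtoC 1)%C by (rewrite -RtoC_opp; f_equal; ring).
    field; assumption. }
  apply elliptic_of_complex; intros p Hp; cbv zeta.
  assert (t0 : 0 < im_w p) by exact Hp.
  destruct (sqrt_pos_facts _ t0) as [r0 rr].
  destruct (dirC_weight_frame (- RtoC (sqrt 2))%C c G p SG Hp) as [u0 [u1 [u2 u3]]].
  destruct (dirC_weight_frame (RtoC (sqrt 2)) e F p SF Hp) as [v0 [v1 [v2 v3]]].
  assert (D := fun i => dirS_ext (frame i p) p _ _ _ _ _ Hp E).
  assert (T := twisted_dirac_frame alpha logz _ p _ _ _ _ _ _ _ _ _ _ _ _ _ _ _ _ _ _ _ _
    Ha Hp (E p Hp) (D 0%nat) (D 1%nat) (D 2%nat) (D 3%nat)).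
  cbv zeta in T; rewrite (Ker p Hp) in T.
  assert (Tf := f_equal (fun s => fst (fst s)) T); assert (Th := f_equal (fun s => snd (fst s)) T).
  cbn [fst snd] in Tf, Th; clear T.
  change (fst (fst (zero : spinor))) with (RtoC 0) in Tf.
  change (snd (fst (zero : spinor))) with (RtoC 0) in Th.
  rewrite u0 u1 v2 v3 in Tf; rewrite v0 v1 u2 u3 in Th; clear u0 u1 u2 u3 v0 v1 v2 v3 D E Ker.
  rewrite RtoC_quarter in Tf, Th.
  set (rho := RtoC (sqrt (im_w p))) in *.
  assert (Hrho : rho <> RtoC 0) by (apply RtoC_neq0; lra).
  assert (s2 : 0 < sqrt 2) by (apply sqrt_lt_R0; lra).
  assert (Hs : RtoC (sqrt 2) <> RtoC 0) by (apply RtoC_neq0; lra).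
  assert (Et : RtoC (im_w p) = (rho * rho)%C) by (unfold rho; rewrite -RtoC_mult rr; reflexivity).
  assert (Er : RtoC (/ sqrt (im_w p)) = (/ rho)%C) by (unfold rho; rewrite RtoC_inv; [reflexivity|lra]).
  assert (Ee : tpow c p = (rho * tpow e p)%C).
  { replace c with (e + RtoC (1 / 2))%C by (unfold e; ring); rewrite tpow_plus tpow_half //; fold rho; ring. }
  assert (E1 : RtoC (2 / (2 * im_w p)) = (/ (rho * rho))%C).
  { rewrite -Et -RtoC_inv; [f_equal; field; lra|lra]. }
  assert (E2 : RtoC (2 / 2) = RtoC 1) by (f_equal; field).
  assert (E3 : RtoC (-1) = (- RtoC 1)%C) by (rewrite -RtoC_opp; f_equal; ring).
  assert (Eh : RtoC (1 / 2) = (RtoC (1 / 4) + RtoC (1 / 4))%C) by (rewrite -RtoC_plus; f_equal; field).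
  rewrite Et Er Ee in Tf; rewrite Et Er Ee in Th; rewrite Et E1 E2 E3.
  assert (Ee' : e = (c - (RtoC (1 / 4) + RtoC (1 / 4)))%C) by (unfold e; now rewrite Eh).
  assert (W0 := tpow_neq0 e p); set (w := tpow e p) in *.
  rewrite El in Tf; rewrite El Ee' in Th.
  split; [apply (Cmult_cancel_zero (RtoC (sqrt 2) * w)%C)|apply (Cmult_cancel_zero (RtoC (sqrt 2) * (rho * w))%C)].
  - apply Cmult_neq_0; assumption.
  - refine (eq_trans _ (esym Th)); field; assumption.
  - repeat apply Cmult_neq_0; assumption.
  - replace (RtoC 0) with (- RtoC 0)%C by ring.
    refine (eq_trans _ (f_equal Copp (esym Tf))); field; assumption.
Qed.

(** Supplies a logarithm of beta for the second kernel element; the sign of the imaginary part of z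
    decides between acos and its opposite. *)
Lemma polar_form (z : C) : z <> RtoC 0 -> exists x, Cexp x = z.
Proof.
  intros Hz; assert (m0 : 0 < Cmod z) by now apply Cmod_gt_0.
  destruct z as [x y].
  assert (S : Cmod (x, y) * Cmod (x, y) = x * x + y * y).
  { unfold Cmod; simpl; rewrite sqrt_sqrt; [ring|nra]. }
  set (m := Cmod (x, y)) in *.
  set (u := x / m).
  assert (U : -1 <= u <= 1).
  { assert (u * u <= 1).
    { unfold u; replace (x / m * (x / m)) with (x * x / (m * m)) by (field; lra).
      apply Rmult_le_reg_r with (m * m); [nra|].
      replace (x * x / (m * m) * (m * m)) with (x * x) by (field; lra); nra. }
    nra. }
  assert (sy : m * sqrt (1 - u²) = Rabs y).
  { rewrite -{1}(sqrt_square m); [|lra]; rewrite -sqrt_mult; [|nra|unfold Rsqr; nra].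
    replace (m * m * (1 - u²)) with (y²).
    - apply sqrt_Rsqr_abs.
    - unfold u, Rsqr; replace (m * m * (1 - x / m * (x / m))) with (m * m - x * x) by (field; lra).
      rewrite S; ring. }
  assert (cx : m * u = x) by (unfold u; field; lra).
  destruct (Rle_lt_dec 0 y) as [Hy|Hy].
  - exists (ln m, acos u); unfold Cexp, Re, Im; simpl; rewrite exp_ln // cos_acos // sin_acos // cx sy.
    rewrite Rabs_pos_eq //.
  - exists (ln m, - acos u); unfold Cexp, Re, Im; simpl.
    rewrite exp_ln // cos_neg sin_neg cos_acos // sin_acos // cx.
    f_equal; rewrite Ropp_mult_distr_r_reverse sy Rabs_left //; ring.
Qed.

(** * Forms on the Inoue surface *)

Lemma constant_of_fibre_constant (phi : pt -> R) : smoothR phi ->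
  (forall X p, translation X -> HxC p -> phi (move p X 1) = phi p) ->
  (forall p, HxC p -> dird dir_t phi p = 0) ->
  forall p, HxC p -> phi p = phi ((0, 1), (0, 0)).
Proof.
  intros S Fib Z p Hp.
  set (X := ((fst (fst p), 0), snd p) : pt).
  assert (TX : translation X) by reflexivity.
  set (p0 := ((0, 0), (0, 0)) : pt).
  assert (Im0 : forall t, Im (fst (move p0 dir_t t)) = t).
  { intros t; rewrite moveE; unfold Im; simpl; ring. }
  assert (E : p = move (move p0 dir_t (Im (fst p))) X 1).
  { rewrite !moveE; destruct p as [[x t] [y1 y2]]; unfold Im; simpl; apply pt_ext; ring. }
  assert (E1 : ((0, 1), (0, 0)) = move p0 dir_t 1) by (rewrite moveE; simpl; apply pt_ext; ring).
  rewrite {1}E Fib //; [|unfold HxC; rewrite Im0; exact Hp].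
  rewrite E1; set (t := Im (fst p)); assert (t0 : 0 < t) by exact Hp.
  assert (M : 0 < Rmin 1 t) by (apply Rmin_glb_lt; lra).
  assert (D : forall s, Rmin 1 t <= s -> is_derive (fun s => phi (move p0 dir_t s)) s 0).
  { intros s Hs; assert (Hq : HxC (move p0 dir_t s)) by (unfold HxC; rewrite Im0; lra).
    rewrite -(Z _ Hq); now apply smoothR_is_derive. }
  destruct (MVT_gen (fun s => phi (move p0 dir_t s)) 1 t (fun _ => 0)) as [c [_ Ec]].
  - intros s Hs; apply D; lra.
  - intros s Hs; apply continuity_pt_filterlim; apply: ex_derive_continuous; eexists; apply D; lra.
  - lra.
Qed.

Lemma dird_of_fibre_constant (phi : pt -> R) (X p : pt) : translation X -> HxC p ->
  (forall X p, translation X -> HxC p -> phi (move p X 1) = phi p) -> dird X phi p = 0.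
Proof.
  intros HX Hp Fib; apply dirR_eq.
  apply (is_derive_ext (fun _ => phi p)); [|apply @is_derive_const].
  intros s; set (Y := lincomb s X 0 X).
  assert (TY : translation Y) by now apply translation_lincomb.
  rewrite -(Fib Y p TY Hp); f_equal; unfold Y; rewrite move_lincomb Rmult_1_r Rmult_0_l move0; reflexivity.
Qed.

Definition lattice (a : 'I_3 -> R) (b : 'I_3 -> C) (i : 'I_3) : pt := ((a i, 0), b i).

Section InoueSurface.

Variables (M : 'M[int]_3) (alpha : R) (beta : C) (a : 'I_3 -> R) (b : 'I_3 -> C).
Hypothesis hM : determinant M = Posz 1.
Hypothesis halpha : 1 < alpha.
Hypothesis hbeta : beta <> Cconj beta.
Hypothesis ha : is_eigenvector M (RtoC alpha) (fun i => RtoC (a i)).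
Hypothesis hb : is_eigenvector M beta b.

Local Notation v0 := (lattice a b i0).
Local Notation v1 := (lattice a b i1).
Local Notation v2 := (lattice a b i2).

Lemma Im_beta : Im beta <> 0.
Proof. exact (proj1 (inoue_linear_algebra M alpha beta a b hM hbeta ha hb)). Qed.

Lemma volume : alpha * Cmod beta ^ 2 = 1.
Proof. exact (proj1 (proj2 (inoue_linear_algebra M alpha beta a b hM hbeta ha hb))). Qed.

Lemma beta_nonzero : beta <> RtoC 0.
Proof. intros E; apply Im_beta; now rewrite E. Qed.

Lemma lattice_span (X : pt) : translation X ->
  exists c0 c1 c2 : R, X = lincomb 1 (lincomb c0 v0 c1 v1) c2 v2.
Proof.
  intros HX.
  destruct (proj2 (proj2 (inoue_linear_algebra M alpha beta a b hM hbeta ha hb))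
    (fst (fst X)) (fst (snd X)) (snd (snd X))) as [c0 [c1 [c2 [E0 [E1 E2]]]]].
  exists c0, c1, c2; destruct X as [[x t] [y1 y2]]; unfold translation, Im in HX.
  unfold Re, Im in *; simpl in *.
  unfold lincomb, lattice, Cplus, Cmult, RtoC; simpl; apply pt_ext; rewrite ?E0 ?E1 ?E2 ?HX; ring.
Qed.

Lemma lattice_translation (i : 'I_3) : translation (lattice a b i).
Proof. reflexivity. Qed.

Definition lattice_periodic (F : pt -> C) : Prop := forall i, cperiod (lattice a b i) F.

Lemma csmooth_periodicI (F : pt -> C) : csmooth F -> lattice_periodic F -> csmooth_periodic v0 v1 v2 F.
Proof.
  intros [S1 S2] P; split; (split; [assumption|]); intros p Hp; unfold re_part, im_part;
    rewrite !P //.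
Qed.

(** By [rigidity] all derivatives along the fibres vanish, and the system then makes the
    t-derivatives vanish too. *)
Lemma solutions_constant (F G : pt -> C) (s c1 c2 : R) (mu nu : C) :
  csmooth F -> csmooth G -> lattice_periodic F -> lattice_periodic G ->
  mu <> RtoC 0 -> nu <> RtoC 0 -> automorphic F alpha beta mu -> automorphic G alpha beta nu ->
  / alpha < Cmod mu * Cmod nu / Cmod beta < alpha ^ 2 -> s * s = 1 -> 0 < c1 -> 0 < c2 ->
  elliptic_system s c1 c2 (re_part F) (im_part F) (re_part G) (im_part G) ->
  exists A B : C, forall p, HxC p -> F p = A /\ G p = B.
Proof.
  intros SF SG PF PG Hmu Hnu AF AG Hk Hs Hc1 Hc2 Sys.
  destruct (proj1 ha) as [i Hi]; destruct (proj1 hb) as [j Hj].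
  assert (Nwa : fst (fst (lattice a b i)) <> 0) by (simpl; intros E; apply Hi; now rewrite E).
  assert (R := fun X p => rigidity v0 v1 v2 (lattice_translation _) (lattice_translation _) (lattice_translation _)
    lattice_span F G s c1 c2 alpha beta mu nu (lattice a b i) (lattice a b j)
    (csmooth_periodicI F SF PF) (csmooth_periodicI G SG PG) halpha Im_beta volume Hmu Hnu AF AG Hk Hs Hc1 Hc2 Sys
    (lattice_translation _) (lattice_translation _) Nwa Hj (PF i) (PF j) (PG i) (PG j) X p).
  exists (F ((0, 1), (0, 0))), (G ((0, 1), (0, 0))).
  assert (FF1 : forall X p, translation X -> HxC p -> re_part F (move p X 1) = re_part F p).
  { intros X p HX Hp; unfold re_part; now rewrite (proj1 (R X p HX Hp)). }
  assert (FF2 : forall X p, translation X -> HxC p -> im_part F (move p X 1) = im_part F p).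
  { intros X p HX Hp; unfold im_part; now rewrite (proj1 (R X p HX Hp)). }
  assert (FG1 : forall X p, translation X -> HxC p -> re_part G (move p X 1) = re_part G p).
  { intros X p HX Hp; unfold re_part; now rewrite (proj2 (R X p HX Hp)). }
  assert (FG2 : forall X p, translation X -> HxC p -> im_part G (move p X 1) = im_part G p).
  { intros X p HX Hp; unfold im_part; now rewrite (proj2 (R X p HX Hp)). }
  assert (Tx : translation dir_x) by reflexivity.
  assert (T1 : translation dir_1) by reflexivity.
  assert (T2 : translation dir_2) by reflexivity.
  assert (DT : forall p, HxC p -> dird dir_t (re_part F) p = 0 /\ dird dir_t (im_part F) p = 0 /\
     dird dir_t (re_part G) p = 0 /\ dird dir_t (im_part G) p = 0).
  { intros p Hp; destruct (Sys p Hp) as [e1 [e2 [e3 e4]]].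
    rewrite e1 e2 e3 e4 !(dird_of_fibre_constant (re_part F)) // !(dird_of_fibre_constant (im_part F)) //
      !(dird_of_fibre_constant (re_part G)) // !(dird_of_fibre_constant (im_part G)) //.
    repeat split; ring. }
  destruct SF as [SF1 SF2], SG as [SG1 SG2].
  intros p Hp; split; apply injective_projections.
  - apply (constant_of_fibre_constant (re_part F)); trivial; intros q Hq; apply (DT q Hq).
  - apply (constant_of_fibre_constant (im_part F)); trivial; intros q Hq; apply (DT q Hq).
  - apply (constant_of_fibre_constant (re_part G)); trivial; intros q Hq; apply (DT q Hq).
  - apply (constant_of_fibre_constant (im_part G)); trivial; intros q Hq; apply (DT q Hq).
Qed.

Lemma weighted_periodic (g : C) (F : pt -> C) : lattice_periodic F ->
  lattice_periodic (fun q => tpow g q * F q)%C.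
Proof. intros P i p Hp; rewrite tpow_move // P //. Qed.

Lemma weighted_automorphic (g m : C) (F : pt -> C) : automorphic F alpha beta m ->
  automorphic (fun q => tpow g q * F q)%C alpha beta (Cexp (g * RtoC (ln alpha)) * m)%C.
Proof. intros A p Hp; rewrite A // tpow_scale_act //; [ring|lra]. Qed.

Lemma deck_act_lattice (i : 'I_3) (p : pt) :
  deck_act (Deck 1 (a i) (RtoC 1) (b i)) p = move p (lattice a b i) 1.
Proof.
  unfold deck_act, move, lattice; cbn [dp dq dr ds fst snd].
  replace (a i, 0) with (RtoC (a i)) by reflexivity; f_equal; ring.
Qed.

Lemma deck_act_g0 (p : pt) : deck_act (Deck alpha 0 beta (RtoC 0)) p = scale_act alpha beta p.
Proof. unfold deck_act, scale_act; cbn [dp dq dr ds]; f_equal; ring. Qed.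

Lemma Cconj_1 : Cconj (RtoC 1) = RtoC 1.
Proof. unfold Cconj, RtoC; simpl; f_equal; ring. Qed.

Lemma Cconj_neq0 (z : C) : z <> RtoC 0 -> Cconj z <> RtoC 0.
Proof.
  intros H; apply Cmod_gt_0; rewrite Cmod_conj; now apply Cmod_gt_0.
Qed.

(** Invariance is used for the generators. Under g_0 a coefficient acquires the inverse of the
    factor by which g_0 scales the basis form that it multiplies. *)
Lemma descends_data (omega : Defs.form) : descends (inoue_group alpha beta a b) omega ->
  let f q := fst (fst (omega q)) in let h q := snd (fst (omega q)) in
  let u q := fst (snd (omega q)) in let v q := snd (snd (omega q)) in
  (csmooth f /\ csmooth h /\ csmooth u /\ csmooth v) /\
  (lattice_periodic f /\ lattice_periodic h /\ lattice_periodic u /\ lattice_periodic v) /\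
  (automorphic f alpha beta (RtoC 1) /\ automorphic h alpha beta (/ (RtoC alpha * Cconj beta))%C /\
   automorphic u alpha beta (/ RtoC alpha)%C /\ automorphic v alpha beta (/ Cconj beta)%C).
Proof.
  intros [[S1 [S2 [S3 S4]]] Inv] f h u v.
  assert (a0 : RtoC alpha <> RtoC 0) by (apply RtoC_neq0; lra).
  assert (b0 : Cconj beta <> RtoC 0) by apply Cconj_neq0, beta_nonzero.
  split; [|split].
  - repeat split; now apply csmooth_smooth.
  - assert (L : forall i p, HxC p -> omega (move p (lattice a b i) 1) = omega p).
    { intros i p Hp; assert (E := Inv _ (inoue_gi alpha beta a b i) p Hp).
      unfold pullback in E; rewrite deck_act_lattice in E; cbn [dp dr] in E.
      rewrite Cconj_1 in E; rewrite -E.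
      destruct (omega (move p (lattice a b i) 1)) as [[x1 x2] [x3 x4]].
      (apply f_equal2; [apply f_equal2|apply f_equal2]); ring. }
    repeat split; intros i p Hp; unfold f, h, u, v; now rewrite L.
  - assert (L : forall p, HxC p -> omega p =
      ((f (scale_act alpha beta p), h (scale_act alpha beta p) * (RtoC alpha * Cconj beta)),
       (u (scale_act alpha beta p) * RtoC alpha, v (scale_act alpha beta p) * Cconj beta))%C).
    { intros p Hp; assert (E := Inv _ (inoue_g0 alpha beta a b) p Hp).
      unfold pullback in E; rewrite deck_act_g0 in E; cbn [dp dr] in E.
      rewrite -E; unfold f, h, u, v.
      now destruct (omega (scale_act alpha beta p)) as [[x1 x2] [x3 x4]]. }
    repeat split; intros p Hp.
    + unfold f at 2; rewrite (L p Hp); simpl; ring.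
    + unfold h at 2; rewrite (L p Hp); simpl; field; split; assumption.
    + unfold u at 2; rewrite (L p Hp); simpl; field; assumption.
    + unfold v at 2; rewrite (L p Hp); simpl; field; assumption.
Qed.

(** * Spectral points *)

Lemma automorphic_const (F : pt -> C) (P : R) (r m A : C) : 0 < P -> automorphic F P r m ->
  (forall p, HxC p -> F p = A) -> A <> RtoC 0 -> m = RtoC 1.
Proof.
  intros HP Aut E HA.
  assert (H0 : HxC ((0, 1), (0, 0))) by (unfold HxC, Im; simpl; lra).
  assert (X := Aut _ H0); rewrite (E _ (HxC_scale_act P r _ HP H0)) (E _ H0) in X.
  replace m with (m * A * / A)%C by (field; exact HA); rewrite -X; field; exact HA.
Qed.

Lemma form_nonzero_cases (omega : Defs.form) (p : pt) : omega p <> zero ->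
  (fst (omega p) <> (RtoC 0, RtoC 0) \/ snd (omega p) <> (RtoC 0, RtoC 0)).
Proof.
  intros H; destruct (classic (fst (omega p) = (RtoC 0, RtoC 0))) as [E1|]; [|now left].
  right; intros E2; apply H; now apply injective_projections.
Qed.

Lemma pair_nonzero_cases (x y : C) : (x, y) <> (RtoC 0, RtoC 0) -> x <> RtoC 0 \/ y <> RtoC 0.
Proof.
  intros H; destruct (classic (x = RtoC 0)) as [->|]; [|now left].
  right; intros ->; now apply H.
Qed.

Lemma exp_le_inv (x y : R) : exp x <= exp y -> x <= y.
Proof.
  intros [H|H]; [now left; apply exp_lt_inv|now right; apply exp_inv].
Qed.

Local Notation l := (ln alpha).

Lemma ln_alpha_pos : 0 < l.
Proof. rewrite -ln_1; apply ln_increasing; lra. Qed.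

Lemma exp_ln_alpha : exp l = alpha.
Proof. apply exp_ln; lra. Qed.

Lemma Cmod_beta : Cmod beta = exp (- (1 / 2) * l).
Proof.
  assert (V := volume).
  apply Rsqr_inj; [apply Cmod_ge_0|apply Rlt_le, exp_pos|].
  unfold Rsqr; rewrite -exp_plus.
  replace (- (1 / 2) * l + - (1 / 2) * l) with (- l) by field.
  rewrite exp_Ropp exp_ln_alpha.
  apply Rmult_eq_reg_l with alpha; [|lra]; rewrite Rinv_r; [rewrite -V; ring|lra].
Qed.

(** In both chiralities |mu nu / beta| is a power alpha^x; this is the window of
    [solutions_constant] in terms of x. *)
Lemma alpha_power_bounds (x y : R) : y = x * l -> -1 < x < 2 -> / alpha < exp y < alpha ^ 2.
Proof.
  assert (l0 := ln_alpha_pos); intros -> Hx.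
  replace (/ alpha) with (exp (- l)) by (rewrite exp_Ropp exp_ln_alpha //).
  replace (alpha ^ 2) with (exp (l + l)) by (rewrite exp_plus exp_ln_alpha; ring).
  split; apply exp_increasing; nra.
Qed.

Lemma alpha_beta_conj : (RtoC alpha * (beta * Cconj beta))%C = RtoC 1.
Proof.
  rewrite -Cmod2_conj -RtoC_mult (volume) //.
Qed.

Lemma Cmod_alpha : Cmod (RtoC alpha) = exp l.
Proof. rewrite Cmod_R Rabs_pos_eq ?exp_ln_alpha //; lra. Qed.

Lemma logz_scaled (logz : C) : logz = (logz / RtoC l * RtoC l)%C.
Proof. assert (H := ln_alpha_pos); field; apply RtoC_neq0; lra. Qed.

Lemma Re_scaled (x : C) : Re (x * RtoC l) = Re x * l.
Proof. destruct x; unfold Re; simpl; ring. Qed.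

(** Write alpha^c for the exponential of c ln alpha. Then z = alpha^(1/4) alpha^c, and the closed
    annulus is -1/2 <= Re c <= 0. F and G are constant, and a nonzero constant has multiplier 1: a
    nonzero F gives alpha^c = 1, a nonzero G gives alpha^c = 1 / (alpha conj beta) = beta. *)
Lemma plus_spectrum (z : C) : spectral_point_plus alpha beta a b z ->
  Rpower alpha (- (1 / 4)) <= Cmod z <= Rpower alpha (1 / 4) ->
  z = (RtoC (Rpower alpha (1 / 4)) * beta)%C \/ z = RtoC (Rpower alpha (1 / 4)).
Proof.
  intros [logz [Ez [omega [Des [Sec [[p0 [Hp0 Nz]] Ker]]]]]] Hz.
  assert (l0 := ln_alpha_pos); assert (bn := beta_nonzero).
  assert (bc : Cconj beta <> RtoC 0) by now apply Cconj_neq0.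
  assert (an : RtoC alpha <> RtoC 0) by (apply RtoC_neq0; lra).
  destruct (descends_data omega Des)
    as [[Sf [Sh [_ _]]] [[Pf [Ph [_ _]]] [Af [Ah [_ _]]]]].
  assert (Sys := plus_system alpha logz omega halpha Sf Sh Sec Ker).
  set (c := (logz / RtoC l - RtoC (1 / 4))%C) in Sys.
  assert (Ec : logz = (c * RtoC l + RtoC (1 / 4 * l))%C).
  { rewrite (logz_scaled logz) RtoC_mult; unfold c; ring. }
  assert (Rc : - (1 / 2) <= Re c <= 0).
  { rewrite -Ez Cmod_Cexp Ec in Hz; unfold Rpower in Hz.
    assert (R1 : Re (c * RtoC l + RtoC (1 / 4 * l)) = (Re c + 1 / 4) * l).
    { transitivity (Re (c * RtoC l) + 1 / 4 * l); [reflexivity|rewrite Re_scaled; ring]. }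
    rewrite R1 in Hz; destruct Hz as [Z1 Z2].
    apply exp_le_inv in Z1; apply exp_le_inv in Z2.
    apply Rmult_le_reg_r in Z1; [|exact l0]; apply Rmult_le_reg_r in Z2; [|exact l0]; lra. }
  clearbody c; cbv zeta in Sys.
  set (F := fun q => (tpow (- c) q * fst (fst (omega q)))%C) in Sys.
  set (G := fun q => (tpow (- c) q * snd (fst (omega q)))%C) in Sys.
  assert (AF := weighted_automorphic (- c)%C _ _ Af); fold F in AF.
  assert (AG := weighted_automorphic (- c)%C _ _ Ah); fold G in AG.
  set (k := Cexp (- c * RtoC l)%C) in AF, AG.
  assert (k0 : k <> RtoC 0) by apply Cexp_neq0.
  assert (kc : (k * Cexp (c * RtoC l))%C = RtoC 1).
  { unfold k; rewrite -Cexp_plus -Cexp_0; f_equal; ring. }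
  destruct (solutions_constant F G 1 4 1 (k * RtoC 1)%C
    (k * / (RtoC alpha * Cconj beta))%C) as [A [B AB]].
  - apply csmooth_mult; [apply csmooth_tpow|exact Sf].
  - apply csmooth_mult; [apply csmooth_tpow|exact Sh].
  - now apply weighted_periodic.
  - now apply weighted_periodic.
  - rewrite Cmult_1_r; exact k0.
  - apply Cmult_neq_0; [exact k0|].
    apply Cmod_gt_0; rewrite Cmod_inv; [apply Rinv_0_lt_compat, Cmod_gt_0|]; now apply Cmult_neq_0.
  - exact AF.
  - exact AG.
  (* Here |mu nu / beta| = alpha^(-2 Re c) lies between 1 and alpha, as alpha |beta|^2 = 1. *)
  - rewrite !Cmod_mult Cmod_inv; [|now apply Cmult_neq_0].
    rewrite Cmod_1 Cmod_mult Cmod_conj Cmod_beta Cmod_alpha; unfold k; rewrite Cmod_Cexp Re_scaled.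
    replace (Re (- c)) with (- Re c) by reflexivity.
    rewrite /Rdiv Rmult_1_r -!exp_plus -!exp_Ropp -!exp_plus.
    apply (alpha_power_bounds (- (2 * Re c))); [field|lra].
  - ring.
  - lra.
  - lra.
  - exact Sys.
  - destruct (form_nonzero_cases omega p0 Nz) as [N|N]; [|exfalso; apply N; now apply Sec].
    rewrite (surjective_pairing (fst (omega p0))) in N.
    assert (Ezz : z = (Cexp (c * RtoC l) * RtoC (Rpower alpha (1 / 4)))%C).
    { rewrite -Ez Ec Cexp_plus Cexp_RtoC; reflexivity. }
    destruct (pair_nonzero_cases _ _ N) as [N1|N1].
    + right.
      assert (A0 : A <> RtoC 0).
      { rewrite -(proj1 (AB p0 Hp0)); unfold F; apply Cmult_neq_0; [apply tpow_neq0|exact N1]. }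
      assert (K := automorphic_const F alpha beta _ A ltac:(lra) AF (fun p Hp => proj1 (AB p Hp)) A0).
      rewrite Cmult_1_r in K; rewrite K Cmult_1_l in kc; rewrite Ezz kc; ring.
    + left.
      assert (B0 : B <> RtoC 0).
      { rewrite -(proj2 (AB p0 Hp0)); unfold G; apply Cmult_neq_0; [apply tpow_neq0|exact N1]. }
      assert (K := automorphic_const G alpha beta _ B ltac:(lra) AG (fun p Hp => proj2 (AB p Hp)) B0).
      assert (Kk : k = (RtoC alpha * Cconj beta)%C).
      { replace k with (k * / (RtoC alpha * Cconj beta) * (RtoC alpha * Cconj beta))%C by (field; split; assumption).
        rewrite K; ring. }
      rewrite Kk in kc.
      assert (Ecb : Cexp (c * RtoC l) = beta).
      { replace (Cexp (c * RtoC l)) with (RtoC alpha * Cconj beta * Cexp (c * RtoC l) * / (RtoC alpha * Cconj beta))%C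
          by (field; split; assumption).
        rewrite kc -alpha_beta_conj; field; split; assumption. }
      rewrite Ezz Ecb; ring.
Qed.

(** F and G are again constant. A nonzero G would force Re c = 0, and a nonzero F would force
    |alpha^(-c)| = |beta|, that is Re c = 1/2: both lie on the boundary of the annulus. *)
Lemma minus_spectrum (z : C) : spectral_point_minus alpha beta a b z ->
  ~ (Rpower alpha (- (1 / 4)) < Cmod z < Rpower alpha (1 / 4)).
Proof.
  intros [logz [Ez [omega [Des [Sec [[p0 [Hp0 Nz]] Ker]]]]]] Hz.
  assert (l0 := ln_alpha_pos); assert (bn := beta_nonzero).
  assert (bc : Cconj beta <> RtoC 0) by now apply Cconj_neq0.
  assert (an : RtoC alpha <> RtoC 0) by (apply RtoC_neq0; lra).
  destruct (descends_data omega Des)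
    as [[_ [_ [Su Sv]]] [[_ [_ [Pu Pv]]] [_ [_ [Au Av]]]]].
  assert (Sys := minus_system alpha logz omega halpha Su Sv Sec Ker).
  set (c := (logz / RtoC l + RtoC (1 / 4))%C) in Sys.
  assert (Ec : logz = (c * RtoC l - RtoC (1 / 4 * l))%C).
  { rewrite (logz_scaled logz) RtoC_mult; unfold c; ring. }
  assert (Rc : 0 < Re c < 1 / 2).
  { rewrite -Ez Cmod_Cexp Ec in Hz; unfold Rpower in Hz.
    assert (R1 : Re (c * RtoC l - RtoC (1 / 4 * l)) = (Re c - 1 / 4) * l).
    { transitivity (Re (c * RtoC l) - 1 / 4 * l); [reflexivity|rewrite Re_scaled; ring]. }
    rewrite R1 in Hz; destruct Hz as [Z1 Z2].
    apply exp_lt_inv in Z1; apply exp_lt_inv in Z2.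
    apply Rmult_lt_reg_r in Z1; [|exact l0]; apply Rmult_lt_reg_r in Z2; [|exact l0]; lra. }
  clearbody c; cbv zeta in Sys.
  set (F := fun q => (tpow (- c) q * snd (snd (omega q)))%C) in Sys.
  set (G := fun q => (tpow (RtoC 1 - c) q * (RtoC (-1) * fst (snd (omega q))))%C) in Sys.
  assert (Au' : automorphic (fun q => RtoC (-1) * fst (snd (omega q)))%C alpha beta (/ RtoC alpha)%C).
  { intros q Hq; rewrite (Au q Hq); ring. }
  assert (Pu' : lattice_periodic (fun q => RtoC (-1) * fst (snd (omega q)))%C).
  { intros i q Hq; rewrite (Pu i q Hq); reflexivity. }
  assert (AF := weighted_automorphic (- c)%C _ _ Av); fold F in AF.
  assert (AG := weighted_automorphic (RtoC 1 - c)%C _ _ Au'); fold G in AG.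
  set (k := Cexp (- c * RtoC l)%C) in AF.
  assert (k0 : k <> RtoC 0) by apply Cexp_neq0.
  assert (mk : Cmod k = exp (- Re c * l)) by (unfold k; rewrite Cmod_Cexp Re_scaled; reflexivity).
  assert (Ek : (Cexp ((RtoC 1 - c) * RtoC l) * / RtoC alpha)%C = k).
  { replace ((RtoC 1 - c) * RtoC l)%C with (RtoC l + - c * RtoC l)%C by ring.
    rewrite Cexp_plus Cexp_RtoC exp_ln_alpha; fold k; field; exact an. }
  rewrite Ek in AG.
  destruct (solutions_constant F G (-1) 2 2
    (k * / Cconj beta)%C k) as [A [B AB]].
  - apply csmooth_mult; [apply csmooth_tpow|exact Sv].
  - apply csmooth_mult; [apply csmooth_tpow|apply csmooth_mult; [apply csmooth_const|exact Su]].
  - now apply weighted_periodic.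
  - now apply (weighted_periodic (RtoC 1 - c)%C (fun q => RtoC (-1) * fst (snd (omega q)))%C).
  - apply Cmult_neq_0; [exact k0|].
    apply Cmod_gt_0; rewrite Cmod_inv; [now apply Rinv_0_lt_compat, Cmod_gt_0|exact bc].
  - exact k0.
  - exact AF.
  - exact AG.
  (* Here |mu nu / beta| = alpha^(1 - 2 Re c) lies between 1 and alpha. *)
  - rewrite Cmod_mult Cmod_inv; [|exact bc].
    rewrite Cmod_conj Cmod_beta mk.
    rewrite /Rdiv -!exp_Ropp -!exp_plus.
    apply (alpha_power_bounds (1 - 2 * Re c)); [field|lra].
  - ring.
  - lra.
  - lra.
  - exact Sys.
  - destruct (form_nonzero_cases omega p0 Nz) as [N|N]; [exfalso; apply N; now apply Sec|].
    rewrite (surjective_pairing (snd (omega p0))) in N.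
    destruct (pair_nonzero_cases _ _ N) as [N1|N1].
    + assert (B0 : B <> RtoC 0).
      { rewrite -(proj2 (AB p0 Hp0)); unfold G; apply Cmult_neq_0; [apply tpow_neq0|].
        apply Cmult_neq_0; [apply RtoC_neq0; lra|exact N1]. }
      assert (K := automorphic_const G alpha beta _ B ltac:(lra) AG (fun p Hp => proj2 (AB p Hp)) B0).
      rewrite K Cmod_1 -exp_0 in mk; apply exp_inv in mk; nra.
    + assert (A0 : A <> RtoC 0).
      { rewrite -(proj1 (AB p0 Hp0)); unfold F; apply Cmult_neq_0; [apply tpow_neq0|exact N1]. }
      assert (K := automorphic_const F alpha beta _ A ltac:(lra) AF (fun p Hp => proj1 (AB p Hp)) A0).
      assert (Kk : k = Cconj beta).
      { replace k with (k * / Cconj beta * Cconj beta)%C by (field; exact bc).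
        rewrite K; ring. }
      rewrite Kk Cmod_conj Cmod_beta in mk; apply exp_inv in mk; nra.
Qed.

(** * Explicit kernel elements on the two boundary circles *)

Lemma csmooth_form (f h u v : pt -> C) : csmooth f -> csmooth h -> csmooth u -> csmooth v ->
  smooth_form (fun q => ((f q, h q), (u q, v q))).
Proof. intros; repeat split; now apply csmooth_smooth. Qed.

(** The kernel element is the function 1: its derivatives vanish, and logz = (ln alpha) / 4 makes
    the term 1/4 - lam zero. *)
Lemma plus_spectral_constant : spectral_point_plus alpha beta a b (RtoC (Rpower alpha (1 / 4))).
Proof.
  assert (l0 := ln_alpha_pos).
  exists (RtoC (1 / 4 * l)); split; [apply Cexp_RtoC|].
  exists (fun _ => ((RtoC 1, RtoC 0), (RtoC 0, RtoC 0))).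
  split; [split|split; [|split]].
  - apply (csmooth_form (fun _ => RtoC 1) (fun _ => RtoC 0) (fun _ => RtoC 0) (fun _ => RtoC 0)); apply csmooth_const.
  - intros g _ p _; unfold pullback; (apply f_equal2; apply f_equal2); ring.
  - intros p _; reflexivity.
  - exists ((0, 1), (0, 0)); split; [unfold HxC, Im; simpl; lra|].
    intros E; apply (f_equal (fun s => fst (fst s))) in E.
    change (RtoC 1 = RtoC 0) in E; injection E; lra.
  - intros p Hp.
    assert (E : forall q, HxC q -> spinor_of_form (fun _ => ((RtoC 1, RtoC 0), (RtoC 0, RtoC 0))) q
       = ((RtoC 1, RtoC 0), (RtoC 0, RtoC 0))).
    { intros q _; rewrite spinor_of_formE; cbn [fst snd]; (apply f_equal2; apply f_equal2); ring. }
    assert (D := fun i => dirS_ext (frame i p) p _ (fun _ => RtoC 1) (fun _ => RtoC 0) (fun _ => RtoC 0) (fun _ => RtoC 0) Hp E).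
    rewrite (twisted_dirac_frame alpha _ _ p _ _ _ _ _ _ _ _ _ _ _ _ _ _ _ _ _ _ _ _
      halpha Hp (E p Hp) (D 0%nat) (D 1%nat) (D 2%nat) (D 3%nat)).
    rewrite !dirC_const RtoC_quarter.
    assert (ln0 : RtoC l <> RtoC 0) by (apply RtoC_neq0; lra).
    replace (RtoC (1 / 4 * l) / RtoC l)%C with (RtoC (1 / 4)) by (rewrite RtoC_mult; field; exact ln0).
    change (zero : spinor) with ((RtoC 0, RtoC 0), (RtoC 0, RtoC 0)).
    (apply f_equal2; apply f_equal2); ring.
Qed.

Lemma im_w_deck_act (g : deck) (p : pt) : im_w (deck_act g p) = dp g * im_w p.
Proof. unfold im_w, deck_act, Im; simpl; ring. Qed.

Lemma Cconj_mult (x y : C) : Cconj (x * y)%C = (Cconj x * Cconj y)%C.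
Proof. destruct x, y; unfold Cconj, Cmult; simpl; apply f_equal2; ring. Qed.

(* The weight t^c of the (0,2)-form t^c conj(dw) /\ conj(dz) is chosen so that the
   action on conj(dw) /\ conj(dz), multiplication by p conj(r), is compensated. *)
Lemma inoue_group_weight (c : C) : Cexp (c * RtoC l)%C = beta ->
  forall g, inoue_group alpha beta a b g ->
  0 < dp g /\ dr g <> RtoC 0 /\
  (Cexp (c * RtoC (ln (dp g))) * (RtoC (dp g) * Cconj (dr g)))%C = RtoC 1.
Proof.
  intros Hc g Hg; assert (bn := beta_nonzero).
  induction Hg as [|i|g g' _ [P1 [R1 E1]] _ [P2 [R2 E2]]|g _ [P1 [R1 E1]]]; cbn [dp dr deck_comp deck_inv].
  - split; [lra|split; [exact bn|]].
    rewrite Hc -alpha_beta_conj; ring.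
  - split; [lra|split; [apply RtoC_neq0; lra|]].
    rewrite ln_1 Cmult_0_r Cexp_0 Cconj_1; ring.
  - split; [now apply Rmult_lt_0_compat|split; [now apply Cmult_neq_0|]].
    rewrite ln_mult // RtoC_plus RtoC_mult Cconj_mult Cmult_plus_distr_l Cexp_plus.
    replace (RtoC 1) with (RtoC 1 * RtoC 1)%C by ring; rewrite -{1}E1 -E2; ring.
  - assert (P0 : RtoC (dp g) <> RtoC 0) by (apply RtoC_neq0; lra).
    assert (C0 : Cconj (dr g) <> RtoC 0) by now apply Cconj_neq0.
    assert (Ci0 : Cconj (/ dr g)%C = (/ Cconj (dr g))%C).
    { replace (Cconj (/ dr g)%C) with (Cconj (/ dr g) * Cconj (dr g) * / Cconj (dr g))%C by (field; exact C0).
      rewrite -Cconj_mult; replace (/ dr g * dr g)%C with (RtoC 1) by (field; exact R1).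
      rewrite Cconj_1; ring. }
    split; [now apply Rinv_0_lt_compat|split].
    + apply Cmod_gt_0; rewrite Cmod_inv //; apply Rinv_0_lt_compat; now apply Cmod_gt_0.
    + rewrite ln_Rinv // RtoC_opp Ci0 RtoC_inv; [|lra].
      replace (c * - RtoC (ln (dp g)))%C with (- (c * RtoC (ln (dp g))))%C by ring.
      rewrite Cexp_opp.
      set (x := Cexp (c * RtoC (ln (dp g)))%C) in *.
      assert (x0 : x <> RtoC 0) by apply Cexp_neq0.
      transitivity (/ (x * (RtoC (dp g) * Cconj (dr g))))%C; [field; repeat split; assumption|].
      rewrite E1; field; apply RtoC_neq0; lra.
Qed.

(** The kernel element is t^c conj(dw) /\ conj(dz) with alpha^c = beta, invariant by
    [inoue_group_weight]. *)
Lemma plus_spectral_twisted : spectral_point_plus alpha beta a b (RtoC (Rpower alpha (1 / 4)) * beta)%C.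
Proof.
  assert (l0 := ln_alpha_pos); assert (bn := beta_nonzero).
  assert (ln0 : RtoC l <> RtoC 0) by (apply RtoC_neq0; lra).
  destruct (polar_form beta bn) as [lb Elb].
  set (c := (lb / RtoC l)%C).
  assert (Hc : Cexp (c * RtoC l)%C = beta) by (rewrite -Elb; f_equal; unfold c; field; exact ln0).
  exists (RtoC (1 / 4 * l) + c * RtoC l)%C; split.
  { rewrite Cexp_plus Hc Cexp_RtoC; reflexivity. }
  set (omega := fun q => ((RtoC 0, tpow c q), (RtoC 0, RtoC 0))).
  exists omega; split; [split|split; [|split]].
  - apply (csmooth_form (fun _ => RtoC 0) (tpow c) (fun _ => RtoC 0) (fun _ => RtoC 0));
      try apply csmooth_const; apply csmooth_tpow.
  - intros g Hg p Hp; destruct (inoue_group_weight c Hc g Hg) as [P0 [R0 E0]].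
    unfold pullback, omega; (apply f_equal2; apply f_equal2); try ring.
    unfold tpow; rewrite im_w_deck_act ln_mult // RtoC_plus Cmult_plus_distr_l Cexp_plus.
    transitivity (Cexp (c * RtoC (ln (dp g))) * (RtoC (dp g) * Cconj (dr g)) * Cexp (c * RtoC (ln (im_w p))))%C; [ring|].
    rewrite E0; ring.
  - intros p _; reflexivity.
  - exists ((0, 1), (0, 0)); split; [unfold HxC, Im; simpl; lra|].
    intros E; apply (f_equal (fun s => snd (fst s))) in E.
    exact (tpow_neq0 _ _ E).
  (* The unitary coefficient is 2 t^e; its derivative along e_1 contributes e, which cancels 1/4 +
     lam because lam = c + 1/4. *)
  - intros p Hp; set (e := (c + RtoC (1 / 2))%C).
    assert (E : forall q, HxC q -> spinor_of_form omega q
       = ((RtoC 0, RtoC 2 * tpow e q * RtoC 1), (RtoC 0, RtoC 0))%C).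
    { intros q Hq; rewrite spinor_of_formE; unfold omega, e; cbn [fst snd].
      rewrite (tpow_plus c) tpow_half // RtoC_mult.
      (apply f_equal2; apply f_equal2); ring. }
    assert (D := fun i => dirS_ext (frame i p) p _ (fun _ => RtoC 0) (fun q => RtoC 2 * tpow e q * RtoC 1)%C (fun _ => RtoC 0) (fun _ => RtoC 0) Hp E).
    rewrite (twisted_dirac_frame alpha _ _ p _ _ _ _ _ _ _ _ _ _ _ _ _ _ _ _ _ _ _ _
      halpha Hp (E p Hp) (D 0%nat) (D 1%nat) (D 2%nat) (D 3%nat)).
    destruct (dirC_weight_frame (RtoC 2) e (fun _ => RtoC 1) p (csmooth_const _) Hp) as [h0 [h1 [h2 h3]]].
    cbv zeta; rewrite h0 h1 h2 h3 !dirC_const RtoC_quarter.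
    replace ((RtoC (1 / 4 * l) + c * RtoC l) / RtoC l)%C with (c + RtoC (1 / 4))%C
      by (rewrite RtoC_mult; field; exact ln0).
    assert (Eh : e = (c + (RtoC (1 / 4) + RtoC (1 / 4)))%C) by (unfold e; rewrite -RtoC_plus; do 2 f_equal; field).
    set (w := tpow e p); rewrite Eh; clearbody w.
    change (zero : spinor) with ((RtoC 0, RtoC 0), (RtoC 0, RtoC 0)).
    (apply f_equal2; apply f_equal2); ring.
Qed.

Lemma Cmod_Rpower (x : R) : Cmod (RtoC (Rpower alpha x)) = Rpower alpha x.
Proof. rewrite Cmod_R Rabs_pos_eq //; apply Rlt_le, exp_pos. Qed.

Lemma Cmod_twisted_point :
  Cmod (RtoC (Rpower alpha (1 / 4)) * beta)%C = Rpower alpha (- (1 / 4)).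
Proof.
  rewrite Cmod_mult Cmod_Rpower Cmod_beta; unfold Rpower; rewrite -exp_plus; f_equal; field.
Qed.

Lemma quarter_lt : Rpower alpha (- (1 / 4)) < Rpower alpha (1 / 4).
Proof. apply Rpower_lt; lra. Qed.

End InoueSurface.

Theorem theorem1p1 (M : 'M[int]_3) (alpha : R) (beta : C)
    (a : 'I_3 -> R) (b : 'I_3 -> C)
    (hM : determinant M = Posz 1)
    (halpha : 1 < alpha)
    (hbeta : beta <> Cconj beta)
    (ha : is_eigenvector M (RtoC alpha) (fun i => RtoC (a i)))
    (hb : is_eigenvector M beta b) :
  (forall z : C,
     Rpower alpha (- (1 / 4)) < Cmod z < Rpower alpha (1 / 4) ->
     ~ spectral_point_plus alpha beta a b z /\
     ~ spectral_point_minus alpha beta a b z) /\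
  (forall z : C,
     Cmod z = Rpower alpha (- (1 / 4)) /\ spectral_point_plus alpha beta a b z <->
     z = (RtoC (Rpower alpha (1 / 4)) * beta)%C) /\
  (forall z : C,
     Cmod z = Rpower alpha (1 / 4) /\ spectral_point_plus alpha beta a b z <->
     z = RtoC (Rpower alpha (1 / 4))).
Proof.
  assert (PS := plus_spectrum M alpha beta a b hM halpha hbeta ha hb).
  assert (M1 := Cmod_twisted_point M alpha beta a b hM halpha hbeta ha hb).
  assert (M2 := Cmod_Rpower alpha (1 / 4)).
  assert (Q := quarter_lt alpha halpha).
  split; [|split].
  - intros z Hz; split; intros Sp.
    (* The two candidates have moduli alpha^(-1/4) and alpha^(1/4), so neither is in the open
       annulus. *)
    + destruct (PS z Sp ltac:(lra)) as [E|E]; rewrite E in Hz; lra.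
    + exact (minus_spectrum M alpha beta a b hM halpha hbeta ha hb z Sp Hz).
  - intros z; split.
    + intros [Hz Sp]; destruct (PS z Sp ltac:(lra)) as [E|E]; [exact E|rewrite E in Hz; lra].
    + intros ->; split; [exact M1|].
      exact (plus_spectral_twisted M alpha beta a b hM halpha hbeta ha hb).
  - intros z; split.
    + intros [Hz Sp]; destruct (PS z Sp ltac:(lra)) as [E|E]; [rewrite E in Hz; lra|exact E].
    + intros ->; split; [exact M2|].
      exact (plus_spectral_constant alpha beta a b halpha).
Qed.
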